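(* Let $(X,d,\mu)$ be a locally complete and separable metric measure space, where $\mu$ is a Borel measure on $X$ with $0<\mu(B)<\infty$ for every ball $B=B(x,r)$, $x\in X$, $0<r<\infty$. Let $E,F\subset X$ be two closed, non-empty, disjoint sets with $d(E,F)>0$. Then, for every $p\in[1,\infty)$, $$\mathrm{Cap}_p(E,F)=\mathrm{Cap}_p^{\mathrm{cont}}(E,F)=\mathrm{Cap}_p^{\mathrm{lip}}(E,F)=\mathrm{Cap}_p^{(\mathrm{lip},\mathrm{lip})}(E,F).$$
   Context: A metric space is locally complete if every point has a neighborhood that is complete in the restricted metric (equivalently, $X$ is an open subset of its completion). $d(E,F)=\inf_{a\in E,b\in F}d(a,b)$. For a rectifiable curve $\gamma$, $\int_\gamma g\,ds$ is the usual path integral, defined via the constant-speed parametrization of $\gamma$ on $[0,1]$. A Borel function $g:X\to[0,\infty]$ is an upper gradient of a function $u:X\to[-\infty,\infty]$ if for all rectifiable curves $\gamma:[0,1]\to X$ one has $|u(\gamma(0))-u(\gamma(1))|\le\int_\gamma g\,ds$, where the left-hand side is interpreted as $\infty$ if it has the form $|\infty-\infty|$ or $|-\infty-(-\infty)|$. For a collection $W$ of pairs $(u,g)$, where $u$ is a function on $X$ and $g$ is an upper gradient of $u$, set $$\mathrm{Cap}_p^W(E,F)=\inf\left\{\int_X g^p\,d\mu : (u,g)\in W,\ u|_E=0,\ u|_F=1\right\}$$ (with $\inf\emptyset=\infty$). $\mathrm{Cap}_p(E,F)$ is this quantity with $W$ the collection of all pairs $(u,g)$ with $g$ an upper gradient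 of $u$; $W=\mathrm{cont}$ consists of those pairs with $u$ continuous; $W=\mathrm{lip}$ of those pairs with $u$ locally Lipschitz; $W=(\mathrm{lip},\mathrm{lip})$ of those pairs with both $u$ and $g$ locally Lipschitz. A function is locally Lipschitz if every point has a neighborhood on which the function is (real-valued and) Lipschitz. *)

(* Defs.v *)
From HB Require Import structures.
From mathcomp Require Import all_boot all_order all_algebra.
From mathcomp Require Import all_classical all_reals all_analysis measurable_realfun.

Set Implicit Arguments.
Unset Strict Implicit.
Unset Printing Implicit Defensive.

Import Order.TTheory GRing.Theory Num.Theory.
Import numFieldNormedType.Exports.

Local Open Scope classical_set_scope.
Local Open Scope ring_scope.
Local Open Scope ereal_scope.

(* MathComp-Analysis requires a measurable space to be pointed, while metricType
   allows the empty space. *)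
#[short(type="pmetricType")]
HB.structure Definition PointedMetric (R : numDomainType) :=
  {M of Pointed M & Metric R M}.

Definition borel (R : realType) (X : pmetricType R) :=
  g_sigma_algebraType (@open X).

Section metric_spaces.
Context {R : realType} {X : pmetricType R}.

Definition separable_space := exists2 D : set X, countable D & dense D.

Definition complete_set (U : set X) :=
  forall x_ : nat -> X, (forall n, U (x_ n)) -> cauchy (x_ @ \oo) ->
    exists2 x, U x & x_ @ \oo --> x.

Definition locally_complete :=
  forall x : X, exists2 U, nbhs x U & complete_set U.

Definition set_dist (E F : set X) : \bar R :=
  ereal_inf [set (mdist ab.1 ab.2)%:E | ab in E `*` F].

Definition locally_lipschitz (f : X -> \bar R) :=
  forall x : X, exists2 U, nbhs x U &
    (forall y, U y -> f y \is a fin_num) /\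
    exists L : R, forall y z, U y -> U z ->
      (`|fine (f y) - fine (f z)| <= L * mdist y z)%R.

(* A curve [0, 1] -> X is given by a total function on R, of which only the
   values on [0, 1] matter. *)

Definition curve_length (gamma : R -> X) (a b : R) : \bar R :=
  ereal_sup [set (\sum_(0 <= i < size s)
      mdist (gamma (nth b (a :: s) i)) (gamma (nth b (a :: s) i.+1)))%R%:E
    | s in itv_partition a b].

Definition rectifiable (gamma : R -> X) :=
  {within `[0%R, 1%R], continuous gamma} /\ curve_length gamma 0%R 1%R < +oo.

(* The curve [0, 1] -> X whose value at t is the point that gamma reaches after
   having travelled the fraction t of its total length. For rectifiable gamma and
   t in [0, 1], the times s below exist because the length is continuous in s,
   and gamma takes the same value at all of them, so that the choice made by get
   is irrelevant. *)
Definition constant_speed (gamma : R -> X) (t : R) : X :=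
  gamma (get [set s : R | `[0%R, 1%R]%classic s /\
    curve_length gamma 0%R s = t%:E * curve_length gamma 0%R 1%R]).

(* The speed of constant_speed gamma is the length of gamma. *)
Definition path_integral (g : X -> \bar R) (gamma : R -> X) : \bar R :=
  curve_length gamma 0%R 1%R *
  \int[lebesgue_measure]_(t in `[0%R, 1%R]) g (constant_speed gamma t).

(* In \bar R both +oo - +oo and -oo - -oo are -oo, of absolute value +oo, which
   is the usual convention for upper gradients. *)
Definition upper_gradient (u g : X -> \bar R) :=
  [/\ measurable_fun [set: borel X] (g : borel X -> \bar R),
      forall x, 0 <= g x &
      forall gamma : R -> X, rectifiable gamma ->
        `|u (gamma 0%R) - u (gamma 1%R)| <= path_integral g gamma].

Definition W_all : set ((X -> \bar R) * (X -> \bar R)) :=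
  [set ug | upper_gradient ug.1 ug.2].

Definition W_cont := W_all `&` [set ug | continuous ug.1].

Definition W_lip := W_all `&` [set ug | locally_lipschitz ug.1].

Definition W_lip_lip :=
  W_all `&` [set ug | locally_lipschitz ug.1 /\ locally_lipschitz ug.2].

Definition Cap (mu : {measure set (borel X) -> \bar R}) (p : R)
    (W : set ((X -> \bar R) * (X -> \bar R))) (E F : set X) : \bar R :=
  ereal_inf [set \int[mu]_x (ug.2 x `^ p) | ug in W `&`
    [set ug | (forall x, E x -> ug.1 x = 0) /\ (forall x, F x -> ug.1 x = 1)]].

End metric_spaces.

Arguments separable_space {R} X.
Arguments locally_complete {R} X.

(* Main.v *)
Require Import Defs.
From mathcomp Require Import all_boot all_order all_algebra.
From mathcomp Require Import all_classical all_reals all_analysis.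
From mathcomp Require Import measurable_realfun ring lra.

(* Fix an admissible g in L^p, i.e. every rectifiable curve from E to F has
   g-length at least 1.  By Vitali-Caratheodory g may be enlarged, at small cost
   in L^p, to a lower semicontinuous function that is locally bounded below and
   that is at least k on an open set outside of which a large part of X is
   covered by finitely many balls of radius 1/k.  Let X_j be the complete sets
   {rho >= 2^-j} exhausting X and replace g by +oo outside X_j.  For Lipschitz
   g_n increasing to g, let u_n(x) be the infimum of sum g_n(x_i) d(x_i, x_i+1)
   over the discrete chains from E to x of mesh 1/(n+1): it is locally Lipschitz,
   it vanishes on E and g_n is an upper gradient of it.  The functions u_n tend
   to at least 1 uniformly on F: otherwise, there would be chains from E to F
   with smaller and smaller mesh and cost bounded by c < 1; since d(E, F) > 0,
   such chains stay close to totally bounded sets, so that an ultrafilter limit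
   of their parametrizations is a curve from E to F of g-length at most c.

   As j grows, the limits of the u_n decrease to a function u to which the u_n
   of each X_j can be compared in L^1.  Interpolating, on the layers between
   X_j and X_(j+1), between functions u_n chosen closer and closer to u gives a
   locally Lipschitz function whose upper gradient exceeds g by an error which
   is small in L^p. *)

Set Implicit Arguments.
Unset Strict Implicit.
Unset Printing Implicit Defensive.

Import Order.TTheory GRing.Theory Num.Theory.
Import numFieldNormedType.Exports.

Local Open Scope classical_set_scope.
Local Open Scope ring_scope.

(** * Real functions *)

(** Chains replace curves in the definition of u_n because nearby points need not be joined by a
    short curve, or by any curve; two points closer than the mesh are always joined by one chain
    step, which makes u_n locally Lipschitz.

    A single X_j does not suffice. Limit curves must stay in a complete set, which forces an
    infinite weight outside X_j; but there the g_n grow without bound, so their L^p norm is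
    uncontrolled. Hence j has to vary over the space, and functions belonging to different j must be
    compared.

    The case p = 1 is not special, as no weak compactness is used. The functions to be interpolated
    take values in [0, 1], so they converge in L^1 on sets of finite measure by dominated
    convergence, and a difference D <= 1 satisfies D^p <= D, which turns smallness in L^1 into
    smallness in L^p. The constants that the layers put in front of D are known in advance, so the
    layers can be chosen to absorb them.

    Since u_n reaches only some q < 1 on F, the glued function is divided by q and truncated at
    1. *)

Section real_line.
Context {R : realType}.
Implicit Types (f K Psi : R -> R) (a b x e : R).
Local Notation leb := (@lebesgue_measure R).

(** Real induction: the supremum of the points up to which [K] stays below [K a] can be pushed
    further unless it is [b]. Since [K] may be discontinuous, the hypothesis compares all ordered
    pairs near [x]. *)
Lemma locally_nonincreasing K a b : a <= b ->
  (forall x, a <= x <= b -> exists2 e, 0 < e &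
    forall r s, a <= r -> s <= b -> x - e < r -> s < x + e -> r <= s ->
      K s <= K r) ->
  K b <= K a.
Proof.
move=> ab loc.
pose S := [set t | a <= t <= b /\ forall r, a <= r <= t -> K r <= K a].
have Sa : S a.
  split; first by rewrite lexx.
  by move=> r ar; have -> : r = a by lra.
have ubS : ubound S b by move=> t [/andP[]].
have supS : has_sup S by split; [exists a | exists b].
have aS : a <= sup S by apply: ub_le_sup => //; exists b.
have Sb : sup S <= b by apply: ge_sup => //; exists a.
have [|e e0 he] := loc (sup S); first by rewrite aS.
have [t [/andP[at_ tb] ht] tS] := sup_adherent e0 supS.
pose t' := Num.min b (sup S + e / 2).
have t'b : t' <= b by rewrite ge_min lexx.
have t'S : t' <= sup S + e / 2 by rewrite ge_min lexx orbT.
have at' : a <= t' by rewrite le_min ab /=; lra.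
have h r : a <= r <= t' -> K r <= K a.
  move=> /andP[ar rt']; have [rt|tr] := leP r t; first by apply: ht; rewrite ar.
  apply: (le_trans (y := K t)); last by apply: ht; rewrite at_ lexx.
  by apply: he => //; lra.
have St' : S t' by split => //; rewrite at' t'b.
have := ub_le_sup (ex_intro _ b ubS) St'.
rewrite /t' ge_min => /orP[bS|]; last by lra.
apply: h; rewrite ab /= le_min lexx /=; lra.
Qed.

Lemma within_continuousP (T : pseudoMetricType R) (a b : R) (f : R -> T) :
  {within `[a, b], continuous f} <->
  forall x, a <= x <= b -> forall e, 0 < e -> exists2 d, 0 < d &
    forall y, a <= y <= b -> `|x - y| < d -> ball (f x) e (f y).
Proof.
split=> [/subspace_continuousP cf x xab e e0|cf].
  have xab' : `[a, b]%classic x by rewrite /= in_itv.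
  move/cvg_ballP : (cf x xab') => /(_ e e0).
  rewrite near_withinE => -[d /= d0 hd].
  by exists d => // y yab xy; apply: hd => //=; rewrite in_itv.
apply/subspace_continuousP => x; rewrite /= in_itv /= => xab.
apply/cvg_ballP => e e0; have [d d0 hd] := cf x xab e e0.
rewrite near_withinE.
by exists d => //= y xy; rewrite in_itv /= => yab; exact: hd.
Qed.

(** A mean value inequality: subtracting from [Psi] the primitive [H] of [f] and a small linear term
    leaves a locally nonincreasing function. It serves for upper gradients and, with signs reversed,
    for the cost along a limit curve. *)
Lemma integral_compare f Psi : {within `[0, 1], continuous f} ->
  (forall x, 0 <= x <= 1 -> forall e, 0 < e -> exists2 d, 0 < d &
    forall r s, 0 <= r -> s <= 1 -> x - d < r -> s < x + d -> r <= s ->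
      Psi s - Psi r <= (f x + e) * (s - r)) ->
  Psi 1 - Psi 0 <= Rintegral leb `[0, 1] f.
Proof.
move=> cf hPsi.
have intf : leb.-integrable `[0, 1] (EFin \o f).
  by apply: continuous_compact_integrable => //; exact: segment_compact.
pose H t : R := Rintegral leb `[0, t] f.
have HB r s : 0 <= r -> r <= s -> s <= 1 -> H s - H r = Rintegral leb `]r, s] f.
  move=> r0 rs s1; rewrite /H Rintegral_itvB ?bnd_simp//.
  by apply: integrableS intf => //; apply: subset_itvl; rewrite bnd_simp.
have H0 : H 0 = 0 by rewrite /H set_itv1 Rintegral_set1.
apply/ler_addgt0Pr => e e0.
suff : (Psi 1 - H 1 - e * 1) <= (Psi 0 - H 0 - e * 0).
  by rewrite H0 -/(H 1); lra.
apply: (@locally_nonincreasing (fun t => Psi t - H t - e * t)) => // x x01.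
have e20 : 0 < e / 2 by rewrite divr_gt0.
have [d d0 hd] := hPsi x x01 _ e20.
have [d' d'0 hd'] := (within_continuousP _ _ _).1 cf x x01 _ e20.
exists (Num.min d d') => [|r s r0 s1]; first by rewrite lt_min d0.
rewrite ltrBlDl -ltrBlDr lt_min => /andP[xrd xrd'].
rewrite -ltrBlDl lt_min => /andP[sxd sxd'] rs.
have {}hd : Psi s - Psi r <= (f x + e / 2) * (s - r) by apply: hd => //; lra.
suff : (f x - e / 2) * (s - r) <= H s - H r by lra.
rewrite HB//.
have -> : (f x - e / 2) * (s - r) = Rintegral leb `]r, s] (cst (f x - e / 2)).
  rewrite Rintegral_cst//= lebesgue_measure_itv /= lte_fin.
  case: ltP => [//|sr]; have -> : s = r by lra.
  by rewrite subrr mulr0.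
apply: le_Rintegral => //.
- have : leb.-integrable `[r, s] (EFin \o cst (f x - e / 2)).
    apply: continuous_compact_integrable; first exact: segment_compact.
    by move=> ?; exact: cvg_cst.
  by apply: integrableS => //; exact: subset_itv_oc_cc.
- apply: integrableS intf => //; move=> y /=; rewrite !in_itv /=; lra.
- move=> y /=; rewrite in_itv /= => /andP[ry ys].
  have := hd' y; rewrite /ball /= ltr_norml ltr_norml => h.
  have : (0 <= y <= 1) by lra.
  by move/h; lra.
Qed.

End real_line.

(** * Length of curves *)

Section metric.
Context {R : realType} {X : pmetricType R}.
Implicit Types (x y z : X) (U : set X).

Lemma nbhs_mdist x U :
  nbhs x U <-> exists2 e : R, 0 < e & forall y, mdist x y < e -> U y.
Proof.
split=> [/nbhs_ballP[e /= e0 he]|[e e0 he]].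
  by exists e => // y xy; apply: he; rewrite ballEmdist.
by apply/nbhs_ballP; exists e => // y; rewrite ballEmdist => /he.
Qed.

Lemma mdist_diff x y z : `|mdist x z - mdist y z| <= mdist x y.
Proof.
have := metric_triangle x y z; have := metric_triangle y x z.
by rewrite (metric_sym y x) ler_norml; lra.
Qed.

Lemma cauchy_mdist (x : nat -> X) : cauchy (x @ \oo) <->
  forall e : R, 0 < e -> exists N, forall m n, (N <= m)%N -> (N <= n)%N ->
    mdist (x m) (x n) < e.
Proof.
split=> [/cauchy_ballP cx e e0|cx].
  have [[A B] /= [[N1 _ h1] [N2 _ h2]] h] := cx e e0.
  exists (maxn N1 N2) => m n; rewrite !geq_max => /andP[m1 _] /andP[_ n2].
  have /h : (A `*` B) (x m, x n) by split; [exact: h1 | exact: h2].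
  by rewrite /= ballEmdist.
apply/cauchy_ballP => e e0; have [N h] := cx e e0.
exists (x @` [set n | (N <= n)%N], x @` [set n | (N <= n)%N]).
  by split; exists N => // n mn; exists n.
by move=> [_ _] [[i mi <-] [j mj <-]]; rewrite /= ballEmdist; exact: h.
Qed.

Lemma cvg_mdistP (x : nat -> X) z : x @ \oo --> z <->
  forall e : R, 0 < e -> exists N, forall n, (N <= n)%N -> mdist z (x n) < e.
Proof.
split=> [xz e e0|xz].
  have [N _ h] := metricType_numDomainType.cvgr_dist_lt xz e0.
  by exists N => n Nn; exact: h.
apply/metricType_numDomainType.cvgrPdist_lt => e e0.
by have [N h] := xz e e0; exists N.
Qed.

End metric.

Section polygonal_length.
Context {R : realType} {X : pmetricType R}.
Variable gamma : R -> X.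
Implicit Types (a b c t v : R) (s : seq R).

(** Recursive form of the sum in [curve_length], suited to induction on the partition and free of
    the default value of [nth]. *)
Fixpoint polygon_length a s : R :=
  if s is b :: s' then mdist (gamma a) (gamma b) + polygon_length b s' else 0.

Local Notation plen := polygon_length.

Lemma polygon_lengthE a b s :
  \sum_(0 <= i < size s)
    mdist (gamma (nth b (a :: s) i)) (gamma (nth b (a :: s) i.+1)) = plen a s.
Proof.
elim: s a => [|x s IH] a; first by rewrite big_nil.
by rewrite /= big_nat_recl//= -IH.
Qed.

Lemma curve_lengthE a b : curve_length gamma a b =
  ereal_sup [set (plen a s)%:E | s in itv_partition a b].
Proof.
by congr ereal_sup; apply: eq_imagel => s _ /=; rewrite polygon_lengthE.
Qed.

Lemma polygon_length_ge0 a s : 0 <= plen a s.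
Proof. by elim: s a => //= x s IH a; rewrite addr_ge0// mdist_ge0. Qed.

Lemma polygon_length_cat a s1 s2 :
  plen a (s1 ++ s2) = plen a s1 + plen (last a s1) s2.
Proof. by elim: s1 a => [|x s IH] a /=; rewrite ?add0r// IH addrA. Qed.

Lemma polygon_length_rcons a s b :
  plen a (rcons s b) = plen a s + mdist (gamma (last a s)) (gamma b).
Proof. by rewrite -cats1 polygon_length_cat/= addr0. Qed.

(** Inserting the vertex [b] does not shorten the polygon, by the triangle inequality. Partitions
    are strictly increasing, so [b] is inserted only if it is not a vertex already. *)
Lemma itv_partition_split a b s : path <%R a s -> a <= b -> b <= last a s ->
  exists s1 s2, [/\ itv_partition a b s1, itv_partition b (last a s) s2 &
    plen a s <= plen a s1 + plen b s2].
Proof.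
elim: s a => [|x s IH] a /=.
  move=> _ ab ba; have -> : b = a by lra.
  by exists [::], [::]; split; rewrite /itv_partition /= ?addr0.
move=> /andP[ax xs] ab bx; have [xb|bltx] := leP x b.
  have [s1 [s2 [[p1 l1] p2 h]]] := IH x xs xb bx.
  exists (x :: s1), s2; split=> //; first by split=> //=; rewrite ax.
  by rewrite /= -addrA lerD2l.
have [altb|bltea] := ltP a b.
  exists [:: b], (x :: s); split; rewrite /itv_partition/= ?altb ?bltx ?eqxx//.
  by rewrite addr0 addrA lerD2r metric_triangle.
have -> : b = a by lra.
exists [::], (x :: s); split; rewrite /itv_partition/= ?ax ?eqxx//.
by rewrite add0r.
Qed.

Lemma itv_partition_seg a b : a <= b ->
  exists2 s, itv_partition a b s & plen a s = mdist (gamma a) (gamma b).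
Proof.
rewrite le_eqVlt => /predU1P[<-|ab].
  by exists [::]; rewrite /= ?mdistxx//; split=> /=.
by exists [:: b]; rewrite /= ?addr0//; split; rewrite /= ?ab.
Qed.

Lemma itv_partition_ge a b s : itv_partition a b s -> a <= b.
Proof.
move=> [p /eqP <-]; elim: s a p => //= x s IH a /andP[ax /IH]; exact/le_trans/ltW.
Qed.

Definition length_on a b : R := sup [set plen a s | s in itv_partition a b].

Hypothesis rect : curve_length gamma 0 1 \is a fin_num.

(** Partitions of [[0, a]] and [[b, 1]] extend one of [[a, b]] to one of [[0, 1]], so the total
    length bounds all polygons. *)
Lemma polygon_length_bounded a b : 0 <= a -> a <= b -> b <= 1 ->
  has_sup [set plen a s | s in itv_partition a b].
Proof.
move=> a0 ab b1; split.
  by have [s ps _] := itv_partition_seg ab; exists (plen a s), s.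
exists (fine (curve_length gamma 0 1)) => _ [s ps <-].
have [s0 ps0 _] := itv_partition_seg a0.
have [s1 ps1 _] := itv_partition_seg b1.
rewrite -lee_fin fineK// curve_lengthE; apply: ereal_sup_ge.
exists (plen 0 ((s0 ++ s) ++ s1))%:E.
  by exists ((s0 ++ s) ++ s1) => //;
    exact: itv_partition_cat (itv_partition_cat ps0 ps) ps1.
have [_ /eqP l0] := ps0.
rewrite !polygon_length_cat l0 lee_fin.
by have := polygon_length_ge0 0 s0; have := polygon_length_ge0 (last 0 (s0 ++ s)) s1; lra.
Qed.

Lemma polygon_le_length a b s : 0 <= a -> b <= 1 -> itv_partition a b s ->
  plen a s <= length_on a b.
Proof.
move=> a0 b1 ps; apply: ub_le_sup; last by exists s.
by apply: (polygon_length_bounded a0 _ b1).2; exact: itv_partition_ge ps.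
Qed.

Lemma mdist_le_length a b : 0 <= a -> a <= b -> b <= 1 ->
  mdist (gamma a) (gamma b) <= length_on a b.
Proof.
by move=> a0 ab b1; have [s ps <-] := itv_partition_seg ab; exact: polygon_le_length.
Qed.

Lemma length_on_ge0 a b : 0 <= a -> a <= b -> b <= 1 -> 0 <= length_on a b.
Proof.
by move=> a0 ab b1; apply: le_trans (mdist_le_length a0 ab b1); rewrite mdist_ge0.
Qed.

Lemma length_on_le a b M : 0 <= a -> a <= b -> b <= 1 ->
  (forall s, itv_partition a b s -> plen a s <= M) -> length_on a b <= M.
Proof.
move=> a0 ab b1 h; apply: ge_sup => [|_ [s ps <-]]; last exact: h.
exact: (polygon_length_bounded a0 ab b1).1.
Qed.

Lemma length_on_gt a b v : 0 <= a -> a <= b -> b <= 1 -> v < length_on a b ->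
  exists2 s, itv_partition a b s & v < plen a s.
Proof.
move=> a0 ab b1 h.
have [_ [s ps <-] hs] := sup_gt (polygon_length_bounded a0 ab b1).1 h.
by exists s.
Qed.

Lemma curve_length_fin a b : 0 <= a -> a <= b -> b <= 1 ->
  curve_length gamma a b = (length_on a b)%:E.
Proof.
move=> a0 ab b1; rewrite curve_lengthE.
rewrite -(@image_comp _ _ _ (plen a) EFin) ereal_sup_EFin//.
- exact: (polygon_length_bounded a0 ab b1).2.
- exact: (polygon_length_bounded a0 ab b1).1.
Qed.

Lemma length_onD a b c : 0 <= a -> a <= b -> b <= c -> c <= 1 ->
  length_on a c = length_on a b + length_on b c.
Proof.
move=> a0 ab bc c1; have ac := le_trans ab bc.
have b0 := le_trans a0 ab; have b1 := le_trans bc c1.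
apply/eqP; rewrite eq_le; apply/andP; split.
  apply: length_on_le => // s [ps /eqP ls].
  have [|s1 [s2 [p1 p2 h]]] := itv_partition_split ps ab; first by rewrite ls.
  rewrite ls in p2; apply: (le_trans h).
  by apply: lerD; apply: polygon_le_length.
rewrite -lerBrDr; apply: length_on_le => // s1 p1.
rewrite lerBrDr addrC -lerBrDr; apply: length_on_le => // s2 p2.
rewrite lerBrDr addrC; have [_ /eqP l1] := p1.
rewrite -[X in plen X s2]l1 -polygon_length_cat; apply: polygon_le_length => //.
exact: itv_partition_cat p2.
Qed.

Lemma length_on_xx a : 0 <= a -> a <= 1 -> length_on a a = 0.
Proof. by move=> a0 a1; have := length_onD a0 (lexx a) (lexx a) a1; lra. Qed.

(** The value is attained at the supremum of the times with length at most [v]: lower semicontinuity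
    of length excludes a larger value there, and a smaller one is excluded because a nearly optimal
    polygon leaves little length for a short initial arc. *)
Lemma length_on_onto v :
  {within `[0, 1], continuous gamma} -> 0 <= v -> v <= length_on 0 1 ->
  exists2 t, 0 <= t <= 1 & length_on 0 t = v.
Proof.
move=> cg0 v0 vl; have cg := (within_continuousP 0 1 gamma).1 cg0.
have {}cg t e : 0 <= t <= 1 -> 0 < e -> exists2 d, 0 < d &
    forall r, 0 <= r <= 1 -> `|t - r| < d -> mdist (gamma t) (gamma r) < e.
  move=> t01 e0; have [d d0 hd] := cg t t01 e e0.
  by exists d => // r r01 tr; have := hd r r01 tr; rewrite ballEmdist.
pose S := [set t | 0 <= t <= 1 /\ length_on 0 t <= v].
have S0 : S 0 by split; rewrite ?lexx ?ler01 ?length_on_xx.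
have ubS : ubound S 1 by move=> t [/andP[]].
have supS : has_sup S by split; [exists 0 | exists 1].
have t0 : 0 <= sup S by apply: ub_le_sup => //; exists 1.
have t1 : sup S <= 1 by apply: ge_sup => //; exists 0.
have t01 : 0 <= sup S <= 1 by rewrite t0.
exists (sup S) => //; apply/eqP; rewrite eq_le; apply/andP; split.
  rewrite leNgt; apply/negP => h.
  have [s [ps /eqP ls] vs] := length_on_gt (lexx 0) t0 t1 h.
  (* The last vertex of a polygon longer than [v] is moved back to a time [t] of [S]; by continuity
     the polygon remains longer than [v]. *)
  case/lastP: s ps ls vs => [|s x]; first by move=> _ _ /=; lra.
  rewrite rcons_path last_rcons polygon_length_rcons => /andP[ps sx] xS.
  move: sx; rewrite xS => sS vs.
  have e0 : 0 < plen 0 s + mdist (gamma (last 0 s)) (gamma (sup S)) - v by lra.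
  have [d d0 hd] := cg _ _ t01 e0.
  have m0 : 0 < Num.min d (sup S - last 0 s) by rewrite lt_min d0; lra.
  have [t [/andP[tge0 tle1] tv]] := sup_adherent m0 supS.
  rewrite ltrBlDl -ltrBlDr lt_min => /andP[td ts].
  have tS : t <= sup S by apply: ub_le_sup; [exists 1|split=> //; rewrite tge0].
  have := hd t; rewrite tge0 tle1 ger0_norm ?subr_ge0// => /(_ isT).
  have -> : sup S - t < d by lra.
  move=> /(_ isT) hdt.
  have := @polygon_le_length 0 t (rcons s t) (lexx 0) tle1.
  rewrite polygon_length_rcons => hl.
  have {}hl : plen 0 s + mdist (gamma (last 0 s)) (gamma t) <= length_on 0 t.
    by apply: hl; split; rewrite ?rcons_path ?last_rcons// ps /=; lra.
  have := metric_triangle (gamma (last 0 s)) (gamma t) (gamma (sup S)).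
  by rewrite (metric_sym (gamma t)); lra.
rewrite leNgt; apply/negP => h.
have S1 : sup S < 1.
  by rewrite lt_neqAle t1 andbT; apply/eqP => S1; move: h; rewrite S1; lra.
have e0 : 0 < (v - length_on 0 (sup S)) / 2 by lra.
have [d d0 hd] := cg _ _ t01 e0.
(* A polygon [x :: s] is optimal up to half the gap, and a time [t] before [x] moves [gamma] by less
   than the other half, so the arc from [sup S] to [t] is shorter than the gap. *)
have : length_on (sup S) 1 - (v - length_on 0 (sup S)) / 2 < length_on (sup S) 1.
  by lra.
move=> /(length_on_gt t0 t1 (lexx 1)) [[|x s] [ps /eqP ls] hs].
  by move: ls S1 => /= ->; rewrite ltxx.
move: ps ls hs => /= /andP[Sx xs] ls hs.
pose t := sup S + Num.min (x - sup S) d / 2.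
have m1 : 0 < Num.min (x - sup S) d by rewrite lt_min d0; lra.
have m2 : Num.min (x - sup S) d <= x - sup S by rewrite ge_min lexx.
have m3 : Num.min (x - sup S) d <= d by rewrite ge_min lexx orbT.
have x1 : x <= 1 by apply: (@itv_partition_ge _ _ s); split=> //; apply/eqP.
have tS : sup S < t by rewrite /t; lra.
have tx : t < x by rewrite /t; lra.
have tle1 : t <= 1 by lra.
have tge0 : 0 <= t by lra.
have hdt : mdist (gamma (sup S)) (gamma t) < (v - length_on 0 (sup S)) / 2.
  apply: hd; first by rewrite tge0.
  by rewrite ltr0_norm ?subr_lt0// /t; lra.
have ht : mdist (gamma t) (gamma x) + plen x s <= length_on t 1.
  apply: (@polygon_le_length _ _ (x :: s)) => //.
  by split=> /=; [rewrite tx | apply/eqP].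
have := metric_triangle (gamma (sup S)) (gamma t) (gamma x).
have := length_onD t0 (ltW tS) tle1 (lexx 1).
have := length_onD (lexx 0) t0 (ltW tS) tle1.
move=> e1 e2 e3.
have : t <= sup S.
  by apply: ub_le_sup; [exists 1 | split; [rewrite tge0|lra]].
by lra.
Qed.

End polygonal_length.

Section constant_speed_curves.
Context {R : realType} {X : pmetricType R}.
Variable gamma : R -> X.
Hypothesis rect : rectifiable gamma.
Implicit Types (s t : R).
Local Notation leb := (@lebesgue_measure R).
Local Notation ell := (length_on gamma 0 1).
Local Notation cs := (constant_speed gamma).

Lemma rectifiable_fin : curve_length gamma 0 1 \is a fin_num.
Proof.
rewrite fin_numElt rect.2 andbT; apply: (@lt_le_trans _ _ 0%E) => //.
have [s ps _] := itv_partition_seg gamma (@ler01 R).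
rewrite curve_lengthE; apply: ereal_sup_ge; exists (polygon_length gamma 0 s)%:E.
  by exists s.
by rewrite lee_fin polygon_length_ge0.
Qed.
Let fin := rectifiable_fin.

Lemma curve_length_length : curve_length gamma 0 1 = ell%:E.
Proof. exact: curve_length_fin. Qed.

Lemma rectifiable_length_ge0 : 0 <= ell.
Proof. exact: length_on_ge0. Qed.

(** Names the choice made in [constant_speed]: [constant_speed gamma t] unfolds to
    [gamma (arc_time t)]. *)
Definition arc_time t : R := get [set s : R | `[0, 1]%classic s /\
    curve_length gamma 0 s = (t%:E * curve_length gamma 0 1)%E].

Lemma arc_timeP t : 0 <= t <= 1 ->
  0 <= arc_time t <= 1 /\ length_on gamma 0 (arc_time t) = t * ell.
Proof.
move=> /andP[t0 t1]; have l0 := rectifiable_length_ge0.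
have [||s /andP[s0 s1] hs] := length_on_onto (v := t * ell) fin rect.1.
- exact: mulr_ge0.
- exact: ler_piMl.
have : [set s : R | `[0, 1]%classic s /\
    curve_length gamma 0 s = (t%:E * curve_length gamma 0 1)%E] s.
  split; first by rewrite /= in_itv /= s0.
  by rewrite !(curve_length_fin fin)// hs.
move=> /getI; rewrite -/(arc_time t) /= in_itv /= => -[/andP[T0 T1]].
by rewrite !(curve_length_fin fin)// => -[->]; rewrite T0.
Qed.

Lemma length_on_mono s t : 0 <= s -> s <= t -> t <= 1 ->
  length_on gamma 0 s <= length_on gamma 0 t.
Proof.
move=> s0 st t1; rewrite (length_onD fin (lexx 0) s0 st t1) lerDl.
exact: length_on_ge0.
Qed.

Lemma arc_time_mono s t : 0 < ell -> 0 <= s -> s <= t -> t <= 1 ->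
  arc_time s <= arc_time t.
Proof.
move=> l0 s0; rewrite le_eqVlt => /predU1P[->//|st] t1.
have [/andP[a1 a2] ea] : 0 <= arc_time s <= 1 /\ _ := @arc_timeP s ltac:(lra).
have [/andP[b1 b2] eb] : 0 <= arc_time t <= 1 /\ _ := @arc_timeP t ltac:(lra).
rewrite leNgt; apply/negP => h.
have := length_on_mono b1 (ltW h) a2; rewrite ea eb ler_pM2r//; lra.
Qed.

(** The consequence that matters is that [gamma s] depends only on the length reached at [s], so
    that every choice of [arc_time] yields the same curve. *)
Lemma mdist_le_lengthB s t : 0 <= s <= 1 -> 0 <= t <= 1 ->
  mdist (gamma s) (gamma t) <= `|length_on gamma 0 s - length_on gamma 0 t|.
Proof.
wlog st : s t / s <= t => [h s01 t01|/andP[s0 s1] /andP[t0 t1]].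
  have [/h|/ltW/h] := leP s t; first exact.
  by rewrite metric_sym distrC; exact.
rewrite (length_onD fin (lexx 0) s0 st t1) opprD addNKr normrN.
by rewrite ger0_norm ?length_on_ge0// mdist_le_length.
Qed.

Lemma constant_speed_lip s t : 0 <= s <= 1 -> 0 <= t <= 1 ->
  mdist (cs s) (cs t) <= ell * `|s - t|.
Proof.
move=> s01 t01; have [a ea] := arc_timeP s01; have [b eb] := arc_timeP t01.
apply: (le_trans (mdist_le_lengthB a b)).
by rewrite ea eb -mulrBl normrM mulrC (ger0_norm rectifiable_length_ge0).
Qed.

Lemma constant_speed_length s : 0 < ell -> 0 <= s <= 1 ->
  cs (length_on gamma 0 s / ell) = gamma s.
Proof.
move=> l0 /andP[s0 s1].
have r01 : 0 <= length_on gamma 0 s / ell <= 1.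
  by rewrite divr_ge0 ?length_on_ge0//= ler_pdivrMr// mul1r length_on_mono.
have [a ea] := arc_timeP r01.
apply: mdist_positivity; apply/eqP; rewrite eq_le mdist_ge0 andbT.
apply: (le_trans (mdist_le_lengthB a _)); first by rewrite s0.
by rewrite ea divfK ?gt_eqF// subrr normr0.
Qed.

Lemma constant_speed0 : cs 0 = gamma 0.
Proof.
have [a ea] : 0 <= arc_time 0 <= 1 /\ _ := @arc_timeP 0 ltac:(lra).
apply: mdist_positivity; apply/eqP; rewrite eq_le mdist_ge0 andbT.
apply: (le_trans (mdist_le_lengthB a _)); first by rewrite lexx ler01.
by rewrite ea mul0r length_on_xx// subrr normr0.
Qed.

Lemma constant_speed1 : cs 1 = gamma 1.
Proof.
have [a ea] : 0 <= arc_time 1 <= 1 /\ _ := @arc_timeP 1 ltac:(lra).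
apply: mdist_positivity; apply/eqP; rewrite eq_le mdist_ge0 andbT.
apply: (le_trans (mdist_le_lengthB a _)); first by rewrite lexx ler01.
by rewrite ea mul1r subrr normr0.
Qed.

Lemma constant_speed_continuous : {within `[0, 1], continuous cs}.
Proof.
apply/(within_continuousP 0 1 cs) => x x01 e e0.
have l0 := rectifiable_length_ge0.
have l1 : 0 < ell + 1 by lra.
exists (e / (ell + 1)) => [|y y01 xy]; first exact: divr_gt0.
rewrite ballEmdist /=; apply: (le_lt_trans (constant_speed_lip x01 y01)).
move: xy; rewrite ltr_pdivlMr//; have := normr_ge0 (x - y); nra.
Qed.

Lemma continuous_constant_speed (phi : X -> R) : continuous phi ->
  {within `[0, 1], continuous (phi \o cs)}.
Proof.
move=> cphi; apply/subspace_continuousP => x x01.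
have /subspace_continuousP/(_ x x01) h := constant_speed_continuous.
exact: cvg_comp h (cphi _).
Qed.

Lemma path_integralE (phi : X -> R) : continuous phi ->
  path_integral (EFin \o phi) gamma =
  (ell * Rintegral leb `[0, 1] (phi \o cs))%:E.
Proof.
move=> cphi; rewrite /path_integral curve_length_length EFinM; congr (_ * _)%E.
rewrite /Rintegral fineK//; apply: integrable_fin_num => //.
apply: continuous_compact_integrable; first exact: segment_compact.
exact: continuous_constant_speed.
Qed.

End constant_speed_curves.

(** * Upper gradients from pointwise Lipschitz bounds *)

Section upper_gradients.
Context {R : realType} {X : pmetricType R}.
Implicit Types (v w h k : X -> R).

Definition real_locally_lipschitz v := forall x, exists2 e : R, 0 < e &
  exists L : R, forall y z, mdist x y < e -> mdist x z < e ->
    `|v y - v z| <= L * mdist y z.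

(* The pointwise asymptotic Lipschitz constant of v is at most h. *)
Definition asymptotic_lip_le v h := forall x (e : R), 0 < e ->
  exists2 r : R, 0 < r & forall y z, mdist x y < r -> mdist x z < r ->
    `|v y - v z| <= (h x + e) * mdist y z.

Lemma locally_lipschitz_continuous v : real_locally_lipschitz v -> continuous v.
Proof.
move=> lv x; apply/cvgrPdist_lt => e e0; have [r r0 [L hL]] := lv x.
have L0 : 0 < `|L| + 1 by have := normr_ge0 L; lra.
apply/nbhs_mdist; exists (Num.min r (e / (`|L| + 1))) => [|y].
  by rewrite lt_min r0 divr_gt0.
rewrite lt_min ltr_pdivlMr// => /andP[xy1 xy2].
apply: le_lt_trans (hL x y _ xy1) _; first by rewrite mdistxx.
have := mdist_ge0 x y; have := ler_norm L; nra.
Qed.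

Lemma lsc_borel_measurable (f : X -> \bar R) :
  (forall a : R, open [set x | (a%:E < f x)%E]) ->
  measurable_fun [set: borel X] (f : borel X -> \bar R).
Proof.
move=> of_; apply: (measurability _ (ErealGenOInfty.measurableE R)).
move=> /= _ [_ [a ->]] <-.
by rewrite setTI preimage_itvoy; apply: sub_sigma_algebra; exact: of_.
Qed.

Lemma continuous_borel_measurable v : continuous v ->
  measurable_fun [set: borel X] (v : borel X -> R).
Proof.
move=> cv; apply/measurable_EFinP.
apply: (@lsc_borel_measurable (EFin \o v)) => a.
rewrite (_ : [set _ | _] = v @^-1` [set y | a < y]).
  by apply: open_comp => //; exact: open_gt.
by apply/seteqP; split=> x /=; rewrite lte_fin.
Qed.

(** The constant speed curve is Lipschitz with its length as constant, so the increments of [v]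
    along it are locally bounded by the continuous function [f], the length times [h]. Applying
    [integral_compare] to [v] and to [- v] gives the absolute value. *)
Lemma asymptotic_lip_upper_gradient v h : asymptotic_lip_le v h ->
  real_locally_lipschitz h -> (forall x, 0 <= h x) ->
  upper_gradient (EFin \o v) (EFin \o h).
Proof.
move=> vh lh h0; have ch := locally_lipschitz_continuous lh.
split.
- by apply/measurable_EFinP; exact: continuous_borel_measurable.
- by move=> x; rewrite lee_fin.
move=> gamma rect; have l0 := rectifiable_length_ge0 rect.
rewrite path_integralE// lee_fin.
pose f := fun t => length_on gamma 0 1 * h (constant_speed gamma t).
have cf : {within `[0, 1], continuous f}.
  apply/subspace_continuousP => x x01; apply: cvgM; first exact: cvg_cst.
  by have /subspace_continuousP := continuous_constant_speed rect ch; exact.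
have -> : length_on gamma 0 1 * Rintegral lebesgue_measure `[0, 1]
    (h \o constant_speed gamma) = Rintegral lebesgue_measure `[0, 1] f.
  rewrite RintegralZl//; apply: continuous_compact_integrable.
    exact: segment_compact.
  exact: continuous_constant_speed.
have loc x : 0 <= x <= 1 -> forall e : R, 0 < e -> exists2 d, 0 < d &
    forall r s, 0 <= r -> s <= 1 -> x - d < r -> s < x + d -> r <= s ->
    `|v (constant_speed gamma s) - v (constant_speed gamma r)| <=
      (f x + e) * (s - r).
  move=> x01 e e0.
  have l1 : 0 < length_on gamma 0 1 + 1 by lra.
  (* Dividing by the length plus 1 absorbs the speed and allows constant curves. *)
  have e1 : 0 < e / (length_on gamma 0 1 + 1) by exact: divr_gt0.
  have [d d0 hd] := vh (constant_speed gamma x) _ e1.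
  exists (d / (length_on gamma 0 1 + 1)) => [|r s r0 s1]; first exact: divr_gt0.
  rewrite ltrBlDl -ltrBlDr -ltrBlDl !ltr_pdivlMr// => xr sx rs.
  have r01 : 0 <= r <= 1 by rewrite r0 (le_trans rs).
  have s01 : 0 <= s <= 1 by rewrite s1 (le_trans r0).
  have near_ t : 0 <= t <= 1 -> r <= t <= s ->
      mdist (constant_speed gamma x) (constant_speed gamma t) < d.
    move=> t01 rts; apply: le_lt_trans (constant_speed_lip rect x01 t01) _.
    by case: (lerP t x) => tx; nra.
  apply: le_trans (hd _ _ (near_ s s01 _) (near_ r r01 _)) _.
  - by rewrite rs lexx.
  - by rewrite rs lexx.
  apply: le_trans (ler_wpM2l _ (constant_speed_lip rect s01 r01)) _.
    by rewrite addr_ge0// ltW.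
  rewrite ger0_norm ?subr_ge0// mulrA ler_wpM2r ?subr_ge0//.
  rewrite mulrDl /f mulrC lerD2l.
  rewrite -mulrAC ler_pdivrMr//; nra.
rewrite -constant_speed0// -constant_speed1// ler_norml; apply/andP; split.
  rewrite lerNl opprB; apply: (integral_compare (Psi := v \o constant_speed gamma) cf).
  move=> x x01 e e0; have [d d0 hd] := loc x x01 e e0.
  exists d => // r s r0 s1 xr sx rs.
  exact: le_trans (ler_norm _) (hd r s r0 s1 xr sx rs).
pose Psi t := - v (constant_speed gamma t).
have := @integral_compare _ f Psi cf; rewrite /Psi opprK addrC; apply.
move=> x x01 e e0; have [d d0 hd] := loc x x01 e e0.
exists d => // r s r0 s1 xr sx rs.
apply: le_trans (hd r s r0 s1 xr sx rs).
by rewrite opprK addrC distrC ler_norm.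
Qed.

End upper_gradients.

(** * Discrete chains *)

Section inf_convolution.
Context {R : realType} {X : pmetricType R}.
Variable w : X -> \bar R.
Hypothesis w0 : forall x, (0 <= w x)%E.
Implicit Types (x y : X) (a r s : R) (n m : nat).

(* [min n (inf_y (w y + n d(x, y)))] written as a single infimum. *)
Definition iconv n x : R := inf [set r | r = n%:R \/
  exists y, (w y + (n%:R * mdist x y)%:E <= r%:E)%E].

Let iconv_ge n x a : a <= n%:R ->
  (forall r y, (w y + (n%:R * mdist x y)%:E <= r%:E)%E -> a <= r) ->
  a <= iconv n x.
Proof.
move=> an h; apply: lb_le_inf; first by exists n%:R; left.
by move=> r [->//|[y]]; exact: h.
Qed.

Let has_lb n x : has_lbound [set r | r = n%:R \/
  exists y, (w y + (n%:R * mdist x y)%:E <= r%:E)%E].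
Proof.
exists 0 => r [->//|[y]]; rewrite -lee_fin; apply: le_trans.
by rewrite adde_ge0// lee_fin mulr_ge0// mdist_ge0.
Qed.

Lemma iconv_ge0 n x : 0 <= iconv n x.
Proof.
apply: iconv_ge => // r y; rewrite -lee_fin; apply: le_trans.
by rewrite adde_ge0// lee_fin mulr_ge0// mdist_ge0.
Qed.

Lemma iconv_le_nat n x : iconv n x <= n%:R.
Proof. by apply: ge_inf => //; left. Qed.

Lemma iconv_le n x : ((iconv n x)%:E <= w x)%E.
Proof.
have := w0 x; case wx : (w x) => [r| |]// _; last exact: leey.
rewrite lee_fin; apply: ge_inf => //; right; exists x.
by rewrite mdistxx mulr0 adde0 wx.
Qed.

Lemma iconv_leD n x y : iconv n x <= iconv n y + n%:R * mdist x y.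
Proof.
rewrite -lerBlDr; apply: iconv_ge => [|r z h].
  rewrite lerBlDr; apply: le_trans (iconv_le_nat n x) _.
  by rewrite lerDl mulr_ge0// mdist_ge0.
rewrite lerBlDr; apply: ge_inf => //; right; exists z.
rewrite EFinD; apply: le_trans (leeD2r _ h).
rewrite -addeA leeD2l// -EFinD lee_fin -mulrDr ler_wpM2l// addrC.
exact: metric_triangle.
Qed.

Lemma iconv_lip n x y : `|iconv n x - iconv n y| <= n%:R * mdist x y.
Proof.
have := iconv_leD n x y; have := iconv_leD n y x.
by rewrite (metric_sym y x) ler_norml; lra.
Qed.

Lemma iconv_mono n m x : (n <= m)%N -> iconv n x <= iconv m x.
Proof.
move=> nm; have nm' : (n%:R : R) <= m%:R by rewrite ler_nat.
apply: iconv_ge => [|r y h]; first exact: le_trans (iconv_le_nat n x) nm'.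
apply: ge_inf => //; right; exists y; apply: le_trans h.
by rewrite leeD2l// lee_fin ler_wpM2r// mdist_ge0.
Qed.

(** A point [y] either lies in the ball, where [w] is at least [a], or pays the penalty [n%:R * s].
    Lower bounds of [w] on balls thus pass to its regularizations. *)
Lemma iconv_ge_ball n x a s : a <= n%:R -> a <= n%:R * s ->
  (forall y, mdist x y < s -> (a%:E <= w y)%E) -> a <= iconv n x.
Proof.
move=> an ans h; apply: iconv_ge => // r y.
have [/h aw|sy] := ltP (mdist x y) s.
  move=> hr; rewrite -lee_fin; apply: le_trans aw (le_trans _ hr).
  by rewrite leeDl// lee_fin mulr_ge0// mdist_ge0.
move=> hr; apply: le_trans ans _; rewrite -lee_fin; apply: le_trans hr.
by rewrite -[leLHS]add0e leeD// lee_fin ler_wpM2l.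
Qed.

Lemma iconv_sup x a : open [set y | (a%:E < w y)%E] -> (a%:E < w x)%E ->
  exists n, a <= iconv n x.
Proof.
move=> oa wx; have /nbhs_mdist[s s0 hs] : nbhs x [set y | (a%:E < w y)%E].
  exact: open_nbhs_nbhs.
have [k hk] : exists k : nat, Num.max a (a / s) <= k%:R.
  exists (Num.truncn (Num.max a (a / s))).+1.
  exact/ltW/truncnS_gt.
move: hk; rewrite ge_max => /andP[h1 h2].
exists k; apply: (iconv_ge_ball (s := s)) => //; first by rewrite -ler_pdivrMr.
by move=> y /hs /ltW.
Qed.

Lemma iconv_cvg x : (forall a : R, open [set y | (a%:E < w y)%E]) ->
  (fun n => (iconv n x)%:E) @ \oo --> w x.
Proof.
move=> w_lsc.
have nd : nondecreasing_seq (fun n => (iconv n x)%:E).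
  by move=> m n mn; rewrite lee_fin iconv_mono.
have := ereal_nondecreasing_cvgn nd; set s := ereal_sup _.
suff -> : s = w x by [].
apply/eqP; rewrite eq_le; apply/andP; split.
  by apply: ub_ereal_sup => _ [m _ <-]; exact: iconv_le.
rewrite leNgt; apply/negP => sw.
have ub n : ((iconv n x)%:E <= s)%E by apply: ereal_sup_ubound; exists n.
have s0 : (0 <= s)%E by apply: le_trans (ub 0%N); rewrite lee_fin iconv_ge0.
have [a [sa aw]] : exists a : R, (s < a%:E)%E /\ (a%:E < w x)%E.
  case: s s0 sw {ub} => [s| |]// _; last by case: (w x).
  case: (w x) => [r| |]//; last by exists (s + 1); rewrite lte_fin ltrDl ltry.
  by rewrite lte_fin => sr; exists ((s + r) / 2); rewrite !lte_fin midf_lt//; lra.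
have [n an] := iconv_sup (w_lsc a) aw.
have an' : (a%:E <= (iconv n x)%:E)%E by rewrite lee_fin.
by have := lt_le_trans sa (le_trans an' (ub n)); rewrite ltxx.
Qed.

End inf_convolution.

Lemma le_iconv {R : realType} {X : pmetricType R} (w w' : X -> \bar R) n x :
  (forall y, (0 <= w y)%E) -> (forall y, (w y <= w' y)%E) ->
  iconv w n x <= iconv w' n x.
Proof.
move=> w0 ww'; apply: lb_le_inf; first by exists n%:R; left.
move=> r [->|[y h]]; first exact: iconv_le_nat.
apply: ge_inf.
  exists 0 => s [->//|[z]]; rewrite -lee_fin; apply: le_trans.
  by rewrite adde_ge0// lee_fin mulr_ge0// mdist_ge0.
by right; exists y; apply: le_trans h; rewrite leeD2r.
Qed.

Section chains.
Context {R : realType} {X : pmetricType R}.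
Implicit Types (phi : X -> R) (p : nat -> X) (E : set X) (x y : X) (d : R).

Definition chain E d x p N :=
  [/\ E (p 0%N), p N = x & forall k, (k < N)%N -> mdist (p k) (p k.+1) <= d].

Definition chain_cost phi p k : R := \sum_(i < k) phi (p i) * mdist (p i) (p i.+1).

(** The competitor 1 truncates the infimum and keeps the set nonempty when no chain of mesh [d]
    reaches [x]. *)
Definition chain_inf phi E d x : R :=
  inf [set r | r = 1 \/ exists p N, chain E d x p N /\ r = chain_cost phi p N].

Lemma chain_costS phi p k : chain_cost phi p k.+1 =
  chain_cost phi p k + phi (p k) * mdist (p k) (p k.+1).
Proof. by rewrite /chain_cost big_ord_recr. Qed.

Lemma chain_cost0 phi p : chain_cost phi p 0 = 0.
Proof. by rewrite /chain_cost big_ord0. Qed.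

Lemma le_chain_cost phi psi p k : (forall i, (i < k)%N -> phi (p i) <= psi (p i)) ->
  chain_cost phi p k <= chain_cost psi p k.
Proof.
by move=> h; apply: ler_sum => i _; rewrite ler_wpM2r ?mdist_ge0// h.
Qed.

Section nonnegative.
Variable phi : X -> R.
Hypothesis phi0 : forall x, 0 <= phi x.

Lemma chain_cost_ge0 p k : 0 <= chain_cost phi p k.
Proof. by apply: sumr_ge0 => i _; rewrite mulr_ge0 ?mdist_ge0. Qed.

Lemma chain_cost_mono p i j : (i <= j)%N -> chain_cost phi p i <= chain_cost phi p j.
Proof.
move=> /subnKC <-; elim: (j - i)%N => [|k IH]; first by rewrite addn0.
by rewrite addnS chain_costS; apply: le_trans IH _; rewrite lerDl mulr_ge0 ?mdist_ge0.
Qed.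

Let has_lb E d x : has_lbound
  [set r | r = 1 \/ exists p N, chain E d x p N /\ r = chain_cost phi p N].
Proof. by exists 0 => r [->//|[p [N [_ ->]]]]; exact: chain_cost_ge0. Qed.

Lemma chain_inf_ge0 E d x : 0 <= chain_inf phi E d x.
Proof.
apply: lb_le_inf; first by exists 1; left.
by move=> r [->//|[p [N [_ ->]]]]; exact: chain_cost_ge0.
Qed.

Lemma chain_inf_le1 E d x : chain_inf phi E d x <= 1.
Proof. by apply: ge_inf => //; left. Qed.

Lemma chain_inf_eq0 E d x : E x -> chain_inf phi E d x = 0.
Proof.
move=> Ex; apply/eqP; rewrite eq_le chain_inf_ge0 andbT.
apply: ge_inf => //; right; exists (fun=> x), 0%N.
by rewrite chain_cost0.
Qed.

(** A chain ending at [x] is prolonged by [y], the new step being weighted at [x]; the truncated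
    value 1 is never exceeded. All Lipschitz bounds on chain infima come from this. *)
Lemma chain_inf_step E d x y : mdist x y <= d ->
  chain_inf phi E d y <= chain_inf phi E d x + phi x * mdist x y.
Proof.
move=> xyd; rewrite -lerBlDr; apply: lb_le_inf; first by exists 1; left.
move=> r [->|[p [N [[Ep px pd] ->]]]]; rewrite lerBlDr.
  by apply: le_trans (chain_inf_le1 _ _ _) _; rewrite lerDl mulr_ge0 ?mdist_ge0.
apply: ge_inf => //; right.
exists (fun k => if (k <= N)%N then p k else y), N.+1; split.
  split=> //; first by rewrite ltnn.
  move=> k; rewrite ltnS => kN; rewrite kN.
  by case: ltngtP kN => // [kN _|->]; [exact: pd|rewrite px].
rewrite chain_costS leqnn ltnn px; congr (_ + _).
by apply: eq_bigr => i _; rewrite (ltnW (ltn_ord i)) (ltn_ord i).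
Qed.

Lemma chain_inf_lip E d x y : mdist x y <= d ->
  `|chain_inf phi E d x - chain_inf phi E d y| <=
    Num.max (phi x) (phi y) * mdist x y.
Proof.
move=> xyd; have h1 := chain_inf_step E xyd.
have /(chain_inf_step E) : mdist y x <= d by rewrite metric_sym.
rewrite (metric_sym y x) => h2; have d0 := mdist_ge0 x y.
have m1 : phi x <= Num.max (phi x) (phi y) by rewrite le_max lexx.
have m2 : phi y <= Num.max (phi x) (phi y) by rewrite le_max lexx orbT.
by rewrite ler_norml; apply/andP; split; nra.
Qed.

Lemma chain_inf_lt E d x c : chain_inf phi E d x < c -> c <= 1 ->
  exists p N, chain E d x p N /\ chain_cost phi p N < c.
Proof.
move=> h c1; have [|r [->|[p [N [ch ->]]]] rc] := inf_lt _ h.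
- by exists 1; left.
- by have := lt_le_trans rc c1; rewrite ltxx.
- by exists p, N.
Qed.

End nonnegative.

Lemma chain_inf_mono phi psi E d d' x : (forall y, 0 <= phi y) ->
  (forall y, phi y <= psi y) -> d' <= d ->
  chain_inf phi E d x <= chain_inf psi E d' x.
Proof.
move=> phi0 phipsi dd; apply: lb_le_inf; first by exists 1; left.
move=> r [->|[p [N [[Ep px pd] ->]]]]; first exact: chain_inf_le1.
apply: (@le_trans _ _ (chain_cost phi p N)); last exact: le_chain_cost.
apply: ge_inf.
  by exists 0 => r' [->//|[q [N' [_ ->]]]]; exact: chain_cost_ge0.
right; exists p, N; split=> //; split=> // k kN.
exact: le_trans (pd k kN) dd.
Qed.

(** Telescoping. With a suitable test function [theta], estimates of single steps become lower
    bounds on the cost of a chain. *)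
Lemma chain_potential phi p (theta : X -> R) A i j : (i <= j)%N ->
  (forall k, (i <= k < j)%N ->
    `|theta (p k) - theta (p k.+1)| <= A * (phi (p k) * mdist (p k) (p k.+1))) ->
  `|theta (p i) - theta (p j)| <= A * (chain_cost phi p j - chain_cost phi p i).
Proof.
move=> /subnKC <-; elim: (j - i)%N => [|k IH] h.
  by rewrite addn0 !subrr normr0 mulr0.
rewrite addnS chain_costS.
have : `|theta (p i) - theta (p (i + k)%N)| <=
    A * (chain_cost phi p (i + k) - chain_cost phi p i).
  by apply: IH => l /andP[il lk]; apply: h; rewrite il addnS ltnS ltnW.
have := h (i + k)%N; rewrite leq_addr addnS ltnSn => /(_ isT).
have := ler_distD (theta (p (i + k)%N)) (theta (p i)) (theta (p (i + k).+1)).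
by lra.
Qed.

Lemma chain_mdist p i j : (i <= j)%N ->
  mdist (p i) (p j) <= chain_cost (cst 1) p j - chain_cost (cst 1) p i.
Proof.
move=> ij; have := @chain_potential (cst 1) p (fun x => mdist (p i) x) 1 i j ij.
rewrite mul1r mdistxx sub0r normrN ger0_norm ?mdist_ge0//; apply.
move=> k _; rewrite !mul1r metric_sym (metric_sym _ (p k.+1)).
exact: mdist_diff.
Qed.

End chains.

(** * Convergence along ultrafilters *)

Section ultrafilters.
Context {R : realType} {X : pmetricType R}.
Variable U : set_system nat.
Hypothesis ultraU : UltraFilter U.

Lemma ultra_compact_cvg (T : topologicalType) (K : set T) (f : nat -> T) :
  compact K -> U (f @^-1` K) -> exists z : T, f @ U --> z.
Proof.
move=> cK UK; have [z [_ clz]] := cK (f @ U) _ UK.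
exists z => A Az; have [//|UnA] := in_ultra_setVsetC (f @^-1` A) ultraU.
by have [y []] := clz (~` A) A UnA Az.
Qed.

(** Pigeonhole: if no [A z] belonged to [U], removing them one by one would leave the empty set in
    [U]. *)
Lemma ultra_finite_cover (I : eqType) (D : seq I) (A : I -> set nat) :
  U [set n | exists2 z, z \in D & A z n] -> exists2 z, z \in D & U (A z).
Proof.
elim: D => [|z D IH] h.
  have : U set0 by apply: filterS h => n [].
  by move=> /filter_ex[].
have [Az|nAz] := in_ultra_setVsetC (A z) ultraU.
  by exists z; rewrite ?mem_head.
have [|y yD Ay] := IH; last by exists y; rewrite // inE yD orbT.
apply: filterS (filterI h nAz) => n [[y]]; rewrite inE => /predU1P[->|yD] Ay //.
by exists y.
Qed.

(** Total boundedness gives, for every [m], one ball of radius 1/(m+1) that contains [U]-almost all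
    terms. Picking terms in more and more of these balls produces a Cauchy sequence in [C], whose
    limit is the limit along [U]. *)
Lemma ultra_complete_cvg (C : set X) (x : nat -> X) :
  complete_set C -> U [set n | C (x n)] ->
  (forall r : R, 0 < r -> exists D : seq X,
    U [set n | exists2 z, z \in D & mdist z (x n) < r]) ->
  exists z : X, x @ U --> z.
Proof.
move=> cC UC tb.
have /choice[z hz] m : exists z, U [set n | mdist z (x n) < m.+1%:R^-1].
  have [|D /ultra_finite_cover[z _ hz]] := tb m.+1%:R^-1; last by exists z.
  by rewrite invr_gt0.
pose B m := [set n | C (x n) /\ forall i, (i <= m)%N -> mdist (z i) (x n) < i.+1%:R^-1].
have UB m : U (B m).
  elim: m => [|m IH].
    apply: filterS (filterI UC (hz 0%N)) => n [Cn h]; split=> // i.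
    by rewrite leqn0 => /eqP ->.
  apply: filterS (filterI IH (hz m.+1)) => n [[Cn hn] h]; split=> // i.
  by rewrite leq_eqVlt => /predU1P[->//|]; exact: hn.
have /choice[k hk] m : exists n, B m n by exact: filter_ex (UB m).
have small (e : R) : 0 < e -> exists m, m.+1%:R^-1 < e.
  move=> e0; exists (Num.truncn e^-1).
  by rewrite invf_plt ?posrE// truncnS_gt.
have near_ m n : (m <= n)%N -> mdist (z m) (x (k n)) < m.+1%:R^-1.
  by move=> mn; have [_] := hk n; exact.
have [|l Cl xl] := cC (x \o k) (fun m => (hk m).1).
  apply/cauchy_mdist => e e0; have [|m hm] := small (e / 2); first exact: divr_gt0.
  exists m => i j mi mj /=; have := metric_triangle (x (k i)) (z m) (x (k j)).
  have := near_ m i mi; have := near_ m j mj; rewrite (metric_sym (x (k i)) (z m)).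
  by move: hm; set r := _^-1; lra.
exists l; apply/metricType_numDomainType.cvgrPdist_lt => e e0.
have [|m hm] := small (e / 3); first exact: divr_gt0.
have e30 : 0 < e / 3 by exact: divr_gt0.
have [i mi hi] : exists2 i, (m <= i)%N & mdist l (x (k i)) < e / 3.
  have [N hN] := (cvg_mdistP _ _).1 xl _ e30.
  by exists (maxn m N); [exact: leq_maxl | apply: hN; exact: leq_maxr].
apply: filterS (hz m) => n hn.
have := metric_triangle l (x (k i)) (x n).
have := metric_triangle (x (k i)) (z m) (x n).
have := near_ m i mi; rewrite (metric_sym (x (k i)) (z m)).
by move: hn hm => /=; set r := _^-1; lra.
Qed.

Lemma ultra_cvg_mdist (x y : nat -> X) (a b : X) :
  x @ U --> a -> y @ U --> b ->
  (fun n => mdist (x n) (y n)) @ U --> mdist a b.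
Proof.
move=> xa yb; apply/cvgrPdist_lt => e e0.
have e20 : 0 < e / 2 by exact: divr_gt0.
have h1 : U [set n | mdist a (x n) < e / 2].
  exact: (metricType_numDomainType.cvgr_dist_lt xa e20).
have h2 : U [set n | mdist b (y n) < e / 2].
  exact: (metricType_numDomainType.cvgr_dist_lt yb e20).
apply: filterS (filterI h1 h2) => n [] /=.
have := mdist_diff a (x n) b; have := mdist_diff b (y n) (x n).
rewrite (metric_sym b (x n)) (metric_sym (y n) (x n)).
have := ler_distD (mdist (x n) b) (mdist a b) (mdist (x n) (y n)).
by lra.
Qed.

End ultrafilters.

(** * Limits of chains *)

Section chain_limits.
Context {R : realType} {X : pmetricType R}.
Variables (w : X -> \bar R) (E F C : set X) (c c0 s0 D0 : R).
Implicit Types (r t : R) (n i k : nat).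
Hypothesis w_lsc : forall a : R, open [set x | (a%:E < w x)%E].
Hypothesis c0_gt0 : 0 < c0.
Hypothesis w_ge : forall x, (c0%:E <= w x)%E.
Hypothesis w_cover : forall r M : R, 0 < r -> exists D : seq X, forall x,
  (w x <= M%:E)%E -> exists2 z, z \in D & mdist z x < r.
Hypothesis s0_gt0 : 0 < s0.
Hypothesis C_complete : complete_set C.
Hypothesis w_near : forall x y, (w y < +oo)%E -> mdist x y < s0 -> C x.
Hypotheses (closedE : closed E) (closedF : closed F).
Hypothesis D0_gt0 : 0 < D0.
Hypothesis EF : forall x y, E x -> F y -> D0 <= mdist x y.
Variables (p : nat -> nat -> X) (N : nat -> nat).
Hypothesis pE : forall n, E (p n 0%N).
Hypothesis pF : forall n, F (p n (N n)).
Hypothesis pd : forall n k, (k < N n)%N -> mdist (p n k) (p n k.+1) <= n.+1%:R^-1.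
Hypothesis pc : forall n, chain_cost (iconv w n) (p n) (N n) <= c.

Let w_ge0 x : (0 <= w x)%E.
Proof. by apply: le_trans (w_ge x); rewrite lee_fin ltW. Qed.

Let G := iconv w.
Let G0 n x : 0 <= G n x. Proof. exact: iconv_ge0. Qed.

Let cost n k : R := chain_cost (G n) (p n) k.
Let sig n k : R := chain_cost (cst 1) (p n) k.

Let cost_ge0 n k : 0 <= cost n k. Proof. exact: chain_cost_ge0. Qed.

Let cost_mono n i j : (i <= j)%N -> cost n i <= cost n j.
Proof. exact: chain_cost_mono. Qed.

Let cost_le n i : (i <= N n)%N -> cost n i <= c.
Proof. by move=> /cost_mono/le_trans; apply; exact: pc. Qed.

Let c_ge0 : 0 <= c. Proof. exact: le_trans (cost_ge0 0%N (N 0%N)) (pc _). Qed.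

Let sig_mono n i j : (i <= j)%N -> sig n i <= sig n j.
Proof. by apply: chain_cost_mono => x; exact: ler01. Qed.

Let large (a : R) : exists n0, forall n, (n0 <= n)%N -> a <= n%:R.
Proof.
exists (Num.truncn a).+1 => n h; apply: le_trans (ltW (truncnS_gt a)) _.
by rewrite ler_nat.
Qed.

Let small (a : R) : 0 < a -> exists n0, forall n, (n0 <= n)%N -> n.+1%:R^-1 <= a.
Proof.
move=> a0; have [n0 hn] := large a^-1; exists n0 => n /hn h.
rewrite invf_ple ?posrE//; apply: le_trans h _; by rewrite ler_nat.
Qed.

(* A chain that stays in {M < w} for a length comparable to r costs about M r,
   hence every point of the chain is close to {w <= M} when M is large. *)
Let chain_near r : 0 < r -> exists M : R, exists n0, forall n i, (n0 <= n)%N ->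
  (i <= N n)%N -> exists2 y, mdist (p n i) y < r & (w y <= M%:E)%E.
Proof.
move=> r0; pose tau := Num.min r D0 / 4.
have rD : 0 < Num.min r D0 by rewrite lt_min r0.
have tau0 : 0 < tau by exact: divr_gt0.
have tr : 4 * tau <= r by rewrite /tau mulrC divfK// ge_min lexx.
have tD : 4 * tau <= D0 by rewrite /tau mulrC divfK// ge_min lexx orbT.
pose M := 2 * (c + 1) / tau.
have M0 : 0 < M by rewrite divr_gt0// mulr_gt0//; have := c_ge0; lra.
have MtE : M * tau = 2 * (c + 1) by rewrite divfK// gt_eqF.
have [n1 h1] := large M; have [n2 h2] := large (M / tau).
have [n3 h3] := small tau0.
exists M, (maxn n1 (maxn n2 n3)) => n i.
rewrite !geq_max => /and3P[/h1 {}h1 /h2 {}h2 /h3 {}h3] iN.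
apply: contrapT => nex.
have H y : mdist (p n i) y < r -> (M%:E <= w y)%E.
  move=> yr; rewrite leNgt; apply/negP => yM; apply: nex.
  by exists y => //; exact: ltW.
(* A bump of height [tau] around [p n i]. Where it varies the weight is at least [M], so along a
   chain of cost at most [c] it varies by at most [c / M], which is less than [tau]. Both ends of
   the chain are then within [tau] of [p n i], although [4 * tau <= D0]. *)
pose theta x := Num.max 0 (tau - mdist (p n i) x).
have theta_i : theta (p n i) = tau by rewrite /theta mdistxx subr0 max_r// ltW.
have theta0 x : 0 < theta x -> mdist (p n i) x < tau.
  by rewrite /theta lt_max ltxx /= subr_gt0.
have thetaL x y : `|theta x - theta y| <= mdist x y.
  have := mdist_diff x y (p n i).
  rewrite /theta (metric_sym x (p n i)) (metric_sym y (p n i)) !ler_norml.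
  by case: (leP 0 (tau - mdist (p n i) x)) => ?;
     case: (leP 0 (tau - mdist (p n i) y)) => ?; have := mdist_ge0 x y; lra.
have step k : (k < N n)%N -> `|theta (p n k) - theta (p n k.+1)| <=
    M^-1 * (G n (p n k) * mdist (p n k) (p n k.+1)).
  move=> kN; rewrite mulrC ler_pdivlMr//.
  have d0 := mdist_ge0 (p n k) (p n k.+1).
  have [far|near_] := leP (2 * tau) (mdist (p n i) (p n k)).
    have th1 : theta (p n k) = 0 by apply: max_l; lra.
    have th2 : theta (p n k.+1) = 0.
      apply: max_l; have := metric_triangle (p n i) (p n k.+1) (p n k).
      by have := pd kN; rewrite (metric_sym (p n k.+1)); move: h3; set q := _^-1; lra.
    by rewrite th1 th2 subrr normr0 mul0r mulr_ge0.
  have GM : M <= G n (p n k).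
    apply: (iconv_ge_ball w_ge0 (s := tau)) => //.
      by rewrite -ler_pdivrMr.
    move=> y yt; apply: H.
    by have := metric_triangle (p n i) (p n k) y; lra.
  rewrite mulrC; apply: (@le_trans _ _ (M * mdist (p n k) (p n k.+1))).
    by rewrite ler_wpM2l// ltW.
  by rewrite ler_wpM2r.
have cM : M^-1 * c < tau.
  rewrite mulrC ltr_pdivrMr// mulrC MtE; have := c_ge0; lra.
have bnd i1 i2 : (i1 <= i2)%N -> (i2 <= N n)%N ->
    `|theta (p n i1) - theta (p n i2)| < tau.
  move=> i12 i2N; apply: le_lt_trans cM.
  apply: le_trans (chain_potential (A := M^-1) (phi := G n) i12 _) _.
    by move=> k /andP[_ ki]; apply: step; exact: leq_trans ki i2N.
  rewrite ler_wpM2l ?invr_ge0 ?(ltW M0)//.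
  have := cost_le i2N; have := cost_ge0 n i1; rewrite /cost; lra.
have e0 : mdist (p n i) (p n 0%N) < tau.
  by apply: theta0; have := bnd 0%N i (leq0n i) iN; rewrite theta_i ltr_norml; lra.
have eN : mdist (p n i) (p n (N n)) < tau.
  by apply: theta0; have := bnd i (N n) iN (leqnn _); rewrite theta_i ltr_norml; lra.
have := EF (pE n) (pF n).
have := metric_triangle (p n 0%N) (p n i) (p n (N n)).
rewrite (metric_sym (p n 0%N) (p n i)); lra.
Qed.

(** The regularized weights are eventually at least [c0], so the chains have length at most
    [c / c0]; the summand 1 makes [L] positive even if [c = 0]. *)
Let L : R := c / c0 + 1.
Let L_gt0 : 0 < L.
Proof. by rewrite ltr_pwDr// divr_ge0 ?c_ge0// ltW. Qed.

Let sig_le : exists n0, forall n i, (n0 <= n)%N -> (i <= N n)%N -> sig n i <= L.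
Proof.
have [n0 hn] := large c0; exists n0 => n i /hn h iN.
apply: (@le_trans _ _ (c / c0)); last by rewrite lerDl.
rewrite ler_pdivlMr//; apply: le_trans (cost_le iN).
rewrite /sig /chain_cost mulr_suml; apply: ler_sum => k _ /=.
rewrite mul1r mulrC ler_wpM2r ?mdist_ge0//.
by apply: (iconv_ge_ball w_ge0 (s := 1)) => //; rewrite mulr1.
Qed.

(** Last index reached within length [t * L]: a discrete parametrization by arc length. *)
Let kap n t : nat := [arg max_(i > @ord0 (N n) | sig n i <= t * L) (i : nat)].

Let kapP n t : 0 <= t -> [/\ (kap n t <= N n)%N, sig n (kap n t) <= t * L &
  forall i, (i <= N n)%N -> sig n i <= t * L -> (i <= kap n t)%N].
Proof.
move=> t0; rewrite /kap; case: arg_maxnP => /=.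
  by rewrite /sig chain_cost0 mulr_ge0// ltW.
move=> i si hi; split=> //; first by rewrite -ltnS.
by move=> j jN sj; exact: (hi (Ordinal (jN : (j < (N n).+1)%N))).
Qed.

Let kap_mono n t t' : 0 <= t -> t <= t' -> (kap n t <= kap n t')%N.
Proof.
move=> t0 tt'; have [k1 k2 _] := kapP n t0.
have [_ _ h] := kapP n (le_trans t0 tt'); apply: h => //.
by apply: le_trans k2 _; rewrite ler_wpM2r// ltW.
Qed.

(** The index after [kap n t] already exceeds length [t * L], so the excess is at most one step of
    the chain. *)
Let sig_kap n t t' : 0 <= t -> t <= t' ->
  sig n (kap n t') - sig n (kap n t) <= L * (t' - t) + n.+1%:R^-1.
Proof.
move=> t0 tt'; have t'0 := le_trans t0 tt'.
have [k1 k2 k3] := kapP n t0; have [l1 l2 l3] := kapP n t'0.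
have d0 : 0 <= n.+1%:R^-1 :> R by rewrite invr_ge0.
have [kN|Nk] := ltnP (kap n t) (N n).
  have hd := pd kN.
  have : t * L < sig n (kap n t).+1.
    by rewrite ltNge; apply/negP => /(k3 _ kN); rewrite ltnn.
  have -> : sig n (kap n t).+1 =
      sig n (kap n t) + mdist (p n (kap n t)) (p n (kap n t).+1).
    by rewrite /sig chain_costS /= mul1r.
  by move: hd; set q := _^-1; lra.
have -> : kap n t' = kap n t.
  by apply/eqP; rewrite eqn_leq (leq_trans l1 Nk) kap_mono.
rewrite subrr addr_ge0// mulr_ge0//; [exact: ltW|lra].
Qed.

Variable U : set_system nat.
Hypotheses (ultraU : UltraFilter U) (U_oo : \oo `<=` U).

Let U_ge n0 : U [set n | (n0 <= n)%N].
Proof. by apply: U_oo; exists n0. Qed.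

Let gam n t := p n (kap n t).

Let gam_dist n t t' : 0 <= t -> t <= t' ->
  mdist (gam n t) (gam n t') <= L * (t' - t) + n.+1%:R^-1.
Proof.
move=> t0 tt'; apply: le_trans (sig_kap n t0 tt').
exact: chain_mdist (kap_mono n t0 tt').
Qed.

(** [chain_near] is used twice: with radius [s0] it places the points in [C], with radius [r / 2] it
    puts them close to a finite net of a sublevel of [w]. The ultrafilter provides the limits for
    all [t] at once, without a diagonal argument. *)
Let gam_cvg t : exists z : X, 0 <= t -> gam ^~ t @ U --> z.
Proof.
have [t0|] := leP 0 t; last by exists point.
suff [z hz] : exists z : X, gam ^~ t @ U --> z by exists z.
apply: (ultra_complete_cvg ultraU C_complete).
  have [M [n0 h]] := chain_near s0_gt0.
  apply: filterS (U_ge n0) => n n0n /=.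
  have [k1 _ _] := kapP n t0; have [y yd yM] := h n _ n0n k1.
  by apply: w_near yd; exact: le_lt_trans yM (ltry _).
move=> r r0; have r20 : 0 < r / 2 by exact: divr_gt0.
have [M [n0 h]] := chain_near r20; have [D hD] := w_cover M r20.
exists D; apply: filterS (U_ge n0) => n n0n /=.
have [k1 _ _] := kapP n t0; have [y yd yM] := h n _ n0n k1.
have [z zD zy] := hD y yM; exists z => //.
have := metric_triangle z y (gam n t).
by rewrite (metric_sym y); move: yd; rewrite /gam; lra.
Qed.

Let Phi_cvg t : exists b : R, 0 <= t -> (fun n => cost n (kap n t)) @ U --> b.
Proof.
have [t0|] := leP 0 t; last by exists 0.
suff [b hb] : exists b : R, (fun n => cost n (kap n t)) @ U --> b by exists b.
apply: (ultra_compact_cvg ultraU (@segment_compact _ 0 c)).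
apply: filterS (U_ge 0) => n _ /=; rewrite in_itv /= cost_ge0 cost_le//.
by have [] := kapP n t0.
Qed.

(** [Phi] is the limit of the accumulated cost. The last clause survives the limit because the level
    [m] is fixed while [n] grows: [iconv w m] is [m]-Lipschitz, so it drops by at most
    [m%:R * L * (t' - t)] between the two times. *)
Lemma chain_limit : exists gamma : R -> X, exists Phi : R -> R,
  [/\ E (gamma 0), F (gamma 1),
    forall t t', 0 <= t -> t <= t' -> mdist (gamma t) (gamma t') <= L * (t' - t),
    (0 <= Phi 0 /\ Phi 1 <= c) /\ (forall t t', 0 <= t -> t <= t' -> Phi t <= Phi t') &
    forall m t t', 0 <= t -> t <= t' ->
      (G m (gamma t) - m%:R * L * (t' - t)) * mdist (gamma t) (gamma t') <=
        Phi t' - Phi t].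
Proof.
have [gamma gP] := choice gam_cvg; have [Phi PhiP] := choice Phi_cvg.
have dU : (fun n => n.+1%:R^-1 : R) @ U --> 0.
  apply: cvg_trans (@cvg_harmonic R); exact: cvg_app.
exists gamma, Phi; split.
- apply: (closed_cvg _ closedE _ _ (gP 0 (lexx 0))).
  apply: filterS (U_ge 0) => n _; rewrite /gam.
  have [k1 k2 _] := kapP n (lexx 0).
  (* The index [kap n 0] is positive if the chain begins with repetitions of its first point. *)
  suff -> : p n (kap n 0) = p n 0%N by [].
  apply/esym/mdist_positivity/eqP; rewrite eq_le mdist_ge0 andbT.
  apply: le_trans (chain_mdist (p n) (leq0n _)) _.
  by rewrite chain_cost0 subr0; rewrite mul0r in k2.
- apply: (closed_cvg _ closedF _ _ (gP 1 ler01)).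
  have [n0 h] := sig_le; apply: filterS (U_ge n0) => n n0n; rewrite /gam.
  have [k1 _ k3] := kapP n (@ler01 R).
  suff -> : kap n 1 = N n by [].
  by apply/eqP; rewrite eqn_leq k1 k3// mul1r h.
- move=> t t' t0 tt'; have t'0 := le_trans t0 tt'.
  rewrite -[leRHS]addr0.
  have c1 := ultra_cvg_mdist ultraU (gP t t0) (gP t' t'0).
  have c2 : (fun n => L * (t' - t) + n.+1%:R^-1) @ U --> L * (t' - t) + 0.
    by apply: cvgD => //; exact: cvg_cst.
  apply: (ler_cvg_to c1 c2).
  by apply: filterS (U_ge 0) => n _; exact: gam_dist.
- split; [split|].
  + by apply: (cvgr_to_ge (PhiP 0 (lexx 0))); apply: filterS (U_ge 0) => n _.
  + apply: (cvgr_to_le (PhiP 1 ler01)); apply: filterS (U_ge 0) => n _.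
    by apply: cost_le; have [] := kapP n (@ler01 R).
  + move=> t t' t0 tt'; have t'0 := le_trans t0 tt'.
    apply: (ler_cvg_to (PhiP t t0) (PhiP t' t'0)).
    by apply: filterS (U_ge 0) => n _; apply: cost_mono; exact: kap_mono.
move=> m t t' t0 tt'; have t'0 := le_trans t0 tt'.
(* For [n >= m] this is a lower bound of all weights on the part of the chain between the times [t]
   and [t']. *)
pose A n := G m (gam n t) - m%:R * (L * (t' - t) + n.+1%:R^-1).
have cA : A @ U --> G m (gamma t) - m%:R * (L * (t' - t) + 0).
  apply: cvgB.
    apply: (cvg_comp (gam ^~ t) (G m) (gP t t0)).
    apply: locally_lipschitz_continuous => x; exists 1 => //; exists m%:R => y z _ _.
    exact: iconv_lip.
  apply: cvgM; first exact: cvg_cst.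
  by apply: cvgD => //; exact: cvg_cst.
have c1 := cvgM cA (ultra_cvg_mdist ultraU (gP t t0) (gP t' t'0)).
have c2 := cvgB (PhiP t' t'0) (PhiP t t0).
rewrite addr0 mulrA in c1; apply: (ler_cvg_to (c1 _) (c2 _)).
apply: filterS (U_ge m) => n mn /=.
have kk := kap_mono n t0 tt'.
set k := kap n t in kk *; set k' := kap n t' in kk *.
have hA i : (k <= i < k')%N -> A n <= G n (p n i).
  move=> /andP[ki ik']; apply: le_trans (iconv_mono w_ge0 (p n i) mn).
  have := iconv_leD w_ge0 m (gam n t) (p n i).
  have : mdist (gam n t) (p n i) <= L * (t' - t) + n.+1%:R^-1.
    apply: le_trans (sig_kap n t0 tt').
    apply: le_trans (chain_mdist (p n) ki) _.
    by rewrite lerD2r sig_mono// ltnW.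
  by move=> /(ler_wpM2l (ler0n R m)); rewrite /A /G; set q := n.+1%:R^-1; lra.
have [An|An] := leP (A n) 0.
  apply: (@le_trans _ _ 0); first by rewrite mulr_le0_ge0 ?mdist_ge0.
  by rewrite subr_ge0 cost_mono.
have : mdist (gam n t) (p n k') <= (A n)^-1 * (cost n k' - cost n k).
  have := @chain_potential R X (G n) (p n) (fun x => mdist (gam n t) x) (A n)^-1 k k' kk.
  rewrite mdistxx sub0r normrN ger0_norm ?mdist_ge0//; apply => i ki.
  rewrite mulrC ler_pdivlMr// mulrC.
  apply: (@le_trans _ _ (A n * mdist (p n i) (p n i.+1))).
    rewrite ler_wpM2l ?(ltW An)// metric_sym (metric_sym _ (p n i.+1)).
    exact: mdist_diff.
  by rewrite ler_wpM2r ?mdist_ge0// hA.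
by rewrite mulrC ler_pdivlMr// mulrC.
Qed.

End chain_limits.

Section limit_curves.
Context {R : realType} {X : pmetricType R}.
Variables (w : X -> \bar R) (gamma : R -> X) (Phi : R -> R) (L c : R).
Implicit Types (t r : R).
Hypothesis w_ge0 : forall x, (0 <= w x)%E.
Hypothesis w_lsc : forall a : R, open [set x | (a%:E < w x)%E].
Hypothesis L_ge0 : 0 <= L.
Hypothesis gamma_lip : forall t t', 0 <= t -> t <= t' ->
  mdist (gamma t) (gamma t') <= L * (t' - t).
Hypothesis Phi_mono : forall t t', 0 <= t -> t <= t' -> Phi t <= Phi t'.
Hypotheses (Phi0 : 0 <= Phi 0) (Phi1 : Phi 1 <= c).
Hypothesis Phi_step : forall m t t', 0 <= t -> t <= t' ->
  (iconv w m (gamma t) - m%:R * L * (t' - t)) * mdist (gamma t) (gamma t') <=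
    Phi t' - Phi t.
Hypothesis gamma_neq : gamma 0 != gamma 1.
Local Notation leb := (@lebesgue_measure R).

Let plen_le a s : 0 <= a -> path <%R a s ->
  polygon_length gamma a s <= L * (last a s - a).
Proof.
elim: s a => [|x s IH] a a0 /=; first by rewrite subrr mulr0.
move=> /andP[ax xs]; have := IH x (le_trans a0 (ltW ax)) xs.
by have := gamma_lip a0 (ltW ax); lra.
Qed.

Lemma lipschitz_rectifiable : rectifiable gamma.
Proof.
split.
  apply/(within_continuousP 0 1 gamma) => x /andP[x0 x1] e e0.
  have L1 : 0 < L + 1 by rewrite ltr_wpDl.
  exists (e / (L + 1)) => [|y /andP[y0 y1]]; first exact: divr_gt0.
  rewrite ltr_pdivlMr// => xy; rewrite ballEmdist /=.
  have [le_|/ltW le_] := leP x y.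
    apply: le_lt_trans (gamma_lip x0 le_) _.
    by move: xy; rewrite distrC ger0_norm ?subr_ge0//; nra.
  rewrite metric_sym; apply: le_lt_trans (gamma_lip y0 le_) _.
  by move: xy; rewrite ger0_norm ?subr_ge0//; nra.
rewrite curve_lengthE; apply: (@le_lt_trans _ _ L%:E); last exact: ltry.
apply: ub_ereal_sup => _ [s [ps /eqP ls] <-]; rewrite lee_fin.
by apply: le_trans (plen_le (lexx 0) ps) _; rewrite ls subr0 mulr1.
Qed.
Let rect := lipschitz_rectifiable.
Let fin := rectifiable_fin rect.

Local Notation len := (length_on gamma).

Let len_le t t' : 0 <= t -> t <= t' -> t' <= 1 -> len t t' <= L * (t' - t).
Proof.
move=> t0 tt' t1; apply: (length_on_le fin) => // s [ps /eqP <-]; exact: plen_le.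
Qed.

(** The step inequality is summed over a partition; the loss [m%:R * L * (t' - t)] is large enough
    to replace the weight at every vertex by the weight at [t]. *)
Let Phi_len m t t' : 0 <= t -> t <= t' -> t' <= 1 ->
  (iconv w m (gamma t) - m%:R * L * (t' - t)) * len t t' <= Phi t' - Phi t.
Proof.
move=> t0 tt' t1; set A := _ - _.
have [A0|A0] := leP A 0.
  apply: (@le_trans _ _ 0); last by rewrite subr_ge0 Phi_mono.
  by rewrite mulr_le0_ge0// (length_on_ge0 fin).
rewrite mulrC -ler_pdivlMr//; apply: (length_on_le fin) => // s [ps /eqP ls].
rewrite ler_pdivlMr// mulrC.
suff h a : t <= a -> path <%R a s -> last a s = t' ->
    A * polygon_length gamma a s <= Phi t' - Phi a by exact: h.
elim: s a {ps ls} => [|x s IH] a ta /=.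
  by move=> _ ->; rewrite mulr0 subrr.
move=> /andP[ax xs] ls; have a0 := le_trans t0 ta.
have xt' : x <= t' by apply: (@itv_partition_ge _ _ _ s); split=> //; apply/eqP.
have := IH x (le_trans ta (ltW ax)) xs ls.
have := Phi_step m a0 (ltW ax).
suff : A * mdist (gamma a) (gamma x) <=
  (iconv w m (gamma a) - m%:R * L * (x - a)) * mdist (gamma a) (gamma x) by lra.
rewrite ler_wpM2r ?mdist_ge0//.
have := iconv_leD w_ge0 m (gamma t) (gamma a).
have := ler_wpM2l (ler0n R m) (gamma_lip t0 ta).
have := ler_wpM2l (mulr_ge0 (ler0n R m) L_ge0) xt'.
by rewrite /A; lra.
Qed.

(** On a short interval the loss in [Phi_len] is of second order, because the length of the piece is
    itself at most [L] times the duration. [locally_nonincreasing] then removes it. *)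
Let Phi_inf m M t t' : 0 <= t -> t <= t' -> t' <= 1 ->
  (forall r, t <= r <= t' -> M <= iconv w m (gamma r)) ->
  M * (len 0 t' - len 0 t) <= Phi t' - Phi t.
Proof.
move=> t0 tt' t'1 hM; apply/ler_addgt0Pr => e e0.
suff : M * len 0 t' - Phi t' - e * t' <= M * len 0 t - Phi t - e * t.
  by nra.
apply: (@locally_nonincreasing _ (fun r => M * len 0 r - Phi r - e * r)) => //.
move=> x /andP[tx xt'].
pose B : R := m%:R * L * L.
have B0 : 0 <= B by rewrite !mulr_ge0.
have B1 : 0 < B + 1 by rewrite ltr_wpDl.
(* Two points this close to [x] differ by at most [e / (B + 1)], so the loss [B * (s - r) * (s - r)]
   is at most [e * (s - r)]. *)
exists (e / (B + 1) / 2) => [|r s tr st' xr sx rs]; first by rewrite !divr_gt0.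
have r0 := le_trans t0 tr; have s1 := le_trans st' t'1.
have := length_onD fin (lexx 0) r0 rs s1 => ->.
have l0 := length_on_ge0 fin r0 rs s1.
have l1 := len_le r0 rs s1.
have := Phi_len m r0 rs s1.
have := hM r; rewrite tr (le_trans rs st') => /(_ isT) Mr.
have rs_e : (B + 1) * (s - r) <= e.
  rewrite mulrC -ler_pdivlMr//; move: xr sx; set q := e / (B + 1); lra.
have : M * len r s <= iconv w m (gamma r) * len r s by rewrite ler_wpM2r.
have : m%:R * L * (s - r) * len r s <= B * (s - r) * (s - r).
  have -> : B * (s - r) * (s - r) = m%:R * L * (s - r) * (L * (s - r)).
    by rewrite /B; ring.
  by rewrite ler_wpM2l// !mulr_ge0// subr_ge0.
have : B * (s - r) * (s - r) <= e * (s - r).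
  rewrite ler_wpM2r ?subr_ge0//; lra.
by lra.
Qed.

Let ell_gt0 : 0 < len 0 1.
Proof.
by apply: lt_le_trans (mdist_le_length fin _ _ _); rewrite ?mdist_gt0.
Qed.

Let iconv_lipschitz m : real_locally_lipschitz (iconv w m).
Proof.
by move=> x; exists 1 => //; exists m%:R => y z _ _; exact: iconv_lip.
Qed.

(** [Phi] composed with [arc_time] grows at least at the rate length times weight. As
    [integral_compare] gives upper bounds, it is applied to the negatives. *)
Let iconv_integral m :
  len 0 1 * Rintegral leb `[0, 1] (iconv w m \o constant_speed gamma) <= c.
Proof.
set cs := constant_speed gamma; set ell := len 0 1.
have ch := locally_lipschitz_continuous (iconv_lipschitz m).
have cf := continuous_constant_speed rect ch.
pose f t := - (ell * iconv w m (cs t)).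
have cont : {within `[0, 1], continuous f}.
  apply/subspace_continuousP => x x01; apply: cvgN; apply: cvgM.
    exact: cvg_cst.
  by have /subspace_continuousP := cf; exact.
have -> : ell * Rintegral leb `[0, 1] (iconv w m \o cs) = - Rintegral leb `[0, 1] f.
  rewrite -[f]/(fun t => - (ell * iconv w m (cs t))).
  under [in RHS]eq_Rintegral do rewrite -mulNr.
  have intf : leb.-integrable `[0, 1] (EFin \o (iconv w m \o cs)).
    by apply: continuous_compact_integrable => //; exact: segment_compact.
  by rewrite RintegralZl// mulNr opprK.
suff : - Phi (arc_time gamma 1) - - Phi (arc_time gamma 0) <= Rintegral leb `[0, 1] f.
  have [/andP[a0 a1] _] : 0 <= arc_time gamma 1 <= 1 /\ _ :=
    @arc_timeP _ _ gamma rect 1 ltac:(lra).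
  have [/andP[b0 b1] _] : 0 <= arc_time gamma 0 <= 1 /\ _ :=
    @arc_timeP _ _ gamma rect 0 ltac:(lra).
  have h1 := Phi_mono a0 a1; have h2 := Phi_mono (lexx 0) b0.
  by have := Phi0; have := Phi1; lra.
apply: (@integral_compare _ f (fun t => - Phi (arc_time gamma t))) => // x x01 e e0.
pose B : R := ell * (m%:R * ell) + 1.
have B0 : 0 < B by rewrite ltr_wpDl// !mulr_ge0// ltW.
exists (e / B) => [|r s r0 s1 xr sx rs]; first exact: divr_gt0.
have r01 : 0 <= r <= 1 by rewrite r0 (le_trans rs).
have s01 : 0 <= s <= 1 by rewrite s1 (le_trans r0).
have [/andP[a0 a1] ea] := arc_timeP rect r01.
have [/andP[b0 b1] eb] := arc_timeP rect s01.
have ab := arc_time_mono rect ell_gt0 r0 rs s1.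
(* By its Lipschitz bound, [iconv w m] stays above [M] on the arc between the two times. *)
pose M := iconv w m (cs x) - m%:R * ell * (e / B).
suff : M * (s * ell - r * ell) <= Phi (arc_time gamma s) - Phi (arc_time gamma r).
  have : (f x + e) * (s - r) - (- (M * (s * ell - r * ell))) =
      (e - ell * (m%:R * ell) * (e / B)) * (s - r).
    by rewrite /f /M; ring.
  have : 0 <= (e - ell * (m%:R * ell) * (e / B)) * (s - r).
    rewrite mulr_ge0 ?subr_ge0// mulrA ler_pdivrMr// mulrC ler_wpM2l ?(ltW e0)//.
    by rewrite /B lerDl.
  lra.
rewrite -ea -eb; apply: (@Phi_inf m) => // t /andP[rt ts].
have t0 := le_trans a0 rt; have t1 := le_trans ts b1.
have t01 : 0 <= t <= 1 by rewrite t0.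
rewrite -(constant_speed_length rect ell_gt0 t01).
have lr : len 0 (arc_time gamma r) <= len 0 t by exact: length_on_mono.
have ls : len 0 t <= len 0 (arc_time gamma s) by exact: length_on_mono.
rewrite ea in lr; rewrite eb in ls; set tau := len 0 t / _.
have rtau : r <= tau by rewrite /tau ler_pdivlMr.
have taus : tau <= s by rewrite /tau ler_pdivrMr.
have tau01 : 0 <= tau <= 1 by rewrite (le_trans r0 rtau) (le_trans taus s1).
have := iconv_leD w_ge0 m (cs x) (cs tau).
have := constant_speed_lip rect x01 tau01; rewrite -/cs -/ell => hd.
have hx : `|x - tau| <= e / B by rewrite ler_norml; move: xr sx; set q := e / B; lra.
have {hd}hd : mdist (cs x) (cs tau) <= ell * (e / B).
  by apply: le_trans hd _; rewrite ler_wpM2l// ltW// ell_gt0.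
have := ler_wpM2l (ler0n R m) hd; rewrite /M; set q := e / B; lra.
Qed.

(** Monotone convergence in [m], since lower semicontinuity makes [iconv w m] increase to [w]. *)
Lemma limit_path_integral : (path_integral w gamma <= c%:E)%E.
Proof.
set cs := constant_speed gamma.
have intm (m : nat) : ((len 0 1)%:E *
    \int[leb]_(t in `[0%R, 1%R]) (iconv w m (cs t))%:E <= c%:E)%E.
  have ch := locally_lipschitz_continuous (iconv_lipschitz m).
  have := path_integralE rect ch; rewrite /path_integral curve_length_length//.
  by move=> ->; rewrite lee_fin iconv_integral.
have mI (m : nat) : measurable_fun (`[0, 1] : set R) (fun t => (iconv w m (cs t))%:E).
  have ch := locally_lipschitz_continuous (iconv_lipschitz m).
  apply/measurable_EFinP; apply: subspace_continuous_measurable_fun => //.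
  exact: continuous_constant_speed.
have cvgI : (fun m => \int[leb]_(t in `[0%R, 1%R]) (iconv w m (cs t))%:E)%E @ \oo -->
    (\int[leb]_(t in `[0%R, 1%R]) w (cs t))%E.
  have -> : (\int[leb]_(t in `[0%R, 1%R]) w (cs t) =
      \int[leb]_(t in `[0%R, 1%R]) limn (fun m => (iconv w m (cs t))%:E))%E.
    by apply: eq_integral => t _; apply/esym/cvg_lim => //; exact: iconv_cvg.
  apply: cvg_monotone_convergence => //.
    by move=> m t _; rewrite lee_fin iconv_ge0.
  by move=> t _ m n mn; rewrite lee_fin iconv_mono.
rewrite /path_integral curve_length_length//.
have c1 : (fun m => (len 0 1)%:E *
    \int[leb]_(t in `[0%R, 1%R]) (iconv w m (cs t))%:E)%E @ \oo -->
    ((len 0 1)%:E * \int[leb]_(t in `[0%R, 1%R]) w (cs t))%E.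
  exact: cvgeZl.
apply: (cvge_to_le c1); exact: nearW.
Qed.

End limit_curves.

(** Uniformity on [F] costs nothing: a failure for every [n], at points that depend on [n], already
    supplies the chains for the compactness argument. *)
Lemma chain_inf_ge_near {R : realType} {X : pmetricType R}
    (w : X -> \bar R) (E F C : set X) (c c0 s0 D0 : R) :
  (forall a : R, open [set x | (a%:E < w x)%E]) ->
  0 < c0 -> (forall x, (c0%:E <= w x)%E) ->
  (forall r M : R, 0 < r -> exists D : seq X, forall x,
    (w x <= M%:E)%E -> exists2 z, z \in D & mdist z x < r) ->
  0 < s0 -> complete_set C ->
  (forall x y, (w y < +oo)%E -> mdist x y < s0 -> C x) ->
  closed E -> closed F -> 0 < D0 ->
  (forall x y, E x -> F y -> D0 <= mdist x y) ->
  (forall gamma, rectifiable gamma -> E (gamma 0) -> F (gamma 1) ->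
    (1 <= path_integral w gamma)%E) ->
  c < 1 ->
  exists n, forall x, F x -> c <= chain_inf (iconv w n) E n.+1%:R^-1 x.
Proof.
move=> w_lsc c0_gt0 w_ge w_cover s0_gt0 cC w_near clE clF D0_gt0 EF adm c1.
have w_ge0 x : (0 <= w x)%E by apply: le_trans (w_ge x); rewrite lee_fin ltW.
apply: contrapT => nex.
have /choice[p /choice[N pN]] n : exists p N, [/\ E (p 0%N), F (p N),
    forall k, (k < N)%N -> mdist (p k) (p k.+1) <= n.+1%:R^-1 &
    chain_cost (iconv w n) p N <= c].
  apply: contrapT => nch; apply: nex; exists n => x Fx.
  rewrite leNgt; apply/negP.
  move=> /chain_inf_lt/(_ (ltW c1))[p [N [[Ep px pd] pc]]].
  by apply: nch; exists p, N; split=> //; rewrite ?px ?ltW.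
have pE n : E (p n 0%N) by case: (pN n).
have pF n : F (p n (N n)) by case: (pN n).
have pd n k : (k < N n)%N -> mdist (p n k) (p n k.+1) <= n.+1%:R^-1.
  by case: (pN n) => _ _ h _; exact: h.
have pc n : chain_cost (iconv w n) (p n) (N n) <= c by case: (pN n).
have [U [ultraU Uoo]] := ultraFilterLemma (eventually_filter).
have [gamma [Phi [E0 F1 lip [[Phi0 Phi1] Phim] step]]] :=
  chain_limit c0_gt0 w_ge w_cover s0_gt0 cC w_near clE clF D0_gt0 EF
    pE pF pd pc ultraU Uoo.
have c_ge0 : 0 <= c.
  by apply: le_trans (pc 0%N); apply: chain_cost_ge0; exact: iconv_ge0.
have L0 : 0 <= c / c0 + 1 by rewrite addr_ge0// divr_ge0// ltW.
have neq : gamma 0 != gamma 1.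
  by rewrite -mdist_gt0; apply: lt_le_trans D0_gt0 (EF _ _ E0 F1).
have rect := lipschitz_rectifiable L0 lip.
have := limit_path_integral w_ge0 w_lsc L0 lip Phim Phi0 Phi1 step neq.
move=> /(le_trans (adm _ rect E0 F1)); rewrite lee_fin; lra.
Qed.

(** * Complete sublevels *)

Section completeness_radius.
Context {R : realType} {X : pmetricType R}.
Implicit Types (x y : X) (r a : R).

Lemma complete_closed_ball (U : set X) x r : complete_set U ->
  (forall y, mdist x y <= r -> U y) -> complete_set [set y | mdist x y <= r].
Proof.
move=> cU sub u ux cu; have [z Uz uz] := cU u (fun n => sub _ (ux n)) cu.
exists z => //=; apply/ler_addgt0Pr => e e0.
have [N hN] := (cvg_mdistP _ _).1 uz e e0.
have := metric_triangle x (u N) z; have := hN N (leqnn N); have := ux N.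
by rewrite (metric_sym (u N) z) /=; lra.
Qed.

(** The bound 1 keeps the supremum finite when [X] is complete. *)
Definition complete_radii x :=
  [set r : R | 0 <= r <= 1 /\ complete_set [set y | mdist x y <= r]].

Definition complete_radius x : R := sup (complete_radii x).

Hypothesis locc : locally_complete X.

Lemma complete_radii_gt0 x : exists2 r, 0 < r & complete_radii x r.
Proof.
have [U /nbhs_mdist[e e0 eU] cU] := locc x.
pose r := Num.min 1 (e / 2).
have r0 : 0 < r by rewrite lt_min ltr01 divr_gt0.
have r1 : r <= 1 by rewrite ge_min lexx.
have re : r <= e / 2 by rewrite ge_min lexx orbT.
exists r => //; split; first by rewrite ltW.
by apply: complete_closed_ball cU _ => y xy; apply: eU; lra.
Qed.

Let ub_radii x : ubound (complete_radii x) 1.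
Proof. by move=> r [/andP[]]. Qed.

Lemma complete_radius_gt0 x : 0 < complete_radius x.
Proof.
have [r r0 xr] := complete_radii_gt0 x.
by apply: lt_le_trans r0 _; apply: ub_le_sup => //; exists 1; exact: ub_radii.
Qed.

(** The closed ball of radius [r - mdist x y] about [y] lies in that of radius [r] about [x], and
    inherits its completeness. *)
Lemma complete_radius_leD x y :
  complete_radius x <= complete_radius y + mdist x y.
Proof.
have [r0 _ xr0] := complete_radii_gt0 x.
apply: ge_sup; first by exists r0.
move=> r [/andP[rge0 rle1] cr]; have [rd|dr] := leP r (mdist x y).
  by apply: le_trans rd _; rewrite lerDr ltW// complete_radius_gt0.
rewrite -lerBlDr; apply: ub_le_sup; first by exists 1; exact: ub_radii.
split; first by have := mdist_ge0 x y; lra.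
apply: complete_closed_ball cr _ => z yz.
by have := metric_triangle x y z; rewrite /=; lra.
Qed.

(** [rho] is the minimum of the completeness radius and of 1/(1 + d(x0, x)). The first makes its
    superlevel sets complete, the second makes them bounded and later of finite measure. *)
Lemma exists_completeness_gauge (x0 : X) : exists rho : X -> R,
  [/\ forall x, 0 < rho x,
    forall x y, `|rho x - rho y| <= mdist x y,
    forall a, 0 < a -> complete_set [set x | a <= rho x] &
    forall a x, 0 < a -> a <= rho x -> mdist x0 x < a^-1].
Proof.
have q0 x : 0 < 1 + mdist x0 x by rewrite ltr_wpDr// mdist_ge0.
pose far x := (1 + mdist x0 x)^-1.
have far_leD x y : far x <= far y + mdist x y.
  have dd := mdist_ge0 x y; have far0 z : 0 <= far z by rewrite invr_ge0 ltW.
  have far1 z : far z <= 1 by rewrite invf_le1// lerDl mdist_ge0.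
  have : far x - far y = (mdist x0 y - mdist x0 x) * (far x * far y).
    by rewrite /far; field; rewrite !gt_eqF.
  have : mdist x0 y - mdist x0 x <= mdist x y by have := metric_triangle x0 x y; lra.
  have : 0 <= far x * far y by exact: mulr_ge0.
  have : far x * far y <= 1 by exact: mulr_ile1.
  by nra.
pose rho x := Num.min (complete_radius x) (far x).
have rho_leD x y : rho x <= rho y + mdist x y.
  rewrite -lerBlDr le_min !lerBlDr /rho !ge_min complete_radius_leD far_leD.
  by rewrite orbT.
have rho_lip x y : `|rho x - rho y| <= mdist x y.
  have := rho_leD x y; have := rho_leD y x.
  by rewrite (metric_sym y x) ler_norml; lra.
exists rho; split=> //.
- by move=> x; rewrite /rho lt_min complete_radius_gt0 invr_gt0 q0.
- move=> a a0 u ua /cauchy_mdist cu.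
  have a20 : 0 < a / 2 by exact: divr_gt0.
  (* The tail of the sequence is within [a / 2] of [u N], and the completeness radius of [u N]
     exceeds [a / 2], so this tail lies in a complete ball. *)
  have [N hN] := cu _ a20.
  have aN : a / 2 < complete_radius (u N).
    by have := ua N; rewrite /= /rho le_min => /andP[]; lra.
  have [|r [_ cr] ar] := sup_gt _ aN.
    by have [r _ h] := complete_radii_gt0 (u N); exists r.
  have [||z _ uz] := cr (fun n => u (N + n)%N).
  + by move=> n /=; have := hN N (N + n)%N (leqnn N) (leq_addr _ _); lra.
  + apply/cauchy_mdist => e e0; have [M hM] := cu e e0.
    by exists M => m n Mm Mn; apply: hM; exact: leq_trans (leq_addl _ _).
  have {}uz : u @ \oo --> z.
    apply/cvg_mdistP => e e0; have [M hM] := (cvg_mdistP _ _).1 uz e e0.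
    exists (N + M)%N => n NMn.
    have := hM (n - N)%N; rewrite subnKC; last exact: leq_trans (leq_addr _ _) NMn.
    by apply; rewrite leq_subRL// (leq_trans (leq_addr _ _) NMn).
  exists z => //=; apply/ler_addgt0Pr => e e0.
  have [M hM] := (cvg_mdistP _ _).1 uz e e0.
  have := rho_leD (u M) z; have := hM M (leqnn M); have := ua M.
  by rewrite (metric_sym (u M) z) /=; lra.
- move=> a x a0; rewrite /rho le_min => /andP[_].
  rewrite /far -{1}(invrK a) lef_pV2 ?posrE ?invr_gt0//; lra.
Qed.

End completeness_radius.

(** * Borel measures *)

Section borel_regularity.
Context {R : realType} {X : pmetricType R}.
Variable mu : {measure set (borel X) -> \bar R}.
Implicit Types (A O C V : set (borel X)).

Lemma open_mdistP (O : set X) : open O <->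
  forall x, O x -> exists2 e : R, 0 < e & forall y, mdist x y < e -> O y.
Proof.
split=> [oO x Ox|h]; first by apply/nbhs_mdist; exact: open_nbhs_nbhs.
by rewrite openE => x /h /nbhs_mdist.
Qed.

Lemma open_borel (O : set X) : open O -> measurable (O : set (borel X)).
Proof. by move=> oO; exact: sub_sigma_algebra. Qed.

Lemma closed_borel (C : set X) : closed C -> measurable (C : set (borel X)).
Proof.
move=> cC; rewrite -(setCK (C : set (borel X))); apply: measurableC.
by apply: open_borel; exact: closed_openC.
Qed.

Lemma decreasing_measure_small (B : nat -> set (borel X)) e :
  (forall n, measurable (B n)) -> (forall m n, (m <= n)%N -> B n `<=` B m) ->
  (mu (B 0%N) < +oo)%E -> (forall x, ~ (forall n, B n x)) -> 0 < e ->
  exists n, (mu (B n) <= e%:E)%E.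
Proof.
move=> mB dB fB0 empty e0.
have B0 : \bigcap_n B n = set0.
  by apply/seteqP; split=> // x Bx; apply: (empty x) => n; exact: Bx.
have cvgB : mu \o B @ \oo --> mu (\bigcap_n B n).
  apply: nonincreasing_cvg_mu => //; first by rewrite B0.
  by move=> m n mn; apply/subsetPset; exact: dB.
rewrite B0 measure0 in cvgB.
have /cvgB[n _ hn] : nbhs (0%E : \bar R) [set y | (y < e%:E)%E].
  by apply: open_nbhs_nbhs; split; [exact: open_ereal_lt_ereal | rewrite /= lte_fin].
by exists n; apply/ltW/(hn n) => /=.
Qed.

(* Openness of approximating sets cannot be preserved by complements, hence the
   two-sided approximation. *)
Lemma finite_borel_regular V A e : open (V : set X) -> (mu V < +oo)%E ->
  measurable A -> 0 < e -> exists O C, [/\ open (O : set X), closed (C : set X),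
    C `<=` A, A `<=` O & (mu (V `&` (O `\` C)) <= e%:E)%E].
Proof.
move=> oV fV mA; move: e.
have mV := open_borel oV.
pose D : set (set (borel X)) := [set A | forall e, 0 < e -> exists O C,
  [/\ open (O : set X), closed (C : set X), C `<=` A, A `<=` O &
   (mu (V `&` (O `\` C)) <= e%:E)%E]].
suff : <<s @open X >> `<=` D by move=> /(_ _ mA).
have fin S : measurable S -> (mu (V `&` S) < +oo)%E.
  move=> mS; apply: le_lt_trans fV; apply: le_measure; rewrite ?inE//.
  exact: measurableI.
apply: smallest_sub; [split|].
- move=> e e0; exists set0, set0; split=> //; first exact: open0.
    exact: closed0.
  by rewrite setD0 setI0 measure0 lee_fin ltW.
- move=> B DB e e0; have [ O [C [oO cC CB BO h]]] := DB e e0.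
  exists (~` C), (~` O); split.
  + exact: closed_openC.
  + exact: open_closedC.
  + by rewrite setTD; exact: subsetC.
  + by rewrite setTD; exact: subsetC.
  + by rewrite (_ : ~` C `\` ~` O = O `\` C)// !setDE setCK setIC.
- move=> B DB e e0; have e20 : 0 < e / 2 by exact: divr_gt0.
  have /choice[ O /choice[C OC]] n : exists O C,
      [/\ open (O : set X), closed (C : set X), C `<=` B n, B n `<=` O &
      (mu (V `&` (O `\` C)) <= (e / 2 / (2 ^ n.+1)%:R)%:E)%E].
    by apply: DB; rewrite divr_gt0// ltr0n expn_gt0.
  have mO n : measurable (O n) by apply: open_borel; case: (OC n).
  have mC n : measurable (C n) by apply: closed_borel; case: (OC n).
  (* An infinite union of closed sets need not be closed, so only finitely many [C i] are kept;
     [W n] is what is lost. *)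
  pose K n := \big[setU/set0]_(i < n) C i.
  have mK n : measurable (K n) by exact: bigsetU_measurable.
  have mUC : measurable (\bigcup_n C n) by exact: bigcup_measurable.
  pose W n := V `&` (\bigcup_n C n `\` K n).
  have [||||n hn] := @decreasing_measure_small W (e / 2) _ _ _ _ e20.
  + by move=> n; apply: measurableI => //; exact: measurableD.
  + move=> m n mn; apply: setIS; apply: setDS; exact: subset_bigsetU.
  + by apply: fin; exact: measurableD.
  + move=> x Wx; have [_ [[i _ Ci] _]] := Wx 0%N.
    have [_ [_]] := Wx i.+1; apply.
    by rewrite /K -bigcup_mkord; exists i => //=.
  exists (\bigcup_n O n), (K n); split.
  + by apply: bigcup_open => i _; case: (OC i).
  + by apply: closed_bigsetU => i _; case: (OC i).
  + rewrite /K -bigcup_mkord => x [i _ Cx]; exists i => //.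
    by case: (OC i) => _ _ h _ _; exact: h.
  + by move=> x [i _ Bx]; exists i => //; case: (OC i) => _ _ _ h _; exact: h.
  have sub : V `&` (\bigcup_n O n `\` K n) `<=`
      \bigcup_n (V `&` (O n `\` C n)) `|` W n.
    move=> x [Vx [[i _ Ox] nK]]; have [Cx|nCx] := pselect ((\bigcup_n C n) x).
      by right; split.
    by left; exists i => //; split=> //; split=> // Cix; apply: nCx; exists i.
  have mVOC i : measurable (V `&` (O i `\` C i)).
    by apply: measurableI => //; exact: measurableD.
  have mU : measurable (\bigcup_n (V `&` (O n `\` C n))) by exact: bigcup_measurable.
  have mW : measurable (W n) by apply: measurableI => //; exact: measurableD.
  apply: (@le_trans _ _ (mu (\bigcup_n (V `&` (O n `\` C n)) `|` W n))).
    apply: le_measure; rewrite ?inE//; last exact: measurableU.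
    by apply: measurableI => //; apply: measurableD => //; exact: bigcup_measurable.
  apply: le_trans (measureU2 _ _ _) _ => //.
  rewrite [e]splitr EFinD; apply: leeD => //.
  apply: le_trans (epsilon_trick0 xpredT (ltW e20)).
  apply: (@le_trans _ _ (\sum_(i <oo) mu (V `&` (O i `\` C i)))%E).
    exact: measure_sigma_subadditive.
  by apply: lee_nneseries => // i _; case: (OC i).
- move=> O oO e e0.
  (* The points at distance at least 1/(n+1) from the complement form closed sets that exhaust the
     open set. *)
  pose C n : set X := ~` \bigcup_(y in ~` (O : set X)) [set x | mdist y x < n.+1%:R^-1].
  have cC n : closed (C n).
    apply: open_closedC; apply: bigcup_open => y _.
    apply/open_mdistP => x /= yx; exists (n.+1%:R^-1 - mdist y x).
      by rewrite subr_gt0.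
    by move=> z; have := metric_triangle y x z; set r := _^-1; lra.
  have CO n : C n `<=` O.
    move=> x Cx; apply: contrapT => nOx; apply: Cx; exists x => //=.
    by rewrite mdistxx invr_gt0.
  have mO := open_borel oO.
  have mC n : measurable (C n : set (borel X)) by exact: closed_borel.
  pose W n : set (borel X) := V `&` (O `\` C n).
  have [||||n hn] := @decreasing_measure_small W e _ _ _ _ e0.
  + by move=> n; apply: measurableI => //; exact: measurableD.
  + move=> m n mn; apply: setIS; apply: setDS; apply: subsetC => x [y Oy yx].
    exists y => //=; apply: lt_le_trans yx _.
    by rewrite lef_pV2 ?posrE// ler_nat ltnS.
  + by apply: fin; exact: measurableD.
  + move=> x Wx; have [_ [Ox _]] := Wx 0%N.
    have [r r0 hr] := (open_mdistP _).1 oO x Ox.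
    have [_ [_]] := Wx (Num.truncn r^-1); apply => -[y nOy yx]; apply: nOy.
    apply: hr; rewrite metric_sym; apply: lt_trans yx _.
    by rewrite invf_plt ?posrE// truncnS_gt.
  by exists O, (C n); split.
Qed.

Variable V : nat -> set (borel X).
Hypothesis openV : forall n, open (V n : set X).
Hypothesis finV : forall n, (mu (V n) < +oo)%E.
Hypothesis coverV : forall x, exists n, V n x.

(** [finite_borel_regular] controls the excess only inside [V n], so the [n]-th open set is cut down
    to [V n] before the union is taken. *)
Lemma borel_outer_regular A e : measurable A -> 0 < e ->
  exists O, [/\ open (O : set X), A `<=` O & (mu (O `\` A) <= e%:E)%E].
Proof.
move=> mA e0.
have /choice[ O OP] n : exists O : set (borel X), [/\ open (O : set X), A `<=` O &
    (mu (V n `&` (O `\` A)) <= (e / (2 ^ n.+1)%:R)%:E)%E].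
  have [| O [C [oO cC CA AO h]]] :=
    finite_borel_regular (openV n) (finV n) mA (e := e / (2 ^ n.+1)%:R).
    by rewrite divr_gt0// ltr0n expn_gt0.
  exists O; split=> //; apply: le_trans h; apply: le_measure; rewrite ?inE.
  - apply: measurableI; first exact: open_borel.
    by apply: measurableD => //; exact: open_borel.
  - apply: measurableI; first exact: open_borel.
    by apply: measurableD; [exact: open_borel|exact: closed_borel].
  - by apply: setIS; exact: setDS.
have mO n : measurable (O n) by apply: open_borel; case: (OP n).
have mV n : measurable (V n) by exact: open_borel.
have mW n : measurable (V n `&` (O n `\` A)).
  by apply: measurableI => //; exact: measurableD.
exists (\bigcup_n (V n `&` O n)); split.
- by apply: bigcup_open => n _; apply: openI => //; case: (OP n).
- move=> x Ax; have [n Vx] := coverV x; exists n => //; split=> //.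
  by case: (OP n) => _ h _; exact: h.
apply: le_trans (epsilon_trick0 xpredT (ltW e0)).
apply: (@le_trans _ _ (\sum_(n <oo) mu (V n `&` (O n `\` A)))%E).
  apply: measure_sigma_subadditive => //.
    apply: measurableD => //; apply: bigcup_measurable => n _.
    exact: measurableI.
  by move=> x [[n _ [Vx Ox]] nA]; exists n.
by apply: lee_nneseries => // n _; case: (OP n).
Qed.

End borel_regularity.

(** * Semicontinuous majorants *)

Section greedy.
Context d {T : measurableType d} {R : realType}.
Variable f : T -> \bar R.
Hypotheses (mf : measurable_fun setT f) (f0 : forall x, (0 <= f x)%E).

(* Greedy expansion of f along the divergent series of the 1/(k+1). *)
Fixpoint greedy_sum n (x : T) : R :=
  if n is k.+1 then
    greedy_sum k x +
    (if ((greedy_sum k x + harmonic k)%:E <= f x)%E then harmonic k else 0)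
  else 0.

Definition greedy_set n : set T :=
  [set x | ((greedy_sum n x + harmonic n)%:E <= f x)%E].

Let hge0 n : 0 <= harmonic n :> R. Proof. by rewrite /harmonic /= invr_ge0. Qed.

Lemma greedy_sumS n x :
  greedy_sum n.+1 x = greedy_sum n x + harmonic n * \1_(greedy_set n) x.
Proof.
rewrite /= indicE; congr (_ + _).
case: ifPn => h; first by rewrite mem_set ?mulr1.
by rewrite memNset ?mulr0//; exact/negP.
Qed.

Lemma greedy_sum_le n x : ((greedy_sum n x)%:E <= f x)%E.
Proof. by elim: n => [|n IH] //=; case: ifPn; rewrite ?addr0. Qed.

Lemma measurable_greedy_sum n : measurable_fun setT (greedy_sum n).
Proof.
elim: n => [|n IH]; first exact: measurable_cst.
have mS : measurable (greedy_set n).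
  rewrite -[greedy_set n]setTI; apply: measurable_lee => //.
  by apply/measurable_EFinP; exact: measurable_funD.
rewrite (_ : greedy_sum n.+1 =
  (greedy_sum n \+ (cst (harmonic n) \* \1_(greedy_set n)))%R).
  by apply: measurable_funD => //; exact: measurable_funM.
by apply/funext => x; rewrite greedy_sumS.
Qed.

Lemma measurable_greedy_set n : measurable (greedy_set n).
Proof.
rewrite -[greedy_set n]setTI; apply: measurable_lee => //.
apply/measurable_EFinP; apply: measurable_funD => //.
exact: measurable_greedy_sum.
Qed.

(** If the greedy sums stayed below [r], then every term would be taken once the terms are at most
    [e], and the harmonic series would converge. *)
Let greedy_sum_exceeds x (r : R) : (r%:E < f x)%E -> exists n, r < greedy_sum n x.
Proof.
move=> rf; apply: contrapT => h.
have {}h n : greedy_sum n x <= r by rewrite leNgt; apply/negP => rn; apply: h; exists n.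
have [e e0 re] : exists2 e : R, 0 < e & ((r + e)%:E <= f x)%E.
  case: (f x) rf => [s| |]//; last by exists 1; rewrite ?leey.
  by rewrite lte_fin => rs; exists (s - r); rewrite ?subr_gt0// lee_fin; lra.
pose N := Num.truncn e^-1.
have small n : (N <= n)%N -> harmonic n <= e :> R.
  move=> Nn; rewrite /harmonic /= invf_ple ?posrE//.
  by apply: le_trans (ltW (truncnS_gt _)) _; rewrite ler_nat ltnS.
have step n : (N <= n)%N -> greedy_sum n.+1 x = greedy_sum n x + harmonic n.
  move=> Nn /=; rewrite ifT//; apply: le_trans re.
  by rewrite lee_fin lerD// small.
have sum_le n : series harmonic (N + n)%N <= r + series harmonic N :> R.
  suff -> : series harmonic (N + n)%N =
      greedy_sum (N + n) x - greedy_sum N x + series harmonic N :> R.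
    have := h (N + n)%N; have : (0 : R) <= greedy_sum N x.
      by elim: N {small step} => //= k IH; case: ifP; rewrite ?addr0 ?addr_ge0.
    lra.
  elim: n => [|n IH]; first by rewrite addn0; lra.
  rewrite addnS step ?leq_addr// seriesSr IH; lra.
apply: (@dvg_harmonic R); apply: nondecreasing_is_cvgn.
  apply/nondecreasing_seqP => n; rewrite seriesSr lerDl; exact: hge0.
exists (r + series harmonic N) => _ [n _ <-].
have [Nn|nN] := leqP N n; first by rewrite -(subnKC Nn); exact: sum_le.
apply: le_trans (sum_le 0%N); rewrite addn0.
have : nondecreasing_seq (series (@harmonic R)).
  by apply/nondecreasing_seqP => k; rewrite seriesSr lerDl; exact: hge0.
by apply; exact: ltnW.
Qed.

Lemma greedy_series x :
  f x = (\sum_(k <oo) (harmonic k * \1_(greedy_set k) x)%:E)%E.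
Proof.
have part n : (\sum_(0 <= k < n) (harmonic k * \1_(greedy_set k) x)%:E)%E =
    (greedy_sum n x)%:E.
  elim: n => [|n IH]; first by rewrite big_nil.
  by rewrite greedy_sumS big_nat_recr//= IH EFinD.
have nd : nondecreasing_seq (fun n => (greedy_sum n x)%:E).
  apply/nondecreasing_seqP => n; rewrite lee_fin greedy_sumS lerDl mulr_ge0//.
suff : (fun n => (greedy_sum n x)%:E) @ \oo --> f x.
  by move=> cv; apply/esym/cvg_lim => //; under eq_fun do rewrite part.
have := ereal_nondecreasing_cvgn nd; congr (_ --> _).
apply/eqP; rewrite eq_le; apply/andP; split.
  by apply: ub_ereal_sup => _ [n _ <-]; exact: greedy_sum_le.
rewrite leNgt; apply/negP => sf.
have ub n : ((greedy_sum n x)%:E <= ereal_sup (range (fun n => (greedy_sum n x)%:E)))%E.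
  by apply: ereal_sup_ubound; exists n.
move: sf ub; set s := ereal_sup _; case: s => [s| |].
- by move=> /greedy_sum_exceeds[n sn] /(_ n); rewrite lee_fin leNgt sn.
- by rewrite ltNge leey.
- by move=> _ /(_ 0%N).
Qed.

End greedy.

Section lower_semicontinuity.
Context {R : realType} {X : pmetricType R}.
Implicit Types (f g : X -> \bar R).

(** A finite partial sum that exceeds [a] at [x] does not decrease near [x], because the sets
    containing [x] are open. *)
Lemma lsc_open_series (c : nat -> R) (O : nat -> set X) :
  (forall k, 0 <= c k) -> (forall k, open (O k)) ->
  forall a : R, open [set x | (a%:E < \sum_(k <oo) (c k * \1_(O k) x)%:E)%E].
Proof.
move=> c0 oO a; apply/open_mdistP => x /= ax.
pose P n y : R := \sum_(k < n) c k * \1_(O k) y.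
have PE n y : (\sum_(0 <= k < n) (c k * \1_(O k) y)%:E)%E = (P n y)%:E.
  by rewrite sumEFin big_mkord.
have t0 k y : 0 <= c k * \1_(O k) y by rewrite mulr_ge0// indicE.
have [n an] : exists n, a < P n x.
  apply: contrapT => h; move: ax; apply/negP; rewrite -leNgt.
  apply: lime_le; first by apply: is_cvg_nneseries => k _ _; rewrite lee_fin.
  apply: nearW => n; rewrite PE lee_fin leNgt; apply/negP => an; apply: h.
  by exists n.
have [e e0 he] : exists2 e : R, 0 < e & forall y, mdist x y < e -> P n x <= P n y.
  elim: n {an} => [|n [e e0 he]]; first by exists 1 => // y _; rewrite /P !big_ord0.
  rewrite /P; have [Ox|nOx] := pselect (O n x).
    have [r r0 hr] := (open_mdistP _).1 (oO n) x Ox.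
    exists (Num.min e r) => [|y]; first by rewrite lt_min e0.
    rewrite lt_min => /andP[ye yr]; rewrite !big_ord_recr /=.
    by rewrite lerD//; [exact: he | rewrite !indicE !mem_set//; exact: hr].
  exists e => // y ye; rewrite !big_ord_recr /= lerD//; first exact: he.
  by rewrite [X in c n * X]indicE memNset// mulr0.
exists e => // y ye; apply: (@lt_le_trans _ _ (P n y)%:E).
  by rewrite lte_fin; apply: lt_le_trans an (he y ye).
by rewrite -PE; apply: nneseries_lim_ge => k _ _; rewrite lee_fin.
Qed.

Lemma lsc_add f g : (forall x, (0 <= f x)%E) -> (forall x, (0 <= g x)%E) ->
  (forall a : R, open [set x | (a%:E < f x)%E]) ->
  (forall a : R, open [set x | (a%:E < g x)%E]) ->
  forall a : R, open [set x | (a%:E < f x + g x)%E].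
Proof.
move=> f0 g0 of_ og a.
have -> : [set x | (a%:E < f x + g x)%E] = \bigcup_(b in [set: R])
    ([set x | (b%:E < f x)%E] `&` [set x | ((a - b)%:E < g x)%E]).
  apply/seteqP; split=> x /=; last first.
    by move=> [b _ [bf abg]]; have := lteD bf abg; rewrite -EFinD subrKC.
  move=> h; suff [b [bf abg]] : exists b : R, (b%:E < f x)%E /\ ((a - b)%:E < g x)%E.
    by exists b.
  have := f0 x; have := g0 x; move: h.
  case: (f x) => [r| |]//; case: (g x) => [s| |]//.
  - rewrite -EFinD lte_fin => h _ _; exists (r - (r + s - a) / 2).
    by rewrite !lte_fin; lra.
  - by exists (r - 1); rewrite ltry lte_fin; lra.
  - by exists (a - s + 1); rewrite ltry lte_fin; lra.
  - by exists 0; rewrite !ltry.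
by apply: bigcup_open => b _; exact: openI.
Qed.

End lower_semicontinuity.

Section lsc_weights.
Context {R : realType} {X : pmetricType R}.
Variable mu : {measure set (borel X) -> \bar R}.
Variable V : nat -> set (borel X).
Hypothesis openV : forall n, open (V n : set X).
Hypothesis finV : forall n, (mu (V n) < +oo)%E.
Hypothesis coverV : forall x, exists n, V n x.

Lemma integral_open_series (c : nat -> R) (O : nat -> set (borel X)) :
  (forall k, 0 <= c k) -> (forall k, measurable (O k)) ->
  (\int[mu]_x (\sum_(k <oo) (c k * \1_(O k) x)%:E) =
   \sum_(k <oo) (c k)%:E * mu (O k))%E.
Proof.
move=> c0 mO; rewrite integral_nneseries//.
- apply: eq_eseriesr => k _; under eq_integral do rewrite EFinM.
  rewrite ge0_integralZl_EFin//.
  + by rewrite integral_indic// setIT.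
  + by apply/measurable_EFinP; exact: measurable_indic.
- by move=> k; apply/measurable_EFinP; exact: measurable_funM.
- by move=> k x _; rewrite lee_fin mulr_ge0// indicE.
Qed.

(* Vitali-Caratheodory *)
Lemma lsc_majorant (f : X -> \bar R) e :
  measurable_fun [set: borel X] (f : borel X -> \bar R) ->
  (forall x, (0 <= f x)%E) -> 0 < e ->
  exists G : X -> \bar R, [/\ forall x, (f x <= G x)%E,
    forall a : R, open [set x | (a%:E < G x)%E] &
    (\int[mu]_x G x <= \int[mu]_x f x + e%:E)%E].
Proof.
move=> mf f0 e0.
pose A := @greedy_set _ (borel X) R f.
have mA k : measurable (A k) by exact: measurable_greedy_set.
have fE x : f x = (\sum_(k <oo) (harmonic k * \1_(A k) x)%:E)%E.
  exact: (@greedy_series _ (borel X)).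
have h0 k : 0 <= harmonic k :> R by rewrite /harmonic /= invr_ge0.
(* Coefficients at most 1 bound the excess of the [k]-th term by the measure of [O k] minus
   [A k]. *)
have h1 k : harmonic k <= 1 :> R by rewrite /harmonic /= invf_le1// ler1n.
have /choice[ O OP] k : exists O : set (borel X), [/\ open (O : set X), A k `<=` O &
    (mu (O `\` A k) <= (e / (2 ^ k.+1)%:R)%:E)%E].
  apply: borel_outer_regular openV finV coverV _ _ (mA k) _.
  by rewrite divr_gt0// ltr0n expn_gt0.
have oO k : open (O k : set X) by case: (OP k).
have mO k : measurable (O k) by exact: open_borel.
have AO k : A k `<=` O k by case: (OP k).
exists (fun x => \sum_(k <oo) (harmonic k * \1_(O k) x)%:E)%E; split.
- move=> x; rewrite fE; apply: lee_nneseries => k _.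
    by move=> _; rewrite lee_fin mulr_ge0// indicE.
  rewrite lee_fin ler_wpM2l// !indicE ler_nat.
  by case: (boolP (x \in A k)) => // /set_mem /AO/mem_set ->.
- exact: lsc_open_series.
rewrite integral_open_series//.
under eq_integral do rewrite fE.
rewrite integral_open_series//.
apply: (@le_trans _ _ (\sum_(k <oo) ((harmonic k)%:E * mu (A k) +
    (e / (2 ^ k.+1)%:R)%:E))%E); last first.
  by apply: epsilon_trick => [k|]; [rewrite mule_ge0 ?lee_fin|exact: ltW].
apply: lee_nneseries => k _; first by rewrite mule_ge0 ?lee_fin.
have -> : mu (O k) = (mu (A k) + mu (O k `\` A k))%E.
  rewrite -measureU//; last 2 first.
  - exact: measurableD.
  - by rewrite setDIK.
  by rewrite setDUK.
rewrite muleDr//; last by rewrite ge0_adde_def// inE.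
apply: leeD => //; apply: (@le_trans _ _ (1 * mu (O k `\` A k))%E).
  by rewrite lee_wpmul2r// lee_fin.
by rewrite mul1e; case: (OP k).
Qed.

Hypothesis sepX : separable_space X.

(** Balls of radius [r] about a countable dense set cover [X], so what finitely many of them leave
    of [U] has measure tending to 0. Closed balls make this remainder open. *)
Lemma small_outside_balls (U : set (borel X)) r e :
  open (U : set X) -> (mu U < +oo)%E -> 0 < r -> 0 < e ->
  exists D : seq X, exists W : set (borel X), [/\ open (W : set X), (mu W <= e%:E)%E &
    forall x, U x -> W x \/ exists2 z, z \in D & mdist z x <= r].
Proof.
move=> oU fU r0 e0; have [S cS dS] := sepX.
have /countable_injP[i inj] := cS.
(* Left inverse of the injection [i] on [S]; indices outside its range only yield further, harmless
   centers. *)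
pose z n : X := get [set x | S x /\ i x = n].
have zP x : S x -> z (i x) = x.
  move=> Sx; have : [set y | S y /\ i y = i x] x by [].
  by move=> /getI[Sz iz]; apply: inj; rewrite ?inE.
pose K n : set X := \bigcup_(k in `I_n) [set x | mdist (z k) x <= r].
have oK n : open (~` K n).
  apply: closed_openC; rewrite /K bigcup_mkord; apply: closed_bigsetU => k _.
  rewrite -(setCK [set x | _]); apply: open_closedC; apply/open_mdistP => x /=.
  move=> /negP; rewrite -ltNge => rx.
  exists (mdist (z k) x - r) => [|y xy]; first by rewrite subr_gt0.
  apply/negP; rewrite -ltNge; have := metric_triangle (z k) y x.
  by rewrite (metric_sym y); lra.
pose W n : set (borel X) := U `&` ~` K n.
have oW n : open (W n : set X) by exact: openI.
have [||||n hn] := @decreasing_measure_small _ _ mu W e _ _ _ _ e0.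
- by move=> n; exact: open_borel.
- move=> m n mn; apply: setIS; apply: subsetC => x [k /= km kx].
  by exists k => //=; exact: leq_trans km mn.
- apply: le_lt_trans fU; apply: le_measure; rewrite ?inE; try exact: open_borel.
  exact: subIsetl.
- move=> x Wx.
  have [y [Sy]] : S `&` [set y | mdist x y < r] !=set0.
    rewrite setIC; apply: dS; first by exists x; rewrite /= mdistxx.
    apply/open_mdistP => y /= xy; exists (r - mdist x y); first by rewrite subr_gt0.
    by move=> u; have := metric_triangle x y u; lra.
  rewrite /= => xy; have [_] := Wx (i y).+1; apply; exists (i y) => //=.
  by rewrite zP// metric_sym ltW.
exists [seq z k | k <- iota 0 n], (W n); split=> // x Ux.
have [[k kn kx]|nK] := pselect (K n x); last by left.
by right; exists (z k) => //; apply: map_f; rewrite mem_iota.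
Qed.

Let series_term (c : nat -> R) (O : nat -> set X) k x : (forall j, 0 <= c j) -> O k x ->
  ((c k)%:E <= \sum_(j <oo) (c j * \1_(O j) x)%:E)%E.
Proof.
move=> c0 Ox; have t0 j : (0 <= (c j * \1_(O j) x)%:E)%E.
  by rewrite lee_fin mulr_ge0// indicE.
apply: (@le_trans _ _ (\sum_(0 <= j < k.+1) (c j * \1_(O j) x)%:E)%E); last first.
  by apply: nneseries_lim_ge => j _ _.
rewrite big_nat_recr//= [X in (_ + X)%E](_ : _ = (c k)%:E); last first.
  by rewrite indicE mem_set// mulr1.
by rewrite leeDr// sume_ge0.
Qed.

(** Two series, each of integral at most [e / 3], are added to the majorant: [S1] makes the weight
    positive on every [V k], and [S2] makes it at least [b k] on the part of [V k] left uncovered by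
    finitely many balls. *)
Lemma lsc_weight (f : X -> \bar R) (b : nat -> R) e :
  measurable_fun [set: borel X] (f : borel X -> \bar R) ->
  (forall x, (0 <= f x)%E) -> (forall k, 0 <= b k) -> 0 < e ->
  exists G : X -> \bar R, [/\ forall x, (f x <= G x)%E,
    forall a : R, open [set x | (a%:E < G x)%E],
    (\int[mu]_x G x <= \int[mu]_x f x + e%:E)%E,
    forall k, exists2 c : R, 0 < c & forall x, V k x -> (c%:E <= G x)%E &
    forall k, exists D : seq X, forall x, V k x ->
      ((b k)%:E <= G x)%E \/ exists2 z, z \in D & mdist z x <= k.+1%:R^-1].
Proof.
move=> mf f0 b0 e0; have e30 : 0 < e / 3 by exact: divr_gt0.
have [G0 [fG0 oG0 iG0]] := lsc_majorant mf f0 e30.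
have G00 x : (0 <= G0 x)%E by apply: le_trans (fG0 x).
pose q k : R := e / 3 / (2 ^ k.+1)%:R.
have q0 k : 0 < q k by rewrite divr_gt0// ltr0n expn_gt0.
have mV k : measurable (V k) by exact: open_borel.
pose v k := fine (mu (V k)).
have v0 k : 0 <= v k by exact: fine_ge0.
have vE k : mu (V k) = (v k)%:E by rewrite fineK// ge0_fin_numE.
(* The summand 1 avoids a division by zero; [c k] times the measure of [V k] is at most [q k]. *)
pose c k := q k / (1 + v k).
have c0 k : 0 < c k by rewrite divr_gt0// ltr_wpDr.
have /choice[D /choice[W DW]] k : exists D : seq X, exists W : set (borel X),
    [/\ open (W : set X), (mu W <= (q k / (1 + b k))%:E)%E &
    forall x, V k x -> W x \/ exists2 z, z \in D & mdist z x <= k.+1%:R^-1].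
  by apply: small_outside_balls; rewrite ?invr_gt0// divr_gt0// ltr_wpDr.
have oW k : open (W k : set X) by case: (DW k).
have mW k : measurable (W k) by exact: open_borel.
pose S1 (x : X) := (\sum_(k <oo) (c k * \1_(V k) x)%:E)%E.
pose S2 (x : X) := (\sum_(k <oo) (b k * \1_(W k) x)%:E)%E.
have c0' k : 0 <= c k by exact: ltW.
have S10 x : (0 <= S1 x)%E.
  by apply: nneseries_ge0 => k _ _; rewrite lee_fin mulr_ge0// indicE.
have S20 x : (0 <= S2 x)%E.
  by apply: nneseries_ge0 => k _ _; rewrite lee_fin mulr_ge0// indicE.
have oS1 := lsc_open_series c0' openV.
have oS2 := lsc_open_series b0 oW.
have oS : forall a : R, open [set x | (a%:E < S1 x + S2 x)%E] by exact: lsc_add.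
have S0 x : (0 <= S1 x + S2 x)%E by exact: adde_ge0.
exists (fun x => G0 x + (S1 x + S2 x))%E; split.
- by move=> x; apply: le_trans (fG0 x) _; rewrite leeDl.
- exact: lsc_add.
- rewrite ge0_integralD//; try exact: lsc_borel_measurable.
  rewrite ge0_integralD//; try exact: lsc_borel_measurable.
  have -> : (e%:E = (e / 3)%:E + ((e / 3)%:E + (e / 3)%:E))%E.
    by rewrite -!EFinD; congr EFin; field.
  rewrite [leRHS]addeA; apply: leeD => //.
  rewrite /S1 /S2 !integral_open_series//.
  apply: leeD; apply: le_trans (epsilon_trick0 xpredT (ltW e30)).
    apply: lee_nneseries => k _; first by rewrite mule_ge0// lee_fin.
    rewrite vE -EFinM lee_fin -/(q k) /c mulrAC ler_pdivrMr ?ltr_wpDr//.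
    by rewrite ler_wpM2l ?(ltW (q0 k))// lerDr.
  apply: lee_nneseries => k _; first by rewrite mule_ge0// lee_fin.
  apply: (@le_trans _ _ ((b k)%:E * (q k / (1 + b k))%:E)%E).
    by rewrite lee_wpmul2l ?lee_fin//; case: (DW k).
  rewrite -EFinM lee_fin -/(q k) mulrA ler_pdivrMr ?ltr_wpDr// mulrC.
  by rewrite ler_wpM2l ?(ltW (q0 k))// lerDr.
- move=> k; exists (c k) => // x Vx.
  apply: le_trans (_ : S1 x <= _)%E; first exact: series_term.
  apply: (@le_trans _ _ (S1 x + S2 x)%E); first by rewrite leeDl.
  by rewrite leeDr.
- move=> k; exists (D k) => x Vx.
  have [_ _ /(_ x Vx)[Wx|]] := DW k; last by right.
  left; apply: (@le_trans _ _ (S2 x)); first exact: series_term.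
  apply: (@le_trans _ _ (S1 x + S2 x)%E); first by rewrite leeDr.
  by rewrite leeDr.
Qed.

End lsc_weights.

(** * Asymptotic Lipschitz constants *)

Section lipschitz_calculus.
Context {R : realType} {X : pmetricType R}.
Implicit Types (f g v w h k chi om : X -> R) (x y z : X).
Local Notation LL := real_locally_lipschitz.

Lemma lipschitz_locally f (L : R) :
  (forall y z, `|f y - f z| <= L * mdist y z) -> LL f.
Proof. by move=> h x; exists 1 => //; exists L. Qed.

Lemma asymptotic_lip_locally_lipschitz v h : asymptotic_lip_le v h -> LL v.
Proof.
move=> vh x; have [r r0 hr] := vh x 1 ltr01.
by exists r => //; exists (h x + 1).
Qed.

Lemma continuous_mdist f x (e : R) : continuous f -> 0 < e ->
  exists2 r : R, 0 < r & forall y, mdist x y < r -> `|f x - f y| < e.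
Proof.
move=> cf e0; have /cvgrPdist_lt/(_ e e0) := cf x.
by move/nbhs_mdist.
Qed.

Lemma locally_lipschitzD f g : LL f -> LL g -> LL (fun x => f x + g x).
Proof.
move=> lf lg x; have [r r0 [L hL]] := lf x; have [s s0 [M hM]] := lg x.
exists (Num.min r s); first by rewrite lt_min r0.
exists (L + M) => y z; rewrite !lt_min => /andP[yr ys] /andP[zr zs].
have := hL y z yr zr; have := hM y z ys zs.
have := ler_normD (f y - f z) (g y - g z).
by rewrite (_ : f y - f z + (g y - g z) = f y + g y - (f z + g z)); [nra|ring].
Qed.

Lemma locally_lipschitz_norm f : LL f -> LL (fun x => `|f x|).
Proof.
move=> lf x; have [r r0 [L hL]] := lf x.
exists r => //; exists L => y z yr zr.
exact: le_trans (ler_dist_dist _ _) (hL y z yr zr).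
Qed.

Lemma locally_lipschitzM f g : LL f -> LL g -> LL (fun x => f x * g x).
Proof.
move=> lf lg x; have [r r0 [L hL]] := lf x; have [s s0 [M hM]] := lg x.
have [rf rf0 hf] := continuous_mdist x (locally_lipschitz_continuous lf) ltr01.
have [rg rg0 hg] := continuous_mdist x (locally_lipschitz_continuous lg) ltr01.
exists (Num.min (Num.min r s) (Num.min rf rg)); first by rewrite !lt_min r0 s0 rf0.
exists ((`|f x| + 1) * `|M| + (`|g x| + 1) * `|L|) => y z; rewrite !lt_min.
move=> /andP[/andP[yr ys] /andP[yf yg]] /andP[/andP[zr zs] /andP[zf zg]].
rewrite (_ : f y * g y - f z * g z = f y * (g y - g z) + g z * (f y - f z)); last by ring.
apply: le_trans (ler_normD _ _) _; rewrite !normrM mulrDl; apply: lerD.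
  rewrite -mulrA; apply: ler_pM => //.
    by have := hf y yf; have := ler_distD (f x) 0 (f y); rewrite !sub0r !normrN; lra.
  apply: le_trans (hM y z ys zs) _; rewrite ler_wpM2r ?mdist_ge0//; exact: ler_norm.
rewrite -mulrA; apply: ler_pM => //.
  by have := hg z zg; have := ler_distD (g x) 0 (g z); rewrite !sub0r !normrN; lra.
apply: le_trans (hL y z yr zr) _; rewrite ler_wpM2r ?mdist_ge0//; exact: ler_norm.
Qed.

Lemma locally_lipschitz_cst (a : R) : LL (fun _ : X => a).
Proof. by apply: (@lipschitz_locally _ 0) => y z; rewrite subrr normr0 mul0r. Qed.

Lemma locally_lipschitzB f g : LL f -> LL g -> LL (fun x => f x - g x).
Proof.
move=> lf lg.
have := locally_lipschitzD lf (locally_lipschitzM (locally_lipschitz_cst (-1)) lg).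
by congr LL; apply/funext => x; rewrite mulN1r.
Qed.

(** Leibniz rule: the increment of [chi] is multiplied by [v - w] only, so gluing is cheap where the
    two functions are close. *)
Lemma asymptotic_lip_interpolation chi om v w h k :
  (forall x, 0 <= chi x <= 1) -> asymptotic_lip_le chi om ->
  asymptotic_lip_le v h -> asymptotic_lip_le w k ->
  asymptotic_lip_le (fun x => chi x * v x + (1 - chi x) * w x)
    (fun x => chi x * h x + (1 - chi x) * k x + om x * `|v x - w x|).
Proof.
move=> chi01 chio vh wk x e e0.
(* The sum of the coefficients of the error [d] in the final estimate, where [d <= 1] bounds [d * d]
   by [d]. *)
pose B := `|h x| + `|k x| + `|om x| + `|v x - w x| + 2.
have B0 : 0 < B by rewrite ltr_wpDl// !addr_ge0.
pose d := Num.min 1 (e / B).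
have d0 : 0 < d by rewrite lt_min ltr01 divr_gt0.
have d1 : d <= 1 by rewrite ge_min lexx.
have dB : d * B <= e by rewrite -ler_pdivlMr// ge_min lexx orbT.
have cont f g : asymptotic_lip_le f g -> continuous f.
  by move=> /asymptotic_lip_locally_lipschitz /locally_lipschitz_continuous.
have cvw : continuous (fun x => v x - w x).
  by apply: locally_lipschitz_continuous; apply: locally_lipschitzB;
    apply: asymptotic_lip_locally_lipschitz; [exact: vh|exact: wk].
have [r1 r10 h1] := chio x d d0; have [r2 r20 h2] := vh x d d0.
have [r3 r30 h3] := wk x d d0.
have [r4 r40 h4] := continuous_mdist x (cont _ _ chio) d0.
have [r5 r50 h5] := continuous_mdist x cvw d0.
exists (Num.min (Num.min r1 r2) (Num.min r3 (Num.min r4 r5))).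
  by rewrite !lt_min r10 r20 r30 r40.
move=> y z; rewrite !lt_min.
move=> /andP[/andP[y1 y2] /and3P[y3 y4 y5]] /andP[/andP[z1 z2] /and3P[z3 z4 z5]].
have {}h1 := h1 y z y1 z1; have {}h2 := h2 y z y2 z2; have {}h3 := h3 y z y3 z3.
have {}h4 := h4 y y4; have {}h5 := h5 z z5.
have /andP[c0 c1] := chi01 y.
have D0 := mdist_ge0 y z.
rewrite (_ : _ - _ = chi y * (v y - v z) + (1 - chi y) * (w y - w z) +
  (chi y - chi z) * (v z - w z)); last by ring.
have nD : `|v z - w z| <= `|v x - w x| + d.
  by have := ler_distD (v x - w x) 0 (v z - w z); rewrite !sub0r !normrN; lra.
have p1 : `|chi y * (v y - v z)| <= chi y * ((h x + d) * mdist y z).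
  by rewrite normrM ger0_norm// ler_wpM2l.
have p2 : `|(1 - chi y) * (w y - w z)| <= (1 - chi y) * ((k x + d) * mdist y z).
  by rewrite normrM ger0_norm ?subr_ge0// ler_wpM2l// subr_ge0.
have p3 : `|(chi y - chi z) * (v z - w z)| <=
    ((om x + d) * mdist y z) * (`|v x - w x| + d).
  by rewrite normrM; apply: ler_pM.
apply: le_trans (ler_normD _ _) _; apply: le_trans (lerD (ler_normD _ _) (lexx _)) _.
apply: le_trans (lerD (lerD p1 p2) p3) _.
pose V := `|v x - w x|; rewrite -/V in nD p3 *.
suff : chi y * (h x + d) + (1 - chi y) * (k x + d) + (om x + d) * (V + d) <=
    chi x * h x + (1 - chi x) * k x + om x * V + e.
  move=> /(ler_wpM2r D0); apply: le_trans; rewrite le_eqVlt; apply/orP; left.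
  by apply/eqP; ring.
have V0 : 0 <= V by exact: normr_ge0.
have q1 : chi y * h x - chi x * h x <= d * `|h x|.
  rewrite -mulrBl; apply: le_trans (ler_norm _) _; rewrite normrM distrC.
  by rewrite ler_wpM2r// ltW.
have q2 : chi x * k x - chi y * k x <= d * `|k x|.
  rewrite -mulrBl; apply: le_trans (ler_norm _) _; rewrite normrM.
  by rewrite ler_wpM2r// ltW.
have q3 : om x * d <= d * `|om x|.
  by rewrite mulrC ler_wpM2l ?(ltW d0)// ler_norm.
have q4 : d * d <= d by rewrite ger_pMr.
by move: dB; rewrite /B -/V; lra.
Qed.

(** The glued function is only known to be at least [q] on [F]; this rescaling makes it equal to 1
    there. *)
Lemma asymptotic_lip_truncate v h (q : R) : 0 < q -> asymptotic_lip_le v h ->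
  asymptotic_lip_le (fun x => Num.min 1 (v x / q)) (fun x => h x / q).
Proof.
move=> q0 vh x e e0; have [r r0 hr] := vh x (e * q) (mulr_gt0 e0 q0).
exists r => // y z yr zr.
have trunc_lip (a b : R) : `|Num.min 1 a - Num.min 1 b| <= `|a - b|.
  by rewrite !ler_norml; case: (leP 1 a) => ?; case: (leP 1 b) => ?;
     have := ler_norm (a - b); have := ler_norm (b - a); rewrite distrC; lra.
apply: le_trans (trunc_lip _ _) _.
rewrite -mulrBl normrM (ger0_norm (_ : 0 <= q^-1)) ?invr_ge0 ?(ltW q0)//.
rewrite ler_pdivrMr//; apply: le_trans (hr y z yr zr) _.
by rewrite le_eqVlt; apply/orP; left; apply/eqP; field; rewrite gt_eqF.
Qed.

(** Points within [d / 2] of [x] are one chain step apart, so [chain_inf_lip] applies, and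
    continuity compares the weights with [phi x]. *)
Lemma asymptotic_lip_chain_inf (phi : X -> R) (L d : R) (E : set X) :
  (forall x, 0 <= phi x) -> (forall y z, `|phi y - phi z| <= L * mdist y z) ->
  0 < d -> asymptotic_lip_le (chain_inf phi E d) phi.
Proof.
move=> phi0 phiL d0 x e e0.
have cphi : continuous phi by exact/locally_lipschitz_continuous/lipschitz_locally.
have [r r0 hr] := continuous_mdist x cphi e0.
exists (Num.min r (d / 2)) => [|y z]; first by rewrite lt_min r0 divr_gt0.
rewrite !lt_min => /andP[yr yd] /andP[zr zd].
apply: le_trans (chain_inf_lip phi0 E _) _.
  by have := metric_triangle y x z; rewrite (metric_sym y x); lra.
rewrite ler_wpM2r ?mdist_ge0// ge_max.
by have := hr y yr; have := hr z zr; rewrite !ltr_norml; lra.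
Qed.

(* The smoothstep [3 t^2 - 2 t^3] is used for the cutoffs because its
   asymptotic Lipschitz constant 6 t (1 - t) vanishes continuously where the
   cutoff becomes constant. *)
Section smooth_cutoff.
Variables (rho : X -> R) (n : nat).
Hypothesis rho_lip : forall x y, `|rho x - rho y| <= mdist x y.
(** Affine in [rho], from 0 at [2 ^- n.+1] to 1 at [2 ^- n]. *)
Let t x : R := Num.max 0 (Num.min 1 (2 ^+ n.+1 * rho x - 1)).

Definition cutoff x : R := t x * t x * (3 - 2 * t x).
Definition cutoff_lip x : R := 2 ^+ n.+1 * (6 * (t x * (1 - t x))).

Let t01 x : 0 <= t x <= 1.
Proof. by rewrite le_max lexx ge_max ler01 ge_min lexx. Qed.

Let tL y z : `|t y - t z| <= 2 ^+ n.+1 * mdist y z.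
Proof.
apply: (@le_trans _ _ (2 ^+ n.+1 * `|rho y - rho z|)); last first.
  by rewrite ler_wpM2l// exprn_ge0.
rewrite -[X in X * _](ger0_norm (_ : 0 <= 2 ^+ n.+1)) ?exprn_ge0// -normrM mulrBr.
rewrite /t; set a := _ * rho y; set b := _ * rho z.
have /andP[] : - `|a - b| <= a - b <= `|a - b| by rewrite -ler_norml.
set N := `|a - b| => N1 N2; rewrite ler_norml.
case: (leP 1 (a - 1)) => ?; case: (leP 1 (b - 1)) => ?;
  rewrite ?(max_r (@ler01 R));
  try (case: (leP 0 (a - 1)) => ?); try (case: (leP 0 (b - 1)) => ?); lra.
Qed.

Let lt : LL t. Proof. exact: lipschitz_locally tL. Qed.

Lemma cutoff01 x : 0 <= cutoff x <= 1.
Proof.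
have /andP[t0 t1] := t01 x; rewrite /cutoff !mulr_ge0//=; last by lra.
have : 0 <= (1 - t x) * (1 - t x) * (1 + 2 * t x) by rewrite !mulr_ge0//; lra.
lra.
Qed.

Lemma cutoff_lip_ge0 x : 0 <= cutoff_lip x.
Proof.
have /andP[? ?] := t01 x.
by rewrite /cutoff_lip mulr_ge0 ?exprn_ge0// mulr_ge0// mulr_ge0// subr_ge0.
Qed.

Lemma cutoff_lip_le x : cutoff_lip x <= 2 ^+ n.+2.
Proof.
have /andP[? ?] := t01 x.
rewrite /cutoff_lip [leRHS]exprSr ler_wpM2l ?exprn_ge0//.
have := sqr_ge0 (2 * t x - 1); lra.
Qed.

Lemma locally_lipschitz_cutoff_lip : LL cutoff_lip.
Proof.
apply: locally_lipschitzM; first exact: locally_lipschitz_cst.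
apply: locally_lipschitzM; first exact: locally_lipschitz_cst.
apply: locally_lipschitzM => //; apply: locally_lipschitzB => //.
exact: locally_lipschitz_cst.
Qed.

Lemma cutoff_asymptotic_lip : asymptotic_lip_le cutoff cutoff_lip.
Proof.
move=> x e e0; pose K : R := 2 ^+ n.+1.
have K0 : 0 < K by rewrite exprn_gt0.
(* Replacing [a] and [b] by [c] in the difference quotient of the smoothstep costs at most
   [6 * d + 12 * d]; the remaining factor is the Lipschitz constant [K] of [t]. *)
have d0 : 0 < e / (18 * K) by rewrite divr_gt0// mulr_gt0.
have [r r0 hr] := continuous_mdist x (locally_lipschitz_continuous lt) d0.
exists r => // y z yr zr.
have := hr y yr; have := hr z zr; have := tL y z; rewrite -/K.
have /andP[a0 a1] := t01 y; have /andP[b0 b1] := t01 z; have /andP[c0 c1] := t01 x.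
rewrite /cutoff /cutoff_lip -/K.
move: (t y) (t z) (t x) a0 a1 b0 b1 c0 c1 => a b c a0 a1 b0 b1 c0 c1 hab.
set d := e / _ in d0 *; rewrite !ltr_norml => /andP[h1 h2] /andP[h3 h4].
have de : 18 * K * d = e by rewrite /d mulrC divfK// gt_eqF// mulr_gt0.
have -> : a * a * (3 - 2 * a) - b * b * (3 - 2 * b) =
  (3 * (a + b) - 2 * (a * a + a * b + b * b)) * (a - b) by ring.
rewrite normrM.
have Q : `|3 * (a + b) - 2 * (a * a + a * b + b * b)| <= 6 * (c * (1 - c)) + 18 * d.
  have aa : `|a * a - c * c| <= 2 * d by rewrite ler_norml; nra.
  have bb : `|b * b - c * c| <= 2 * d by rewrite ler_norml; nra.
  have ab : `|a * b - c * c| <= 2 * d by rewrite ler_norml; nra.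
  have cc : 0 <= c * (1 - c) by rewrite mulr_ge0// subr_ge0.
  move: aa bb ab; rewrite !ler_norml; lra.
apply: le_trans (ler_pM _ _ Q hab) _ => //.
rewrite le_eqVlt; apply/orP; left; apply/eqP; rewrite -de; ring.
Qed.

Lemma cutoff_eq1 x : 2 ^- n <= rho x -> cutoff x = 1 /\ cutoff_lip x = 0.
Proof.
move=> h; have h2 : 2 <= 2 ^+ n.+1 * rho x.
  rewrite exprS -mulrA ler_peMr//.
  by rewrite -(ler_pM2l (_ : 0 < 2 ^+ n)) ?exprn_gt0// mulfV ?expf_neq0// in h.
have t1 : t x = 1 by rewrite /t min_l ?max_r//; lra.
by rewrite /cutoff /cutoff_lip t1; split; ring.
Qed.

Lemma cutoff_eq0 x : rho x <= 2 ^- n.+1 -> cutoff x = 0 /\ cutoff_lip x = 0.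
Proof.
move=> h; have h2 : 2 ^+ n.+1 * rho x <= 1.
  by rewrite mulrC -ler_pdivlMr ?exprn_gt0// mul1r.
have t1 : t x = 0.
  by rewrite /t max_l// ge_min; apply/orP; right; lra.
by rewrite /cutoff /cutoff_lip t1; split; ring.
Qed.

End smooth_cutoff.

End lipschitz_calculus.

Lemma bounded_cvg_integral {d} {T : measurableType d} {R : realType}
    (mu : {measure set T -> \bar R}) (A : set T) (f_ : nat -> T -> R) (f : T -> R)
    (e : R) :
  measurable A -> (mu A < +oo)%E -> (forall n, measurable_fun setT (f_ n)) ->
  measurable_fun setT f -> (forall n x, 0 <= f_ n x <= 1) ->
  (forall x, f_ ^~ x @ \oo --> f x) -> 0 < e ->
  exists N, forall n, (N <= n)%N ->
    (\int[mu]_(x in A) `|f_ n x - f x|%:E <= e%:E)%E.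
Proof.
move=> mA fA mf_ mf f01 cvg e0.
have [|||||_ + _] := @dominated_convergence _ _ _ mu A mA (fun n => EFin \o f_ n)
    (EFin \o f) (cst 1%:E).
- by move=> n; apply/measurable_EFinP; exact: measurable_funS (mf_ n).
- by apply/measurable_EFinP; exact: measurable_funS mf.
- by apply: aeW => x _; apply: cvg_EFin; [exact: nearW | exact: cvg].
- apply/integrableP; split; first exact: measurable_cst.
  by rewrite /= normr1 integral_cst// mul1e.
- apply: aeW => x n _; rewrite /= lee_fin ger0_norm; by have /andP[] := f01 n x.
move=> cv; have /cv[N _ hN] : nbhs (0%E : \bar R) [set y | (y < e%:E)%E].
  by apply: open_nbhs_nbhs; split; [exact: open_ereal_lt_ereal | rewrite /= lte_fin].
exists N => n Nn; have /= := hN n Nn => /ltW; apply: le_trans.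
by rewrite le_eqVlt; apply/orP; left; apply/eqP; apply: eq_integral => x _.
Qed.

Section path_integral_monotone.
Context {R : realType} {X : pmetricType R}.
Variable gamma : R -> X.
Hypothesis rect : rectifiable gamma.

Lemma measurable_constant_speed (f : X -> \bar R) :
  measurable_fun [set: borel X] (f : borel X -> \bar R) ->
  measurable_fun (`[0, 1] : set R) (f \o constant_speed gamma).
Proof.
move=> mf; apply: (@measurable_comp _ _ _ _ (borel X) _ [set: borel X]) => //.
apply: (@measurability _ _ _ (borel X) _ _ (@open X)) => // _ [ O oO <-].
have := constant_speed_continuous rect.
move=> /continuousP/(_ O oO) /open_subspaceP[W oW WO].
by rewrite setIC -WO; apply: measurableI => //; exact: open_measurable.
Qed.

Lemma le_path_integral (f g : X -> \bar R) :
  measurable_fun [set: borel X] (f : borel X -> \bar R) ->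
  measurable_fun [set: borel X] (g : borel X -> \bar R) ->
  (forall x, (0 <= f x)%E) -> (forall x, (f x <= g x)%E) ->
  (path_integral f gamma <= path_integral g gamma)%E.
Proof.
move=> mf mg f0 fg; rewrite /path_integral curve_length_length//.
rewrite lee_wpmul2l ?lee_fin ?rectifiable_length_ge0//.
by apply: ge0_le_integral => //; exact: measurable_constant_speed.
Qed.

End path_integral_monotone.

(** * Approximation and gluing *)

Section approximation.
Context {R : realType} {X : pmetricType R}.
Variable mu : {measure set (borel X) -> \bar R}.
Variable rho : X -> R.
Hypothesis rho_gt0 : forall x, 0 < rho x.
Hypothesis rho_lip : forall x y, `|rho x - rho y| <= mdist x y.
Hypothesis rho_complete : forall a : R, 0 < a -> complete_set [set x | a <= rho x].

Local Notation C k := [set x | 2 ^- k <= rho x].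

Hypothesis finC : forall k : nat, (mu (C k) < +oo)%E.
Variables (E F : set X) (D0 : R).
Hypotheses (closedE : closed E) (closedF : closed F).
Hypothesis D0_gt0 : 0 < D0.
Hypothesis EF : forall x y, E x -> F y -> D0 <= mdist x y.
Variable g : X -> \bar R.
Hypothesis g_ge0 : forall x, (0 <= g x)%E.
Hypothesis g_lsc : forall a : R, open [set x | (a%:E < g x)%E].
Hypothesis g_pos : forall k : nat, exists2 c : R, 0 < c &
  forall x, 2 ^- k < rho x -> (c%:E <= g x)%E.
Hypothesis g_cover : forall k : nat, exists D : seq X, forall x, 2 ^- k < rho x ->
  ((k.+1%:R)%:E <= g x)%E \/ exists2 z, z \in D & mdist z x <= k.+1%:R^-1.
Hypothesis g_adm : forall gamma, rectifiable gamma -> E (gamma 0) -> F (gamma 1) ->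
  (1 <= path_integral g gamma)%E.

Let pow_gt0 k : 0 < 2 ^- k :> R. Proof. by rewrite invr_gt0 exprn_gt0. Qed.

Let pow_anti i k : (i <= k)%N -> 2 ^- k <= 2 ^- i :> R.
Proof. by move=> ik; rewrite lef_pV2 ?posrE ?exprn_gt0// ler_eXn2l// ltr1n. Qed.

Let pow_lt i k : (i < k)%N -> 2 ^- k < 2 ^- i :> R.
Proof. by move=> ik; rewrite ltf_pV2 ?posrE ?exprn_gt0// ltr_eXn2l// ltr1n. Qed.

Let pow_half k : 2 ^- k = 2 ^- k.+1 + 2 ^- k.+1 :> R.
Proof. by rewrite exprS invfM -mulrDl (_ : 2^-1 + 2^-1 = 1) ?mul1r//; field. Qed.

Let rho_continuous : continuous rho.
Proof.
apply: locally_lipschitz_continuous; apply: (@lipschitz_locally _ _ _ 1) => y z.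
by rewrite mul1r.
Qed.

Lemma gauge_level_exists x : exists k : nat, 2 ^- k <= rho x.
Proof.
exists (Num.truncn (rho x)^-1).+1; rewrite invf_ple ?posrE ?exprn_gt0//.
apply: le_trans (ltW (truncnS_gt _)) _.
by rewrite -natrX ler_nat; exact/ltnW/ltn_expl.
Qed.

Lemma measurable_gauge_level k : measurable (C k : set (borel X)).
Proof.
apply: closed_borel; rewrite (_ : [set x | _] = rho @^-1` [set y | 2 ^- k <= y])//.
by apply: closed_comp => //.
Qed.

Definition confined j x : \bar R := if 2 ^- j <= rho x then g x else +oo%E.

Lemma confined_ge j x : (g x <= confined j x)%E.
Proof. by rewrite /confined; case: ifP => // _; rewrite leey. Qed.

Lemma confined_ge0 j x : (0 <= confined j x)%E.
Proof. exact: le_trans (g_ge0 x) (confined_ge j x). Qed.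

Lemma confined_anti i j x : (i <= j)%N -> (confined j x <= confined i x)%E.
Proof.
move=> ij; rewrite /confined; case: (leP (2 ^- i) (rho x)) => h.
  by rewrite (le_trans (pow_anti ij) h).
by rewrite leey.
Qed.

(** The set where the weight is raised to [+oo] is open, which preserves lower semicontinuity. *)
Lemma confined_lsc j (a : R) : open [set x | (a%:E < confined j x)%E].
Proof.
rewrite (_ : [set x | _] = [set x | (a%:E < g x)%E] `|` (rho @^-1` [set y | y < 2 ^- j])).
  apply: openU => //; apply: open_comp; last exact: open_lt.
  by move=> x _; exact: rho_continuous.
apply/seteqP; split=> x /=; rewrite /confined; have [h|h] := leP (2 ^- j) (rho x).
- by move=> ag; left.
- by move=> _; right.
- by case=> //; rewrite ltNge h.
- by rewrite ltry.
Qed.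

Let phi j n := iconv (confined j) n.
Let u j n := chain_inf (phi j n) E n.+1%:R^-1.

Let phi0 j n x : 0 <= phi j n x.
Proof. exact: iconv_ge0 (confined_ge0 j) _ _. Qed.

(** The weight is infinite outside [C j], and since [rho] is 1-Lipschitz the neighbourhood of radius
    [2 ^- j.+1] of [C j] lies in the complete set [C j.+1]. *)
Lemma confined_near_one j (c : R) : c < 1 -> exists n, forall x, F x -> c <= u j n x.
Proof.
move=> c1; have [c0 c00 hc0] := g_pos j.+1.
apply: (@chain_inf_ge_near _ _ (confined j) E F (C j.+1) c c0 (2 ^- j.+1) D0) => //.
- exact: confined_lsc.
- move=> x; rewrite /confined; case: ifPn => h; last exact: leey.
  by apply: hc0; exact: lt_le_trans (pow_lt (ltnSn j)) h.
- move=> r M r0.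
  (* Large enough for the level [M], for the radius [r], and for [C j] to lie where [g_cover k]
     applies. *)
  pose k := maxn j.+1 (maxn (Num.truncn M) (Num.truncn r^-1)).
  have [D hD] := g_cover k; exists D => x.
  rewrite /confined; case: ifPn => // h gM.
  have jk : (j < k)%N by exact: leq_maxl.
  have [kg|[z zD zx]] := hD x (lt_le_trans (pow_lt jk) h).
    have := le_trans kg gM; rewrite lee_fin leNgt => /negP; case.
    apply: lt_le_trans (truncnS_gt _) _; rewrite ler_nat ltnS.
    by rewrite /k !leq_max leqnn orbT.
  exists z => //; apply: le_lt_trans zx _; rewrite invf_plt ?posrE//.
  apply: lt_le_trans (truncnS_gt _) _; rewrite ler_nat ltnS.
  by rewrite /k !leq_max leqnn !orbT.
- exact: rho_complete.
- move=> x y; rewrite /confined; case: ifPn; last by rewrite ltxx.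
  move=> hy _ xy; have := rho_lip x y; rewrite ler_norml /= => /andP[h1 h2].
  by have := pow_half j; lra.
- move=> gamma rect g0 g1; apply: le_trans (g_adm rect g0 g1) _.
  apply: le_path_integral => //; last exact: confined_ge.
  + exact: lsc_borel_measurable.
  + by apply: lsc_borel_measurable; exact: confined_lsc.
Qed.

Let u01 j n x : 0 <= u j n x <= 1.
Proof. by rewrite chain_inf_ge0//= chain_inf_le1. Qed.

Let u_mono j m n x : (m <= n)%N -> u j m x <= u j n x.
Proof.
move=> mn; apply: chain_inf_mono => //.
  by move=> y; exact: iconv_mono (confined_ge0 j) _ _ _ mn.
by rewrite lef_pV2 ?posrE// ler_nat.
Qed.

Let phi_anti i j n x : (i <= j)%N -> phi j n x <= phi i n x.
Proof.
move=> ij; apply: le_iconv => y; [exact: confined_ge0|exact: confined_anti].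
Qed.

Let u_anti i j n x : (i <= j)%N -> u j n x <= u i n x.
Proof. by move=> ij; apply: chain_inf_mono => // y; exact: phi_anti. Qed.

Let u_lip j n : asymptotic_lip_le (u j n) (phi j n).
Proof.
apply: (@asymptotic_lip_chain_inf _ _ _ n%:R) => // y z.
exact: iconv_lip (confined_ge0 j) _ _ _.
Qed.

Let u_meas j n : measurable_fun [set: borel X] (u j n : borel X -> R).
Proof.
apply: continuous_borel_measurable; apply: locally_lipschitz_continuous.
exact: asymptotic_lip_locally_lipschitz (u_lip j n).
Qed.

(** [u j n] increases with [n] and decreases with [j]; dominated convergence makes both limits hold
    in L^1 on [C k]. The threshold on [n] for the bound on [F] depends on [j], so [j] is chosen
    first. The limit [U] is the same for all [k], which makes different layers comparable. *)
Lemma confined_limit : exists U : X -> R,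
  measurable_fun [set: borel X] (U : borel X -> R) /\
  forall k m (c e : R), c < 1 -> 0 < e -> exists j n, [/\ (m <= j)%N,
    forall x, F x -> c <= u j n x &
    (\int[mu]_(x in C k) `|u j n x - U x|%:E <= e%:E)%E].
Proof.
pose Uj j x := sup (range (fun n => u j n x)).
have ubu j x : ubound (range (fun n => u j n x)) 1.
  by move=> _ [n _ <-]; case/andP: (u01 j n x).
have cvU j x : (fun n => u j n x) @ \oo --> Uj j x.
  apply: nondecreasing_cvgn; last by exists 1; exact: ubu.
  by move=> m n; exact: u_mono.
have Uj01 j x : 0 <= Uj j x <= 1.
  apply/andP; split.
    apply: (le_trans (y := u j 0%N x)); first by case/andP: (u01 j 0%N x).
    by apply: ub_le_sup; [exists 1; exact: ubu | exists 0%N].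
  by apply: ge_sup; [exists (u j 0%N x), 0%N | exact: ubu].
have Uj_anti x : nonincreasing_seq (fun j => Uj j x).
  move=> i j ij; apply: (ler_cvg_to (cvU j x) (cvU i x)).
  by apply: nearW => n; exact: u_anti.
pose U x := inf (range (fun j => Uj j x)).
have cvUj x : (fun j => Uj j x) @ \oo --> U x.
  apply: nonincreasing_cvgn; first exact: Uj_anti.
  by exists 0 => _ [j _ <-]; case/andP: (Uj01 j x).
have mUj j : measurable_fun [set: borel X] (Uj j : borel X -> R).
  by apply: (measurable_fun_cvg (h := fun n => (u j n : borel X -> R))).
have mU : measurable_fun [set: borel X] (U : borel X -> R).
  by apply: (measurable_fun_cvg (h := fun j => (Uj j : borel X -> R))).
exists U; split=> // k m c e c1 e0.
have e20 : 0 < e / 2 by exact: divr_gt0.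
have mC := measurable_gauge_level k.
have [j0 hj0] := @bounded_cvg_integral _ (borel X) R mu (C k) Uj U (e / 2)
  mC (finC k) mUj mU Uj01 cvUj e20.
pose j := maxn m j0.
have [n0 hn0] := @bounded_cvg_integral _ (borel X) R mu (C k) (u j) (Uj j) (e / 2)
  mC (finC k) (u_meas j) (mUj j) (u01 j) (cvU j) e20.
have [n1 hn1] := confined_near_one j c1.
exists j, (maxn n0 n1); split; first exact: leq_maxl.
  by move=> x Fx; apply: le_trans (hn1 x Fx) _; apply: u_mono; exact: leq_maxr.
set n := maxn n0 n1.
have m1 (f h : borel X -> R) : measurable_fun [set: borel X] f ->
    measurable_fun [set: borel X] h ->
    measurable_fun (C k : set (borel X)) (fun x => `|f x - h x|%:E).
  move=> mf mh; apply/measurable_EFinP.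
  apply: (@measurable_funS _ _ _ _ [set: borel X]) => //.
  by apply: measurableT_comp => //; exact: measurable_funB.
apply: (@le_trans _ _ (\int[mu]_(x in C k)
    (`|u j n x - Uj j x|%:E + `|Uj j x - U x|%:E))%E).
  apply: ge0_le_integral => //; first exact: m1.
    by apply: emeasurable_funD; exact: m1.
  by move=> x _; rewrite -EFinD lee_fin ler_distD.
rewrite ge0_integralD//; try exact: m1.
rewrite [e]splitr EFinD; apply: leeD.
  by apply: hn0; exact: leq_maxl.
by apply: hj0; exact: leq_maxr.
Qed.

(** Layer [k] uses an index [j] that is at least [k.+1], so that its weight is below [g] on
    [C k.+1]. Consecutive layers are close because both are close to [U]. *)
Lemma lipschitz_layers (K : nat -> R) (q e : R) :
  (forall k, 0 < K k) -> (forall k, K k <= K k.+1) -> q < 1 -> 0 < e ->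
  exists a psi : nat -> X -> R, [/\
    forall k, asymptotic_lip_le (a k) (psi k) /\ real_locally_lipschitz (psi k),
    forall k x, 0 <= psi k x /\ (C k.+1 x -> ((psi k x)%:E <= g x)%E),
    forall k x, 0 <= a k x <= 1,
    forall k x, (E x -> a k x = 0) /\ (F x -> q <= a k x) &
    forall k, ((K k)%:E * \int[mu]_(x in C k.+1) `|a k x - a k.+1 x|%:E <=
      (e / (2 ^ k.+1)%:R)%:E)%E].
Proof.
move=> K0 KS q1 e0; have [U [mU hU]] := confined_limit.
(* As [K] is nondecreasing, [K k * (eta k + eta k.+1)] is at most 1/2 + 1/4 of the allowed error. *)
pose eta k := e / (2 ^ k.+1)%:R / (2 * K k).
have eta0 k : 0 < eta k.
  by rewrite divr_gt0// ?mulr_gt0// divr_gt0// ltr0n expn_gt0.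
have /choice[j /choice[n jn]] k : exists j n, [/\ (k.+1 <= j)%N,
    forall x, F x -> q <= u j n x &
    (\int[mu]_(x in C k.+1) `|u j n x - U x|%:E <= (eta k)%:E)%E].
  by have [j [n h]] := hU k.+1 k.+1 q (eta k) q1 (eta0 k); exists j, n.
exists (fun k => u (j k) (n k)), (fun k => phi (j k) (n k)); split.
- move=> k; split; first exact: u_lip.
  apply: (@lipschitz_locally _ _ _ (n k)%:R) => y z.
  exact: iconv_lip (confined_ge0 _) _ _ _.
- move=> k x; split=> // Cx; apply: le_trans (iconv_le (confined_ge0 _) _ _) _.
  rewrite /confined ifT//; apply: le_trans Cx; apply: pow_anti.
  by case: (jn k).
- by move=> k x; exact: u01.
- move=> k x; split; first exact: chain_inf_eq0.
  by case: (jn k) => _ h _; exact: h.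
move=> k; set a := u (j k) (n k); set b := u (j k.+1) (n k.+1).
have [_ _ ha] := jn k; have [_ _ hb] := jn k.+1.
have mC := measurable_gauge_level k.+1.
have m1 (D : set (borel X)) (f h : borel X -> R) : measurable_fun [set: borel X] f ->
    measurable_fun [set: borel X] h ->
    measurable_fun D (fun x => `|f x - h x|%:E).
  move=> mf mh; apply/measurable_EFinP.
  apply: (@measurable_funS _ _ _ _ [set: borel X]) => //.
  by apply: measurableT_comp => //; exact: measurable_funB.
have ma : measurable_fun [set: borel X] (a : borel X -> R) by exact: u_meas.
have mb : measurable_fun [set: borel X] (b : borel X -> R) by exact: u_meas.
have {}hb : (\int[mu]_(x in C k.+1) `|b x - U x|%:E <= (eta k.+1)%:E)%E.
  apply: le_trans hb; apply: ge0_subset_integral => //.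
  - exact: measurable_gauge_level.
  - exact: m1.
  - by move=> x /=; apply: le_trans; exact: pow_anti.
have hab : (\int[mu]_(x in C k.+1) `|a x - b x|%:E <= (eta k)%:E + (eta k.+1)%:E)%E.
  apply: le_trans (leeD ha hb); rewrite -ge0_integralD//; try exact: m1.
  apply: ge0_le_integral => //; first exact: m1.
    by apply: emeasurable_funD; exact: m1.
  by move=> x _; rewrite -EFinD lee_fin (distrC (b x)) ler_distD.
apply: (@le_trans _ _ ((K k)%:E * ((eta k)%:E + (eta k.+1)%:E))%E).
  by rewrite lee_wpmul2l// lee_fin ltW.
rewrite -EFinD -EFinM lee_fin mulrDr.
have e1 : K k * eta k = e / (2 ^ k.+1)%:R / 2.
  by rewrite /eta; field; rewrite !natrX ?expf_neq0 ?gt_eqF.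
have e2 : K k.+1 * eta k.+1 = e / (2 ^ k.+1)%:R / 4.
  by rewrite /eta (expnS 2 k.+1) natrM; field; rewrite ?natrX ?expf_neq0 ?gt_eqF.
have : K k * eta k.+1 <= K k.+1 * eta k.+1 by rewrite ler_wpM2r// ltW.
have : 0 <= e / (2 ^ k.+1)%:R by rewrite divr_ge0// ltW.
by rewrite e1 e2; set z := _ / _%:R; lra.
Qed.

End approximation.

Section gluing.
Context {R : realType} {X : pmetricType R}.
Variable rho : X -> R.
Hypothesis rho_gt0 : forall x, 0 < rho x.
Hypothesis rho_lip : forall x y, `|rho x - rho y| <= mdist x y.
Variables (a psi : nat -> X -> R).
Hypothesis a_lip : forall k, asymptotic_lip_le (a k) (psi k).
Hypothesis psi_lip : forall k, real_locally_lipschitz (psi k).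

Local Notation chi := (cutoff rho).
Local Notation om := (cutoff_lip rho).

(** Built from the inside: step [i.+1] changes [glue i] only where [rho < 2 ^- i], and keeps nothing
    of it where [rho <= 2 ^- i.+1]. *)
Fixpoint glue k : X -> R := if k is i.+1 then
  fun x => chi i x * glue i x + (1 - chi i x) * a i.+1 x else a 0%N.

Fixpoint glue_lip k : X -> R := if k is i.+1 then
  fun x => chi i x * glue_lip i x + (1 - chi i x) * psi i.+1 x +
    om i x * `|glue i x - a i.+1 x| else psi 0%N.

Lemma glue_asymptotic_lip k : asymptotic_lip_le (glue k) (glue_lip k).
Proof.
elim: k => [|k IH]; first exact: a_lip.
apply: asymptotic_lip_interpolation => //.
- by move=> x; exact: cutoff01.
- exact: cutoff_asymptotic_lip.
Qed.

Lemma locally_lipschitz_glue_lip k : real_locally_lipschitz (glue_lip k).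
Proof.
elim: k => [|k IH]; first exact: psi_lip.
have lchi : real_locally_lipschitz (chi k).
  by apply: asymptotic_lip_locally_lipschitz; exact: cutoff_asymptotic_lip.
apply: locally_lipschitzD; first apply: locally_lipschitzD.
- exact: locally_lipschitzM.
- apply: locally_lipschitzM => //; apply: locally_lipschitzB => //.
  exact: locally_lipschitz_cst.
- apply: locally_lipschitzM; first exact: locally_lipschitz_cutoff_lip.
  apply: locally_lipschitz_norm; apply: locally_lipschitzB.
    exact: asymptotic_lip_locally_lipschitz (glue_asymptotic_lip k).
  exact: asymptotic_lip_locally_lipschitz (a_lip k.+1).
Qed.

Lemma glue_stable i k x : 2 ^- i <= rho x -> (i <= k)%N ->
  glue k x = glue i x /\ glue_lip k x = glue_lip i x.
Proof.
move=> h /subnKC <-; elim: (k - i)%N => [|l [IH1 IH2]]; first by rewrite addn0.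
have hl : 2 ^- (i + l) <= rho x.
  apply: le_trans h; rewrite lef_pV2 ?posrE ?exprn_gt0// ler_eXn2l ?ltr1n//.
  exact: leq_addr.
have [c1 c0] := cutoff_eq1 hl.
by rewrite addnS /= c1 c0 IH1 IH2 subrr !mul0r !mul1r !addr0.
Qed.

Lemma glue_outside k x : rho x <= 2 ^- k ->
  glue k x = a k x /\ glue_lip k x = psi k x.
Proof.
case: k => [//|k] h; have [c1 c0] := cutoff_eq0 h.
by rewrite /= c1 c0 subr0 !mul0r !mul1r !add0r addr0.
Qed.

Variable g : X -> \bar R.
Hypothesis psi_le : forall k x, 0 <= psi k x /\
  (2 ^- k.+1 <= rho x -> ((psi k x)%:E <= g x)%E).

Lemma glue_lip_ge0 k x : 0 <= glue_lip k x.
Proof.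
elim: k => [|k IH]; first by case: (psi_le 0 x).
have /andP[c0 c1] := cutoff01 rho k x.
have [p0 _] := psi_le k.+1 x.
rewrite /=; apply: addr_ge0; last by rewrite mulr_ge0// cutoff_lip_ge0.
by apply: addr_ge0; rewrite mulr_ge0// subr_ge0.
Qed.

(** In the layer where [rho] is between [2 ^- k.+1] and [2 ^- k], the function [glue k] is just
    [a k], so only [a k] and [a k.+1] meet there, and both of their bounds are below [g]. *)
Lemma glue_lip_le k x : 2 ^- k <= rho x -> ((glue_lip k x)%:E <= g x)%E \/
  exists2 i, 2 ^- i.+1 <= rho x &
    ((glue_lip k x)%:E <= g x + (2 ^+ i.+2 * `|a i x - a i.+1 x|)%:E)%E.
Proof.
elim: k => [|k IH] h.
  left; apply: (psi_le 0 x).2; apply: le_trans h.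
  by rewrite lef_pV2 ?posrE ?exprn_gt0// ler_eXn2l ?ltr1n.
have [hk|/ltW hk] := leP (2 ^- k) (rho x).
  by have [_ ->] := glue_stable hk (leqnSn k); exact: IH.
right; exists k => //.
have [e1 e2] := glue_outside hk.
rewrite /= e1 e2.
have [p0 pg] := psi_le k x; have [p0' pg'] := psi_le k.+1 x.
have /pg {}pg := h.
have {}pg' : ((psi k.+1 x)%:E <= g x)%E.
  apply: pg'; apply: le_trans h.
  by rewrite lef_pV2 ?posrE ?exprn_gt0// ler_eXn2l ?ltr1n.
have /andP[c0 c1] := cutoff01 rho k x.
rewrite EFinD; apply: leeD; last first.
  by rewrite lee_fin ler_wpM2r// cutoff_lip_le.
case: (g x) pg pg' => [r| |]//; last by move=> _ _; rewrite leey.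
rewrite !lee_fin => h1 h2.
have := ler_wpM2l c0 h1.
have : (1 - chi k x) * psi k.+1 x <= (1 - chi k x) * r.
  by rewrite ler_wpM2l// subr_ge0.
lra.
Qed.

(** [N x] is not locally constant, but near [x] everything agrees with level [(N x).+1], from which
    the local bounds are inherited. The clause on convex predicates [P] serves for [v = 0] on [E]
    and [q <= v] on [F]. *)
Lemma glued_function : exists v h : X -> R, [/\
  asymptotic_lip_le v h, real_locally_lipschitz h, forall x, 0 <= h x,
  forall (P : R -> Prop) x, (forall s t c : R, P s -> P t -> 0 <= c <= 1 ->
    P (c * s + (1 - c) * t)) -> (forall k, P (a k x)) -> P (v x) &
  forall x, ((h x)%:E <= g x)%E \/ exists2 i, 2 ^- i.+1 <= rho x &
    ((h x)%:E <= g x + (2 ^+ i.+2 * `|a i x - a i.+1 x|)%:E)%E].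
Proof.
have [N hN] := choice (gauge_level_exists rho_gt0).
pose v x := glue (N x) x; pose h x := glue_lip (N x) x.
have loc x : exists k, exists2 e : R, 0 < e &
    forall y, mdist x y < e -> v y = glue k y /\ h y = glue_lip k y.
  have lt_ : 2 ^- (N x).+1 < rho x.
    apply: lt_le_trans (hN x).
    by rewrite ltf_pV2 ?posrE ?exprn_gt0// ltr_eXn2l ?ltr1n.
  exists (N x).+1, (rho x - 2 ^- (N x).+1); first by rewrite subr_gt0.
  move=> y xy; have hy : 2 ^- (N x).+1 <= rho y.
    by have := rho_lip x y; rewrite ler_norml => /andP[_]; lra.
  rewrite /v /h; have [Nle|/ltnW Nge] := leqP (N y) (N x).+1.
    by have [-> ->] := glue_stable (hN y) Nle.
  by have [-> ->] := glue_stable hy Nge.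
exists v, h; split.
- move=> x e e0; have [k [r r0 hr]] := loc x.
  have [s s0 hs] := glue_asymptotic_lip k x e0.
  exists (Num.min r s) => [|y z]; first by rewrite lt_min r0.
  rewrite !lt_min => /andP[yr ys] /andP[zr zs].
  have [-> _] := hr y yr; have [-> _] := hr z zr.
  by have [_ ->] := hr x ltac:(by rewrite mdistxx); exact: hs.
- move=> x; have [k [r r0 hr]] := loc x.
  have [s s0 [L hL]] := locally_lipschitz_glue_lip k x.
  exists (Num.min r s); first by rewrite lt_min r0.
  exists L => y z; rewrite !lt_min => /andP[yr ys] /andP[zr zs].
  have [_ ->] := hr y yr; have [_ ->] := hr z zr; exact: hL.
- by move=> x; exact: glue_lip_ge0.
- move=> P x Pconv Pa; rewrite /v; elim: (N x) => [|k IH]; first exact: Pa.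
  by apply: Pconv => //; exact: cutoff01.
- by move=> x; exact: glue_lip_le (hN x).
Qed.

End gluing.

(** * Powers of weights, and capacities *)

Section power_of_lsc.
Context {R : realType} {X : pmetricType R}.
Variables (G : X -> \bar R) (p : R).
Hypotheses (p0 : 0 < p) (G0 : forall x, (0 <= G x)%E).

Lemma le_poweR (r : R) (s t : \bar R) : 0 <= r -> (0 <= s)%E -> (s <= t)%E ->
  (s `^ r <= t `^ r)%E.
Proof.
move=> r0 s0 st; apply: gt0_ler_poweR => //; rewrite in_itv /= leey andbT//.
exact: le_trans s0 st.
Qed.

Lemma poweRKV (s : \bar R) : (0 <= s)%E -> ((s `^ p) `^ p^-1)%E = s.
Proof. by move=> s0; rewrite -poweRrM mulfV ?gt_eqF// poweRe1. Qed.

Lemma poweRVK (s : \bar R) : (0 <= s)%E -> ((s `^ p^-1) `^ p)%E = s.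
Proof. by move=> s0; rewrite -poweRrM mulVf ?gt_eqF// poweRe1. Qed.

Lemma lsc_root : (forall a : R, open [set x | (a%:E < G x)%E]) ->
  forall a : R, open [set x | (a%:E < G x `^ p^-1)%E].
Proof.
move=> oG a; have [a0|a0] := ltP a 0.
  rewrite (_ : [set x | _] = setT); first exact: openT.
  apply/seteqP; split=> // x _ /=; apply: (@lt_le_trans _ _ 0%E) => //.
  exact: poweR_ge0.
rewrite (_ : [set x | _] = [set x | ((a `^ p)%:E < G x)%E]); first exact: oG.
have a0' : (0 <= a%:E)%E by rewrite lee_fin.
apply/seteqP; split=> x /=; rewrite -poweR_EFin => h; rewrite ltNge; apply/negP => h'.
  have : (G x `^ p^-1 <= (a%:E `^ p) `^ p^-1)%E by rewrite le_poweR// invr_ge0 ltW.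
  by rewrite poweRKV// leNgt h.
have : ((G x `^ p^-1) `^ p <= a%:E `^ p)%E by rewrite le_poweR ?poweR_ge0// ltW.
by rewrite poweRVK// leNgt h.
Qed.

End power_of_lsc.

Lemma real_locally_lipschitzE {R : realType} {X : pmetricType R} (f : X -> R) :
  real_locally_lipschitz f -> locally_lipschitz (EFin \o f).
Proof.
move=> lf x; have [r r0 [L hL]] := lf x.
exists [set y | mdist x y < r]; first by apply/nbhs_mdist; exists r.
by split=> [y _ //|]; exists L => y z yr zr; exact: hL.
Qed.

Section capacity.
Context {R : realType} {X : pmetricType R}.
Variable mu : {measure set (borel X) -> \bar R}.
Hypotheses (locc : locally_complete X) (sepX : separable_space X).
Hypothesis finite_ball : forall (x : X) (r : R), 0 < r -> (mu (ball x r) < +oo)%E.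
Variables (E F : set X) (p : R).
Hypotheses (closedE : closed E) (closedF : closed F).
Hypothesis EF : (0 < set_dist E F)%E.
Hypothesis p_ge1 : 1 <= p.

Let p0 : 0 < p. Proof. exact: lt_le_trans p_ge1. Qed.

Lemma set_dist_gt0 : exists2 D0 : R, 0 < D0 &
  forall x y, E x -> F y -> D0 <= mdist x y.
Proof.
have h x y : E x -> F y -> (set_dist E F <= (mdist x y)%:E)%E.
  by move=> Ex Fy; apply: ereal_inf_lbound; exists (x, y).
move: EF h; case: (set_dist E F) => [s| |]//.
  by rewrite lte_fin => s0 h; exists s => // x y Ex /(h x y Ex); rewrite lee_fin.
(* An infinite distance would leave [D0] arbitrary. *)
by move=> _ h; exists 1 => // x y Ex /(h x y Ex).
Qed.

(** At each point, either the gluing error is small against the weight and is absorbed by a factor,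
    or it dominates and [H] is at most a constant times the difference of two layers. The first case
    contributes [lam%:E * G], the second a series of integral at most [e]; the other [e] comes from
    the passage to [G]. *)
Lemma capacity_approximation (u g : X -> \bar R) (lam e : R) :
  upper_gradient u g -> (forall x, E x -> u x = 0%E) -> (forall x, F x -> u x = 1%E) ->
  1 < lam -> 0 < e ->
  (Cap mu p W_lip_lip E F <= lam%:E * (\int[mu]_x (g x `^ p) + e%:E) + e%:E)%E.
Proof.
move=> [mg g0 ug] uE uF lam1 e0.
have [D0 D00 hD0] := set_dist_gt0.
have [rho [rho0 rhoL rhoC rhoB]] := exists_completeness_gauge locc point.
have two_gt0 k : 0 < 2 ^- k :> R by rewrite invr_gt0 exprn_gt0.
have rho_cont : continuous rho.
  apply: locally_lipschitz_continuous; apply: (@lipschitz_locally _ _ _ 1) => y z.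
  by rewrite mul1r.
pose V k : set (borel X) := [set x | 2 ^- k < rho x].
pose C k : set (borel X) := [set x | 2 ^- k <= rho x].
have openV k : open (V k : set X).
  rewrite (_ : V k = rho @^-1` [set y | 2 ^- k < y])//.
  by apply: open_comp => [x _|]; [exact: rho_cont | exact: open_gt].
have mC k : measurable (C k) by exact: measurable_gauge_level.
have finC k : (mu (C k) < +oo)%E.
  have b0 : 0 < (2 ^- k)^-1 :> R by rewrite invr_gt0.
  apply: le_lt_trans (finite_ball point b0); apply: le_measure; rewrite ?inE//.
    apply: open_borel; apply/open_mdistP => x; rewrite ballEmdist /= => px.
    exists ((2 ^- k)^-1 - mdist point x); first by rewrite subr_gt0.
    by move=> y; have := metric_triangle point x y;
      move: px; set t := (2 ^- k)^-1; lra.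
  by move=> x Cx; rewrite ballEmdist /=; exact: rhoB.
have finV k : (mu (V k) < +oo)%E.
  apply: le_lt_trans (finC k); apply: le_measure; rewrite ?inE//.
    exact: open_borel.
  by move=> x /ltW.
have coverV x : exists k, V k x.
  have [k hk] := gauge_level_exists rho0 x; exists k.+1; apply: lt_le_trans hk.
  by rewrite ltf_pV2 ?posrE ?exprn_gt0// ltr_eXn2l ?ltr1n.
pose f x := (g x `^ p)%E.
have mf : measurable_fun [set: borel X] (f : borel X -> \bar R).
  by apply: (measurableT_comp (measurable_poweR p)).
have f0 x : (0 <= f x)%E by exact: poweR_ge0.
(* The weight is built for the [p]-th power of [g]; after taking the root this level becomes
   [k.+1]. *)
have b0 k : 0 <= (k.+1%:R : R) `^ p by exact: powR_ge0.
have [G [fG oG iG posG covG]] := lsc_weight openV finV coverV sepX mf f0 b0 e0.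
have G0 x : (0 <= G x)%E by exact: le_trans (f0 x) (fG x).
pose gt x := (G x `^ p^-1)%E.
have gt0 x : (0 <= gt x)%E by exact: poweR_ge0.
have pV0 : 0 <= p^-1 by rewrite invr_ge0 ltW.
have gt_lsc := lsc_root p0 G0 oG.
have g_gt x : (g x <= gt x)%E.
  by rewrite -[leLHS](poweRKV p0 (g0 x)); exact: (le_poweR pV0 (f0 x) (fG x)).
have gt_pos k : exists2 c : R, 0 < c & forall x, 2 ^- k < rho x -> (c%:E <= gt x)%E.
  have [c c0 hc] := posG k; exists (c `^ p^-1); first exact: powR_gt0.
  by move=> x Vx; rewrite -poweR_EFin le_poweR ?lee_fin ?(ltW c0)// hc.
have gt_cover k : exists D : seq X, forall x, 2 ^- k < rho x ->
    ((k.+1%:R)%:E <= gt x)%E \/ exists2 z, z \in D & mdist z x <= k.+1%:R^-1.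
  have [D hD] := covG k; exists D => x Vx; have [h|] := hD x Vx; last by right.
  left; have k0 : (0 <= (k.+1%:R : R)%:E)%E by rewrite lee_fin.
  rewrite -[leLHS](poweRKV p0 k0).
  by apply: le_poweR => //; exact: poweR_ge0.
have gt_adm gamma : rectifiable gamma -> E (gamma 0) -> F (gamma 1) ->
    (1 <= path_integral gt gamma)%E.
  move=> rect E0 F1; apply: (@le_trans _ _ (path_integral g gamma)); last first.
    by apply: le_path_integral => //; exact: lsc_borel_measurable.
  have := ug gamma rect; rewrite uE// uF// sub0e -EFinN /= normrN normr1.
  exact.
(* Two losses of a factor [Q] are allowed, one for the division by [q] and one for absorbing small
   gluing errors; raised to the power [p] they give [lam]. *)
pose Q := lam `^ (2 * p)^-1; pose q := Q^-1.
have lam0 : 0 < lam by lra.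
have Q0 : 0 < Q by exact: powR_gt0.
have pp0 : 0 < (2 * p)^-1 by rewrite invr_gt0 mulr_gt0.
have Q1 : 1 < Q.
  suff : 1 `^ (2 * p)^-1 < Q by rewrite powR1.
  by apply: gt0_ltr_powR; rewrite ?nnegrE// ltW.
have QQp : (Q * Q) `^ p = lam.
  rewrite -(expr2 Q) -powR_mulrn ?(ltW Q0)// -!powRrM.
  by rewrite mulVf ?gt_eqF ?mulr_gt0// powRr1// ltW.
have q0 : 0 < q by rewrite invr_gt0.
have q1 : q < 1 by rewrite invf_lt1.
pose s := 1 - q.
have s0 : 0 < s by rewrite subr_gt0.
(* When the error dominates, [h] is at most [2 ^+ k.+2 / s] times the difference of the layers,
   because [q + s = 1]; division by [q] gives [B k]. *)
pose B k : R := 2 ^+ k.+2 / (q * s).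
have B0 k : 0 < B k by rewrite divr_gt0 ?exprn_gt0 ?mulr_gt0.
pose K k := (B k) `^ p.
have K0 k : 0 < K k by exact: powR_gt0.
have KS k : K k <= K k.+1.
  have BS : B k <= B k.+1.
    by rewrite /B ler_pM2r ?invr_gt0 ?mulr_gt0// ler_eXn2l ?ltr1n.
  by apply: ge0_ler_powR; rewrite ?nnegrE//; exact: ltW.
have [a [psi [lipa psig a01 aEF intA]]] := lipschitz_layers rhoL rhoC finC
  closedE closedF D00 hD0 gt0 gt_lsc gt_pos gt_cover gt_adm K0 KS q1 e0.
have [v [h [vh lh h0 vP hle]]] := glued_function rho0 rhoL
  (fun k => (lipa k).1) (fun k => (lipa k).2) psig.
have vE x : E x -> v x = 0.
  move=> Ex; apply: (vP (fun y => y = 0)) => [y z c -> -> _|k].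
    by rewrite !mulr0 addr0.
  by have [/(_ Ex)] := aEF k x.
have vF x : F x -> q <= v x.
  move=> Fx; apply: (vP (fun y => q <= y)) => [y z c hy hz /andP[c0 c1]|k]; first by nra.
  by have [_ /(_ Fx)] := aEF k x.
pose H x := h x / q.
have H0 x : 0 <= H x by rewrite divr_ge0// ltW.
have lH : real_locally_lipschitz H.
  by apply: locally_lipschitzM => //; exact: locally_lipschitz_cst.
have vH := asymptotic_lip_truncate q0 vh.
have lv := asymptotic_lip_locally_lipschitz vH.
apply: (@le_trans _ _ (\int[mu]_x ((H x)%:E `^ p))%E).
  apply: ereal_inf_lbound.
  exists (EFin \o (fun x => Num.min 1 (v x / q)), EFin \o H) => //=; split.
    split; first exact: asymptotic_lip_upper_gradient.
    by split; exact: real_locally_lipschitzE.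
  split=> x xEF /=.
    by rewrite vE// mul0r min_r.
  by rewrite min_l// ler_pdivlMr// mul1r vF.
pose term k x : \bar R :=
  ((K k)%:E * ((fun x => `|a k x - a k.+1 x|%:E) \_ (C k.+1)) x)%E.
have res0 k x : (0 <= ((fun x => `|a k x - a k.+1 x|%:E) \_ (C k.+1)) x)%E.
  by rewrite patchE; case: ifP => // _; rewrite lee_fin.
have term0 k x : (0 <= term k x)%E by rewrite mule_ge0// lee_fin ltW.
have ma k : measurable_fun [set: borel X] (a k : borel X -> R).
  apply: continuous_borel_measurable; apply: locally_lipschitz_continuous.
  exact: asymptotic_lip_locally_lipschitz (lipa k).1.
have mres k : measurable_fun [set: borel X]
    ((fun x => `|a k x - a k.+1 x|%:E) \_ (C k.+1) : borel X -> \bar R).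
  apply/(measurable_restrictT _ _).1 => //; apply/measurable_EFinP.
  apply: (@measurable_funS _ _ _ _ [set: borel X]) => //.
  by apply: measurableT_comp => //; exact: measurable_funB.
have mterm k : measurable_fun [set: borel X] (term k : borel X -> \bar R).
  exact: measurable_funeM.
have mG : measurable_fun [set: borel X] (G : borel X -> \bar R).
  exact: lsc_borel_measurable.
have bound x : ((H x)%:E `^ p <= lam%:E * G x + \sum_(k <oo) term k x)%E.
  have S0 : (0 <= \sum_(k <oo) term k x)%E by apply: nneseries_ge0 => k _ _.
  have caseA : ((H x)%:E <= (Q * Q)%:E * gt x)%E ->
      ((H x)%:E `^ p <= lam%:E * G x + \sum_(k <oo) term k x)%E.
    move=> hA; apply: (@le_trans _ _ (lam%:E * G x)%E); last by rewrite leeDl.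
    have QQ0 : (0 <= (Q * Q)%:E)%E by rewrite lee_fin mulr_ge0 ?(ltW Q0).
    rewrite -[in leRHS](poweRVK p0 (G0 x)) -QQp -poweR_EFin -(poweRM _ QQ0 (gt0 x)).
    by apply: (le_poweR (ltW p0) _ hA); rewrite lee_fin.
  have HQ : H x = h x * Q by rewrite /H /q invrK.
  have [hg|[i Ci hi]] := hle x.
    apply: caseA; apply: (@le_trans _ _ (Q%:E * gt x)%E).
      by rewrite HQ mulrC EFinM lee_wpmul2l// lee_fin ltW.
    rewrite EFinM -muleA lee_wpmul2l ?lee_fin ?(ltW Q0)//.
    by rewrite -[leLHS]mul1e lee_wpmul2r// lee_fin ltW.
  set D := `|a i x - a i.+1 x| in hi.
  have D0' : 0 <= D by exact: normr_ge0.
  have D1 : D <= 1.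
    by have /andP[? ?] := a01 i x; have /andP[? ?] := a01 i.+1 x; rewrite ler_norml; lra.
  case Egt : (gt x) hi => [r| |]; last 2 first.
  - by move=> _; apply: caseA; rewrite Egt gt0_muley ?leey// lte_fin mulr_gt0.
  - by have := gt0 x; rewrite Egt.
  rewrite -EFinD lee_fin => hi.
  have r0 : 0 <= r by have := gt0 x; rewrite Egt lee_fin.
  have qQ : q * Q = 1 by rewrite /q mulVf// gt_eqF.
  have [small|large] := leP (2 ^+ i.+2 * D * q) (s * r).
    apply: caseA; rewrite Egt HQ -EFinM lee_fin (mulrC (h x)) -mulrA.
    rewrite ler_wpM2l ?(ltW Q0)//.
    suff : h x * q <= r.
      by move=> /(ler_wpM2r (ltW Q0)); rewrite -mulrA qQ mulr1 mulrC.
    have := ler_wpM2r (ltW q0) hi; rewrite /s in small; lra.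
  have HB : H x <= B i * D.
    rewrite /H ler_pdivrMr// /B.
    have -> : 2 ^+ i.+2 / (q * s) * D * q = 2 ^+ i.+2 * D / s.
      by field; rewrite !gt_eqF.
    rewrite ler_pdivlMr//; have := ler_wpM2r (ltW s0) hi; rewrite /s; rewrite /s in large.
    lra.
  apply: (@le_trans _ _ (term i x)); last first.
    apply: (@le_trans _ _ (\sum_(k <oo) term k x)%E); last first.
      by rewrite leeDr// mule_ge0// lee_fin ltW.
    apply: (@le_trans _ _ (\sum_(0 <= k < i.+1) term k x)%E); last first.
      by apply: nneseries_lim_ge.
    by rewrite big_nat_recr//= leeDr// sume_ge0.
  rewrite /term patchE mem_set// -EFinM poweR_EFin lee_fin -/D.
  apply: (@le_trans _ _ ((B i * D) `^ p)).
    by apply: ge0_ler_powR; rewrite ?nnegrE// ?(ltW p0)// mulr_ge0// ltW.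
  rewrite powRM ?(ltW (B0 i))// ler_wpM2l ?(ltW (K0 i))//.
  (* Here L^1 smallness becomes L^p smallness: [D] is at most 1, so its [p]-th power is at most
     [D]. *)
  move: D0'; rewrite le_eqVlt => /predU1P[<-|D0'].
    by rewrite powR0// gt_eqF.
  by rewrite -[leRHS]powRr1 ?(ltW D0')//; apply: ger_powR => //; rewrite D0'.
apply: (@le_trans _ _ (\int[mu]_x (lam%:E * G x + \sum_(k <oo) term k x))%E).
  apply: ge0_le_integral => //.
  - by move=> x _; exact: poweR_ge0.
  - apply: (measurableT_comp (measurable_poweR p)); apply/measurable_EFinP.
    apply: continuous_borel_measurable; exact: locally_lipschitz_continuous.
  - apply: emeasurable_funD; first exact: measurable_funeM.
    exact: ge0_emeasurable_sum.
have lG0 x : (0 <= lam%:E * G x)%E by rewrite mule_ge0// lee_fin ltW.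
rewrite ge0_integralD//; last 3 first.
- exact: measurable_funeM.
- by move=> x _; apply: nneseries_ge0 => k _ _.
- exact: ge0_emeasurable_sum.
apply: leeD.
  by rewrite ge0_integralZl_EFin ?(ltW lam0)// lee_wpmul2l// lee_fin ltW.
rewrite integral_nneseries//.
apply: le_trans (epsilon_trick0 xpredT (ltW e0)).
apply: lee_nneseries => k _; first by move=> _; exact: integral_ge0.
by rewrite /term ge0_integralZl_EFin ?(ltW (K0 k))// -integral_mkcond.
Qed.

Lemma Cap_lip_lip_le : (Cap mu p W_lip_lip E F <= Cap mu p W_all E F)%E.
Proof.
apply: le_ereal_inf_tmp => _ [[u g] [/= ug [uE uF]] <-].
have [Ioo|Ifin] := leP +oo%E (\int[mu]_x (g x `^ p))%E.
  by rewrite (le_trans _ Ioo)// leey.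
have I0 : (0 <= \int[mu]_x (g x `^ p))%E.
  by apply: integral_ge0 => x _; exact: poweR_ge0.
have app := capacity_approximation ug uE uF.
move: app I0 Ifin; case: (\int[mu]_x (g x `^ p))%E => [I| |]// app.
rewrite lee_fin => I0 _; apply/lee_addgt0Pr => e e0.
(* [(1 + d) * (I + d) + d = I + d * (I + 2 + d)], which is at most [I + d * (I + 3)] as [d <= 1]. *)
pose d := Num.min 1 (e / (I + 3)).
have I3 : 0 < I + 3 by lra.
have d0 : 0 < d by rewrite lt_min ltr01 divr_gt0.
have d1 : d <= 1 by rewrite ge_min lexx.
have dI : d * (I + 3) <= e by rewrite -ler_pdivlMr// ge_min lexx orbT.
apply: le_trans (app (1 + d) d _ d0) _; first by rewrite ltrDl.
rewrite [leLHS](_ : _ = ((1 + d) * (I + d) + d)%:E)// -EFinD lee_fin; nra.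
Qed.

End capacity.

Lemma locally_lipschitz_ereal_continuous {R : realType} {X : pmetricType R}
    (f : X -> \bar R) : locally_lipschitz f -> continuous f.
Proof.
move=> lf x; have [U /nbhs_mdist[r r0 hr] [fin [L hL]]] := lf x.
have fx : f x \is a fin_num by apply: fin; apply: hr; rewrite mdistxx.
suff : f @ x --> (fine (f x))%:E by rewrite fineK.
apply/fine_cvgP; split.
  by apply/nbhs_mdist; exists r => // y /hr; exact: fin.
apply/cvgrPdist_lt => e e0; have L0 : 0 < `|L| + 1 by have := normr_ge0 L; lra.
apply/nbhs_mdist; exists (Num.min r (e / (`|L| + 1))) => [|y].
  by rewrite lt_min r0 divr_gt0.
rewrite lt_min ltr_pdivlMr// => /andP[/hr Uy xy].
apply: le_lt_trans (hL x y (hr x _) Uy) _; first by rewrite mdistxx.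
have := mdist_ge0 x y; have := ler_norm L; nra.
Qed.

Lemma le_Cap {R : realType} {X : pmetricType R}
    (mu : {measure set (borel X) -> \bar R}) (p : R)
    (W W' : set ((X -> \bar R) * (X -> \bar R))) (E F : set X) :
  W `<=` W' -> (Cap mu p W' E F <= Cap mu p W E F)%E.
Proof.
move=> WW'; apply: ereal_inf_le_tmp => _ [ug [Wug h] <-].
by exists ug => //; split=> //; exact: WW'.
Qed.

Local Open Scope ereal_scope.

Theorem theorem1p3 (R : realType) (X : pmetricType R)
    (mu : {measure set (borel X) -> \bar R})
    (hcomplete : locally_complete X)
    (hsep : separable_space X)
    (hmu : forall (x : X) (r : R), (0 < r)%R -> 0 < mu (ball x r) < +oo)
    (E F : set X)
    (closedE : closed E) (closedF : closed F)
    (E0 : E !=set0) (F0 : F !=set0)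
    (disjEF : E `&` F = set0)
    (hEF : 0 < set_dist E F)
    (p : R) (hp : (1 <= p)%R) :
  [/\ Cap mu p W_all E F = Cap mu p W_cont E F,
      Cap mu p W_cont E F = Cap mu p W_lip E F &
      Cap mu p W_lip E F = Cap mu p W_lip_lip E F].
Proof.
have finb (x : X) (r : R) : (0 < r)%R -> mu (ball x r) < +oo.
  by move=> /(hmu x) /andP[].
have c1 : Cap mu p W_all E F <= Cap mu p W_cont E F by apply: le_Cap => ug [].
have c2 : Cap mu p W_cont E F <= Cap mu p W_lip E F.
  by apply: le_Cap => ug [Wug lu]; split=> //; exact: locally_lipschitz_ereal_continuous.
have c3 : Cap mu p W_lip E F <= Cap mu p W_lip_lip E F.
  by apply: le_Cap => ug [Wug [lu _]].
have c4 := Cap_lip_lip_le hcomplete hsep finb closedE closedF hEF hp.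
(* The four inequalities form a cycle. *)
split; apply/eqP; rewrite eq_le ?c1 ?c2 ?c3 /=.
- exact: le_trans c2 (le_trans c3 c4).
- exact: le_trans c3 (le_trans c4 c1).
- exact: le_trans c4 (le_trans c1 c2).
Qed.
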